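(* Let $d\ge 2$, let $I_1,\dots,I_d$ be open intervals, and for each $1\le i\le d$ let $\mathbf{X}^i$ be the minimal diffusion process on $I_i$ with scaling function $\mathtt{s}_i$, speed measure $m_i$ and no killing inside. Let $E=I_1\times\cdots\times I_d$, $m=m_1\times\cdots\times m_d$, and let $(\mathcal{E},\mathcal{F})$ be the Dirichlet form on $L^2(E,m)$ of the Cartesian product $\mathbf{X}$ of $\{\mathbf{X}^1,\dots,\mathbf{X}^d\}$. Let $\mathtt{t}_i=\mathtt{s}_i^{-1}$ on $J_i=\mathtt{s}_i(I_i)$, $\mathbf{t}=(\mathtt{t}_1,\dots,\mathtt{t}_d)$ and $U=J_1\times\cdots\times J_d$. Then $C_c^\infty(E)\subset\mathcal{F}$ if and only if $\mathbf{t}$ is absolutely continuous and $\mathbf{t}'\in L^2_{\mathrm{loc}}(U)$.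
   Context: A scaling function on an open interval $I$ is a strictly increasing continuous function $\mathtt{s}:I\to\mathbb{R}$, normalized to vanish at a fixed point of $I$; a speed measure is a fully supported Radon measure on $I$. Absolute continuity on an open interval means on each compact subinterval. The minimal diffusion on $I$ with scaling function $\mathtt{s}$, speed measure $m$ and no killing inside is the diffusion associated with the regular strongly local Dirichlet form on $L^2(I,m)$ given by $\mathcal{E}^{(\mathtt{s},m)}(u,v)=\frac12\int_I\frac{du}{d\mathtt{s}}\frac{dv}{d\mathtt{s}}d\mathtt{s}$ with domain $\mathcal{F}^{(\mathtt{s},m)}_0$, the closure of $\{\varphi\circ\mathtt{s}:\varphi\in C_c^\infty(\mathtt{s}(I))\}$ in the norm $(\mathcal{E}^{(\mathtt{s},m)}(u,u)+\|u\|^2_{L^2(m)})^{1/2}$; for $u=\varphi\circ\mathtt{s}$ with $\varphi$ absolutely continuous, $\frac{du}{d\mathtt{s}}=\varphi'\circ\mathtt{s}$. The Cartesian product $\mathbf{X}$ of $\{\mathbf{X}^1,\dots,\mathbf{X}^d\}$ is the diffusion on $E$ whose coordinate components are independent with $i$-th component equal in distribution to $\mathbf{X}^i$, the boundary of $E$ being a trap. It is $m$-symmetric, and its Dirichlet form on $L^2(E,m)$ is regular; if $\mathcal{C}_i$ is a core of the form $(\mathcal{E}^i,\mathcal{F}^i)$ of $\mathbf{X}^i$, then $\mathcal{C}_1\otimes\cdots\otimes\mathcal{C}_d$ (the span of products $u_1(x_1)\cdots u_d(x_d)$, $u_i\in\mathcal{C}_i$) is a core of $(\mathcal{E},\mathcal{F})$,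 and $\mathcal{E}(u,v)=\sum_{i=1}^d\int \mathcal{E}^i(u_{\hat x_i},v_{\hat x_i})\prod_{j\ne i}m_j(dx_j)$, where $u_{\hat x_i}$ is $u$ viewed as a function of $x_i$ with the other coordinates fixed. $\mathbf{t}$ is called absolutely continuous if each $\mathtt{t}_i$ is; then $\mathbf{t}':=(\mathtt{t}_1',\dots,\mathtt{t}_d')$, and $\mathbf{t}'\in L^2_{\mathrm{loc}}(U)$ if and only if $\mathtt{t}_i'\in L^2_{\mathrm{loc}}(J_i)$ for each $1\le i\le d$. *)

(* Defs.v *)
From HB Require Import structures.
From mathcomp Require Import all_boot all_order all_algebra.
From mathcomp Require Import all_classical all_reals all_analysis.
Set Implicit Arguments.
Unset Strict Implicit.
Unset Printing Implicit Defensive.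
Import Order.TTheory GRing.Theory Num.Theory.
Import numFieldNormedType.Exports.
Local Open Scope classical_set_scope.
Local Open Scope ring_scope.

(* Functions on an open set D of R or R^d are represented by total functions,
   of which only the restriction to D matters; Borel measures on D are
   represented by measures on the whole space carried by D. *)

Notation borelV R d := (g_sigma_algebraType (@open 'rV[R]_d)).

Definition box (R : realType) (d : nat) (A : 'I_d -> set R) : set 'rV[R]_d :=
  [set x | forall i, A i (x ord0 i)].

(* The product measure, by iterated integration of the measures of sections
   (compare product_measure1), splitting R^(n.+1) as R x R^n. *)
Fixpoint prod_measure (R : realType) (n : nat) :
    ('I_n -> set R -> \bar R) -> set 'rV[R]_n -> \bar R :=
  match n with
  | 0 => fun _ A => (\1_A (0 : 'rV[R]_0))%:E
  | n'.+1 => fun mu A =>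
      (\int[mu ord0]_y prod_measure (fun j => mu (lift ord0 j))
         [set z : 'rV[R]_n' | A (row_mx (y%:M : 'rV[R]_1) z)])%E
  end.

Definition supported_in (R : realType) (T : topologicalType)
    (D : set T) (f : T -> R) : Prop :=
  compact (closure [set x | f x != 0]) /\ closure [set x | f x != 0] `<=` D.

Definition Ccinfty1 (R : realType) (J : set R) (f : R -> R) : Prop :=
  (forall n x, derivable (derive1n n f) x 1) /\ supported_in J f.

Definition partials (R : realType) (d : nat) (l : seq 'I_d)
    (f : 'rV[R]_d -> R) : 'rV[R]_d -> R :=
  foldr (fun i g x => 'D_(delta_mx ord0 i) g x) f l.

Definition Ccinfty (R : realType) (d : nat) (E : set 'rV[R]_d)
    (f : 'rV[R]_d -> R) : Prop :=
  (forall l : seq 'I_d, continuous (partials l f) /\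
     forall i x, derivable (partials l f) x (delta_mx ord0 i))
  /\ supported_in E f.

Definition open_interval (R : realType) (I : set R) : Prop :=
  [/\ open I, is_interval I & I !=set0].

Definition scaling_function (R : realType) (I : set R) (s : R -> R) : Prop :=
  [/\ forall x y, I x -> I y -> x < y -> s x < s y,
      forall x, I x -> {for x, continuous s}
    & exists2 x0, I x0 & s x0 = 0].

Definition speed_measure (R : realType) (I : set R)
    (m : {measure set R -> \bar R}) : Prop :=
  [/\ m (~` I) = 0%E,
      forall K, compact K -> K `<=` I -> (m K < +oo)%E
    & forall V, open V -> V `<=` I -> V !=set0 -> (0 < m V)%E].

Definition scale_inv (R : realType) (I : set R) (s : R -> R) : R -> R :=
  'pinv_(fun=> 0) I s.

(* The Lebesgue-Stieltjes measure ds on I. *)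
Definition scale_measure (R : realType) (I : set R) (s : R -> R)
    (A : set R) : \bar R :=
  lebesgue_measure (s @` (A `&` I)).

(* du/ds = phi' \o s for u = phi \o s *)
Definition scale_deriv (R : realType) (I : set R) (s u : R -> R) (x : R) : R :=
  derive1 (u \o scale_inv I s) (s x).

Definition energy (R : realType) (I : set R) (s u v : R -> R) : \bar R :=
  ((2^-1)%:E * \int[scale_measure I s]_(x in I)
     (scale_deriv I s u x * scale_deriv I s v x)%R%:E)%E.

Definition L2 (dd : measure_display) (T : measurableType dd) (R : realType)
    (D : set T) (m : set T -> \bar R) (u : T -> R) : Prop :=
  measurable_fun D u /\ (\int[m]_(x in D) ((u x) ^+ 2)%R%:E < +oo)%E.

Definition scale_core (R : realType) (I : set R) (s u : R -> R) : Prop :=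
  exists2 phi, Ccinfty1 (s @` I) phi & forall x, I x -> u x = phi (s x).

(* [minimal_form I s m u e] : u lies in the closure of the core, i.e. u is the
   L^2(m)-limit of an energy-Cauchy sequence of the core, and its energy, the
   limit of the energies along the sequence, is e. *)
Definition minimal_form (R : realType) (I : set R) (s : R -> R)
    (m : set R -> \bar R) (u : R -> R) (e : R) : Prop :=
  L2 I m u /\
  exists w : nat -> R -> R,
    [/\ forall n, scale_core I s (w n),
        (\int[m]_(x in I) ((w n x - u x) ^+ 2)%R%:E)%E @[n --> \oo] --> 0%E,
        forall eps : R, 0 < eps -> exists N, forall n k,
          (N <= n)%N -> (N <= k)%N ->
          (energy I s (w n \- w k)%R (w n \- w k)%R <= eps%:E)%E
      & energy I s (w n) (w n) @[n --> \oo] --> e%:E].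

(* A Markov process X on D enters through its transition function: p t x is
   the law of X_t on {t < lifetime}, under P_x.  With p_t u (x) the integral
   of u against p t x, this is t^-1 (u - p_t u, u) in L^2(D, m). *)
Definition approx_form (dd : measure_display) (T : measurableType dd)
    (R : realType) (D : set T) (m : set T -> \bar R)
    (p : R -> T -> set T -> \bar R) (t : R) (u : T -> R) : \bar R :=
  ((t^-1)%:E *
    (\int[m]_(x in D) ((u x) ^+ 2)%R%:E
     - \int[m]_(x in D) ((u x)%:E * \int[p t x]_(y in D) (u y)%:E)))%E.

(* u is in the domain of the Dirichlet form on L^2(D, m) of the process and
   e = lim_(t -> 0+) t^-1 (u - p_t u, u) is its energy. *)
Definition dirichlet_form (dd : measure_display) (T : measurableType dd)
    (R : realType) (D : set T) (m : set T -> \bar R)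
    (p : R -> T -> set T -> \bar R) (u : T -> R) (e : R) : Prop :=
  L2 D m u /\ approx_form D m p t u @[t --> 0^'+] --> e%:E.

Definition dirichlet_domain (dd : measure_display) (T : measurableType dd)
    (R : realType) (D : set T) (m : set T -> \bar R)
    (p : R -> T -> set T -> \bar R) (u : T -> R) : Prop :=
  exists e : R, dirichlet_form D m p u e.

(* Only the values p t x for t > 0 and x in I matter. *)
Definition symmetric_transition (R : realType) (I : set R)
    (m : set R -> \bar R) (p : R -> R.-spker R ~> R) : Prop :=
  [/\ forall t x, 0 < t -> I x -> p t x (~` I) = 0%E,
      forall t r x A, 0 < t -> 0 < r -> I x -> measurable A ->
        p (t + r)%R x A = (\int[p t x]_(y in I) p r y A)%E
    & forall t A B, 0 < t -> measurable A -> measurable B ->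
        A `<=` I -> B `<=` I ->
        (\int[m]_(x in A) p t x B = \int[m]_(x in B) p t x A)%E].

(* The process with transition function p is the one associated with the form
   on L^2(I, m) that is the closure of the energy on the core. *)
Definition minimal_diffusion (R : realType) (I : set R) (s : R -> R)
    (m : {measure set R -> \bar R}) (p : R -> R.-spker R ~> R) : Prop :=
  symmetric_transition I m p /\
  forall u e, dirichlet_form I m (fun t x => p t x) u e
              <-> minimal_form I s m u e.

(* Independence of the coordinates: started from x, the law at time t of the
   Cartesian product, before one of the coordinates dies, is the product of
   the laws p i t (x_i). *)
Definition cartesian_product (R : realType) (d : nat)
    (p : 'I_d -> R -> R.-spker R ~> R) :
    R -> 'rV[R]_d -> set 'rV[R]_d -> \bar R :=
  fun t x => prod_measure (fun i => (p i t (x ord0 i) : set R -> \bar R)).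

Definition abs_continuous_on (R : realType) (J : set R) (f : R -> R) : Prop :=
  forall a b : R, `[a, b] `<=` J ->
  forall eps : R, 0 < eps -> exists2 delta : R, 0 < delta &
  forall (n : nat) (l r : 'I_n -> R),
    (forall k, a <= l k /\ l k <= r k /\ r k <= b) ->
    (forall k k', k != k' -> r k <= l k' \/ r k' <= l k) ->
    \sum_(k < n) (r k - l k) < delta ->
    \sum_(k < n) `|f (r k) - f (l k)| < eps.

(* Vector fields on U that are square-integrable on compact subsets of U for
   the d-dimensional Lebesgue measure. *)
Definition L2loc (R : realType) (d : nat) (U : set 'rV[R]_d)
    (g : 'rV[R]_d -> 'rV[R]_d) : Prop :=
  (forall i, measurable_fun (U : set (borelV R d)) (fun y => g y ord0 i)) /\
  forall K, compact K -> K `<=` U ->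
    (\int[(prod_measure (fun _ : 'I_d => (@lebesgue_measure R : set R -> \bar R))
           : set (borelV R d) -> \bar R)]_(y in K)
       (\sum_(i < d) (g y ord0 i) ^+ 2)%R%:E < +oo)%E.

(* Main.v *)
(** Write [phi_r u = |u|^2 - <A_r u, u>] for a symmetric sub-Markov semigroup
    [A] in [L^2]; then [phi_r u / r] increases to the Dirichlet form as [r]
    decreases to 0, and all estimates are made on bounded integrable functions
    at fixed [r].

    Suppose that [t_i] is absolutely continuous with [t_i'] locally square
    integrable. By Cauchy-Schwarz the squared increments of [t_i] over a uniform
    partition of step [h] sum to at most [C h]. Let [g] be Lipschitz with support
    in [[a, b]]. A smooth interpolation of [g o t_i] at the nodes is in the core,
    has bounded energy, and is at squared distance O(h) of [g], so that
    [phi_r g <= C r] with [C] depending only on [a], [b] and on bounds of [g].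
    Applying this on the lines parallel to the axes gives [phi_r f <= C r] for
    every smooth compactly supported [f] on the product.

    Conversely, take [f = (x_i - c) chi(x_1) ... chi(x_d)] with smooth cut-offs
    [chi]. If [f] is in the domain then so is its [i]-th factor in dimension one.
    Along an approximating sequence of core functions, Cauchy-Schwarz bounds the
    sums of [(t_i y - t_i x)^2 / (y - x)] over disjoint intervals. This yields
    absolute continuity and, by Fatou's lemma on difference quotients, local
    square integrability of [t_i']. *)
Require Import Defs.
From HB Require Import structures.
From mathcomp Require Import finmap.
From mathcomp Require Import all_boot all_order all_algebra.
From mathcomp Require Import all_classical all_reals all_analysis measurable_realfun.
From mathcomp Require Import ring lra.
Set Implicit Arguments.
Unset Strict Implicit.
Unset Printing Implicit Defensive.
Import Order.TTheory GRing.Theory Num.Theory.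
Import numFieldNormedType.Exports.
Local Open Scope classical_set_scope.
Local Open Scope ring_scope.

(** * A smooth step *)

(** The form on the product is known only as a limit along the transition function, so the passage
    to dimension one compares semigroups at a fixed time. Write [A = P Q], with [P] moving the first
    coordinate and [Q] the others. Splitting at half times gives
    [phi^A f = phi^Q f + phi^P (Q_{r/2} f)]; as [Q_{r/2} f - f] has squared norm at most [phi^Q f],
    one gets [phi^A <= 2 phi^P + 3 phi^Q], a bound that can be iterated over the coordinates. The
    interpolation error is small in [L^2] only, not in energy. This suffices because [phi_r] is at
    most the squared norm: with [r] fixed and [h] tending to 0 the error disappears. In the
    converse, [phi] of a product of nonnegative functions is a difference of two products, which
    bounds the form of each factor; [c] is the left end of the support of the cut-off, so that
    [(x - c) chi] is nonnegative. Convergence in [L^2] of the speed measure says nothing at a given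
    point, but full support of that measure yields points of good approximation near both ends of
    any interval. *)

Section smooth_functions.
Context {R : realType}.
Implicit Types f g : R -> R.

(** The recursion is on the derivative, so that products, inverses and compositions are treated by
    induction on [n]: their derivatives are built by the same operations from functions of one order
    less. *)
Fixpoint Ck (n : nat) f : Prop :=
  if n is n'.+1 then (forall x, derivable f x 1) /\ Ck n' (derive1 f) else True.

Lemma Ck_derivable n f : Ck n f ->
  forall k x, (k < n)%N -> derivable (derive1n k f) x 1.
Proof.
elim: n f => [//|n IH] f /= [df Cf] [|k] x kn; first exact: df.
by rewrite derive1Sn; exact: IH.
Qed.

Lemma is_derive_derive1 f (x d : R) : is_derive x 1 f d -> (derive1 f) x = d.
Proof. by move=> fd; rewrite derive1E; exact: derive_val. Qed.

Lemma derivable_is_derive1 f (x : R) : derivable f x 1 -> is_derive x 1 f ((derive1 f) x).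
Proof. by move=> df; rewrite derive1E; exact: derivableP. Qed.

Lemma CkS_is_derive n f g : (forall x : R, is_derive x 1 f (g x)) -> Ck n g ->
  Ck n.+1 f.
Proof.
move=> fg Cg; split=> [x|]; first exact: ex_derive.
by suff -> : (derive1 f) = g by []; apply/funext => x; exact: is_derive_derive1.
Qed.

Lemma CkS_elim n f : Ck n.+1 f ->
  (forall x : R, is_derive x 1 f ((derive1 f) x)) /\ Ck n (derive1 f).
Proof. by move=> [df Cf]; split=> // x; exact: derivable_is_derive1. Qed.

Lemma CkW n f : Ck n.+1 f -> Ck n f.
Proof.
by elim: n f => [//|n IH] f [df Cf]; split => //; exact: IH.
Qed.

Lemma Ck_cst n c : Ck n (fun=> c : R).
Proof.
elim: n c => [//|n IH] c.
have H (x : R) : is_derive x 1 (fun=> c) ((fun=> 0 : R) x) by exact: is_derive_cst.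
exact: (CkS_is_derive H).
Qed.

Lemma Ck_id n : Ck n (fun x : R => x).
Proof.
case: n => // n.
have H (x : R) : is_derive x 1 (fun x : R => x) ((fun=> 1 : R) x) by exact: is_derive_id.
by apply: (CkS_is_derive H); exact: Ck_cst.
Qed.

Lemma CkD n f g : Ck n f -> Ck n g -> Ck n (fun x => f x + g x).
Proof.
elim: n f g => [//|n IH] f g /CkS_elim[df Cf] /CkS_elim[dg Cg].
have H (x : R) : is_derive x 1 (fun x => f x + g x)
  ((fun x => derive1 f x + derive1 g x) x) by exact: is_deriveD.
by apply: (CkS_is_derive H); exact: IH.
Qed.

Lemma CkM n f g : Ck n f -> Ck n g -> Ck n (fun x => f x * g x).
Proof.
elim: n f g => [//|n IH] f g Cf Cg.
have [df Cf'] := CkS_elim Cf; have [dg Cg'] := CkS_elim Cg.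
have H (x : R) : is_derive x 1 (fun x => f x * g x)
  ((fun x => f x * derive1 g x + g x * derive1 f x) x) by exact: is_deriveM.
by apply: (CkS_is_derive H); apply: CkD; apply: IH => //; exact: CkW.
Qed.

Lemma Ck_comp n f g : Ck n f -> Ck n g -> Ck n (fun x => f (g x)).
Proof.
elim: n f g => [//|n IH] f g Cf Cg.
have [df Cf'] := CkS_elim Cf; have [dg Cg'] := CkS_elim Cg.
have H (x : R) : is_derive x 1 (fun x => f (g x))
  ((fun x => derive1 f (g x) * derive1 g x) x).
  exact: (is_derive1_comp (df (g x)) (dg x)).
by apply: (CkS_is_derive H); apply: CkM => //; apply: IH => //; exact: CkW.
Qed.

Lemma Ck_inv n f : (forall x, f x != 0) -> Ck n f -> Ck n (fun x => (f x)^-1).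
Proof.
elim: n f => [//|n IH] f f0 Cf; have [df Cf'] := CkS_elim Cf.
have H (x : R) : is_derive x 1 (fun x => (f x)^-1)
    ((fun x => (-1) * ((f x)^-1 * (f x)^-1) * derive1 f x) x).
  by have := is_deriveV (f0 x) (df x); rewrite mulN1r -invfM expr2.
apply: (CkS_is_derive H).
apply: CkM => //; apply: CkM; first exact: Ck_cst.
by apply: CkM; apply: IH => //; exact: CkW.
Qed.

Lemma Ck_sum n (m : nat) (F : nat -> R -> R) : (forall i, Ck n (F i)) ->
  Ck n (fun x => \sum_(i < m) F i x).
Proof.
move=> CF; elim: m => [|m IH].
  by under eq_fun do rewrite big_ord0; exact: Ck_cst.
by under eq_fun do rewrite big_ord_recr /=; exact: CkD.
Qed.

(** The usual flat function is [flat 0]. The negative powers of [x] are added because the linear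
    span of the family is closed under differentiation. *)
Let flat (k : nat) (x : R) : R := if 0 < x then x ^- k * expR (- x^-1) else 0.

Let flatS k (h : R) : h^-1 * flat k h = flat k.+1 h.
Proof.
rewrite /flat; case: ifPn => [h0|]; last by rewrite mulr0.
by rewrite mulrA -invfM -exprS.
Qed.

Let flat_ge0 k h : 0 <= flat k h.
Proof.
rewrite /flat; case: ifPn => // h0; rewrite mulr_ge0 ?expR_ge0//.
by rewrite invr_ge0 exprn_ge0// ltW.
Qed.

(** From [u <= expR u] at [u = h^-1 / (k+1)], raised to the power [k+1]. One factor [h] is left
    over, which forces the limit 0 at the origin. *)
Let flat_le k h : flat k h <= k.+1%:R ^+ k.+1 * `|h|.
Proof.
rewrite /flat; case: ifPn => [h0|]; last first.
  by rewrite mulr_ge0// exprn_ge0// ler0n.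
have k0 : 0 < k.+1%:R :> R by rewrite ltr0n.
have hk : 0 < h ^+ k.+1 by rewrite exprn_gt0.
rewrite gtr0_norm// expRN.
have H : (h^-1 / k.+1%:R) ^+ k.+1 <= expR h^-1.
  have -> : expR h^-1 = expR (h^-1 / k.+1%:R) ^+ k.+1.
    by rewrite -expRM_natr divfK// gt_eqF.
  rewrite lerXn2r ?nnegrE ?expR_ge0//; first by rewrite divr_ge0// ?invr_ge0 ltW.
  by apply: le_trans (expR_ge1Dx _); rewrite lerDr.
rewrite -[leLHS]/(_ / _) ler_pdivrMr ?expR_gt0//.
apply: le_trans (ler_wpM2l _ H); last first.
  by rewrite mulr_ge0 ?exprn_ge0// ltW.
move: (k.+1%:R) k0 => K K0; rewrite exprMn !exprVn (exprS h k) (exprS K k).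
rewrite [leRHS](_ : _ = h ^- k)//; field.
by rewrite ?expf_neq0 ?gt_eqF.
Qed.

Lemma is_derive_near_cst f (x c : R) : (\near x, f x = c) -> is_derive x 1 f 0.
Proof.
move=> fc; have H : is_derive x 1 (fun=> c : R) 0 by exact: is_derive_cst.
by apply: near_eq_is_derive H; near=> y; apply/esym; near: y.
Unshelve. all: by end_near. Qed.

Let near_gt (x a : R) : a < x -> \forall y \near x, a < y.
Proof.
move=> ax; exists (x - a) => /=; first by rewrite subr_gt0.
by move=> y /=; rewrite ltr_distlC => /andP[+ _]; rewrite subKr.
Qed.

(** The delicate point is the origin: the difference quotient of [flat k] there is [flat k.+1],
    which tends to 0 by [flat_le]. *)
Let flat_derive k (x : R) :
  is_derive x 1 (flat k) (flat k.+2 x + (- k%:R) * flat k.+1 x).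
Proof.
have [x0|x0|->] := ltgtP x 0.
- have H y : y < 0 -> forall j, flat j y = 0.
    by move=> y0 j; rewrite /flat ltNge ltW.
  rewrite !H// mulr0 addr0.
  apply: (@is_derive_near_cst _ _ 0).
  by near=> y; rewrite H//; near: y; exact: lt_nbhsl.
- have N : \near x, (fun y => y ^- k * expR (- y^-1)) x = flat k x.
    by near=> y; rewrite /flat ifT//; near: y; exact: near_gt.
  have x0' : x != 0 by rewrite gt_eqF.
  have dx : is_derive x 1 (fun y : R => y^-1) (- x ^- 2).
    have := @is_deriveV R id x 1 1 x0' (is_derive_id _ _).
    by rewrite /= [_ *: 1]mulr1.
  have d1 : is_derive x 1 (fun y : R => expR (- y^-1)) (expR (- x^-1) * x ^- 2).
    have := @is_derive1_comp R expR (fun y => - y^-1) x _ _ (is_derive_expR _)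
      (is_deriveN dx).
    by rewrite opprK.
  have d2 : is_derive x 1 (fun y : R => (y^-1) ^+ k) (k%:R * x^-1 ^+ k.-1 * (- x ^- 2)).
    have := @is_deriveX R _ (fun y : R => y^-1) k x 1 _ dx.
    rewrite (_ : (fun y : R => y^-1 ^+ k) = [eta GRing.inv] ^+ k)//.
    by apply/funext => y; rewrite exprfctE.
  have H : is_derive x 1 (fun y => y ^- k * expR (- y^-1))
      (x^-1 ^+ k * (expR (- x^-1) * x ^- 2) +
       expR (- x^-1) * (k%:R * x^-1 ^+ k.-1 * (- x ^- 2))).
    have -> : (fun y : R => y ^- k * expR (- y^-1)) =
      ((fun y => y^-1 ^+ k) * (fun y => expR (- y^-1))).
      by apply/funext => y; rewrite -exprVn.
    exact: (is_deriveM d2 d1).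
  suff -> : flat k.+2 x + (- k%:R) * flat k.+1 x =
    x^-1 ^+ k * (expR (- x^-1) * x ^- 2) +
       expR (- x^-1) * (k%:R * x^-1 ^+ k.-1 * (- x ^- 2)).
    exact: (near_eq_is_derive N H).
  rewrite /flat x0; case: k {d2 H N} => [|k] /=.
    by rewrite expr0 expr1; field.
  rewrite !exprVn (exprS x k.+2) (exprS x k.+1) (exprS x k) expr2.
  move: (k.+1%:R : R) => N; move: (x ^+ k) (expf_neq0 k x0') => X X0.
  by field; rewrite X0 x0'.
- have f0 j : flat j 0 = 0 by rewrite /flat ltxx.
  rewrite !f0 mulr0 addr0.
  apply: DeriveDef.
    apply/cvg_ex; exists 0; apply/cvgrPdist_le => e e0; near=> h.
    rewrite /= /GRing.scale /= mulr1 addr0 f0 subr0 sub0r normrN flatS.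
    rewrite ger0_norm//; apply: le_trans (flat_le _ _) _.
    rewrite -ler_pdivlMl ?exprn_gt0 ?ltr0n//.
    near: h; apply: dnbhs0_le; rewrite mulr_gt0// invr_gt0 exprn_gt0 ?ltr0n//.
  apply/cvg_lim => //; apply/cvgrPdist_le => e e0; near=> h.
  rewrite /= /GRing.scale /= mulr1 addr0 f0 subr0 sub0r normrN flatS.
  rewrite ger0_norm//; apply: le_trans (flat_le _ _) _.
  rewrite -ler_pdivlMl ?exprn_gt0 ?ltr0n//.
  near: h; apply: dnbhs0_le; rewrite mulr_gt0// invr_gt0 exprn_gt0 ?ltr0n//.
Unshelve. all: by end_near. Qed.

Let flat_Ck n k : Ck n (flat k).
Proof.
elim: n k => [//|n IH] k; apply: (CkS_is_derive (flat_derive k)).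
by apply: CkD => //; apply: CkM => //; exact: Ck_cst.
Qed.

(** The witness is [e x / (e x + e (1 - x))] with [e] the flat function. The last clause, a bounded
    derivative that vanishes off the open unit interval, is what the energy of an interpolation is
    estimated from. *)
Lemma smooth_transition : exists sg : R -> R,
  [/\ forall n, Ck n sg, forall x, x <= 0 -> sg x = 0,
      forall x, 1 <= x -> sg x = 1, forall x, 0 <= sg x <= 1
    & exists B : R, forall x : R, `|derive1 sg x| <= B * (0 < x < 1)%R%:R].
Proof.
pose e := flat 0; pose D x := e x + e (1 - x).
have e_gt0 x : 0 < x -> 0 < e x.
  by move=> x0; rewrite /e /flat x0 expr0 invr1 mul1r expR_gt0.
have e_le0 x : x <= 0 -> e x = 0 by move=> x0; rewrite /e /flat ltNge x0.
have e_ge0 x : 0 <= e x by exact: flat_ge0.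
have D0 x : 0 < D x.
  have [x0|x0] := ltP 0 x; first by rewrite ltr_wpDr// e_gt0.
  by rewrite ltr_wpDl// e_gt0// subr_gt0 (le_lt_trans x0).
pose sg x := e x * (D x)^-1.
have sgC n : Ck n sg.
  apply: CkM; first exact: flat_Ck.
  apply: Ck_inv => [x|]; first by rewrite gt_eqF.
  apply: CkD; first exact: flat_Ck.
  apply: Ck_comp; first exact: flat_Ck.
  apply: CkD; first exact: Ck_cst.
  have -> : -%R = (fun x : R => (-1) * x) by apply/funext => x; rewrite mulN1r.
  by apply: CkM; [exact: Ck_cst|exact: Ck_id].
have sg0 x : x <= 0 -> sg x = 0 by move=> x0; rewrite /sg e_le0// mul0r.
have sg1 x : 1 <= x -> sg x = 1.
  move=> x1; rewrite /sg /D (e_le0 (1 - x)) ?subr_le0// addr0 divff//.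
  by rewrite gt_eqF// e_gt0// (lt_le_trans ltr01).
have sg01 x : 0 <= sg x <= 1.
  apply/andP; split; first by rewrite /sg divr_ge0// ltW.
  by rewrite /sg ler_pdivrMr// mul1r lerDl; exact: e_ge0.
have dsg (x : R) : derivable sg x 1 by exact: (@Ck_derivable 1 _ (sgC 1) 0 x).
have xin (x : R) : x \in `](x - 1), (x + 1)[ by rewrite in_itv/= gtrBl ltrDl ltr01.
have xle (x : R) : x - 1 <= x + 1 by rewrite lerD2l; lra.
(* Where [sg] takes the value 0 or 1 it has an extremum, so its derivative vanishes there, the
   points 0 and 1 included. *)
have sg'0 x : x <= 0 -> derive1 sg x = 0.
  move=> x0; apply: is_derive_derive1; apply: (derive1_at_min (xle x)) => // y _.
  by rewrite (sg0 _ x0); have /andP[] := sg01 y.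
have sg'1 x : 1 <= x -> derive1 sg x = 0.
  move=> x1; apply: is_derive_derive1; apply: (derive1_at_max (xle x)) => // y _.
  by rewrite (sg1 _ x1); have /andP[] := sg01 y.
exists sg; split => //.
have cs : continuous (derive1 sg).
  move=> x; apply: differentiable_continuous; apply/derivable1_diffP.
  exact: (@Ck_derivable 2 _ (sgC 2) 1 x).
have [c _ cmax] := @EVT_max R (fun x => `|derive1 sg x|) 0 1 ler01
  (continuous_subspaceT (fun x => continuous_comp (cs x) (@norm_continuous _ _ _))).
exists `|derive1 sg c| => x.
have [x0|x0] := leP x 0; first by rewrite sg'0 ?mulr0 ?normr0.
have [x1|x1] := leP 1 x; first by rewrite sg'1 ?mulr0 ?normr0.
by rewrite mulr1 cmax// in_itv/= !ltW.
Qed.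

End smooth_functions.

(** * Symmetric sub-Markov semigroups and their products *)

Section sfm.
Local Open Scope ereal_scope.
Context {R : realType}.

(** The set functions of the statement, such as [prod_measure], are bare functions without canonical
    structure. Equality with a bundled measure can be destructed wherever integration theory is
    called upon. *)
Definition sfm d (T : measurableType d) (m : set T -> \bar R) : Prop :=
  exists m' : {sigma_finite_measure set T -> \bar R}, m = m'.

Section sigma_finite_copy.
Context d (T : measurableType d) (m : {measure set T -> \bar R}).
Hypothesis sm : sigma_finite setT m.

Definition sigma_finite_copy of sigma_finite setT m : set T -> \bar R := m.

HB.instance Definition _ := Measure.copy (sigma_finite_copy sm) m.

HB.instance Definition _ :=
  Measure_isSigmaFinite.Build d T R (sigma_finite_copy sm) sm.

Lemma sigma_finite_sfm : sfm m.
Proof. by exists (sigma_finite_copy sm). Qed.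

End sigma_finite_copy.

Lemma finite_sfm d (T : measurableType d) (m : {measure set T -> \bar R}) :
  m setT < +oo -> sfm m.
Proof.
move=> mT; apply: sigma_finite_sfm; exists (fun=> setT).
  by rewrite bigcup_const.
by move=> i; split.
Qed.

Lemma eq_integralT d (T : measurableType d) (m : set T -> \bar R) f g : f =1 g ->
  \int[m]_x f x = \int[m]_x g x.
Proof. by move=> fg; congr integral; apply/funext. Qed.

Lemma sfm_integral_ge0 d (T : measurableType d) (m : set T -> \bar R) f : sfm m ->
  (forall x, 0 <= f x) -> 0 <= \int[m]_x f x.
Proof. by move=> [m' ->] f0; exact: integral_ge0. Qed.

Section tonelli.
Context d1 d2 (T1 : measurableType d1) (T2 : measurableType d2).
Variables (m1 : set T1 -> \bar R) (m2 : set T2 -> \bar R) (f : T1 * T2 -> \bar R).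
Hypotheses (mf : measurable_fun setT f) (f0 : forall z, 0 <= f z).

Lemma sfm_tonelli : sfm m1 -> sfm m2 ->
  \int[m1]_x \int[m2]_y f (x, y) = \int[m2]_y \int[m1]_x f (x, y).
Proof. by move=> [m1' ->] [m2' ->]; exact: fubini_tonelli. Qed.

Lemma sfm_measurable_intr : sfm m2 ->
  measurable_fun setT (fun x => \int[m2]_y f (x, y)).
Proof. by move=> [m2' ->]; exact: measurable_fun_fubini_tonelli_F. Qed.

Lemma sfm_measurable_intl : sfm m1 ->
  measurable_fun setT (fun y => \int[m1]_x f (x, y)).
Proof. by move=> [m1' ->]; exact: measurable_fun_fubini_tonelli_G. Qed.

End tonelli.

End sfm.

Section ssg.
Local Open Scope ereal_scope.
Context {R : realType}.

(* symmetric sub-Markov semigroup of kernels [K t x], for [t > 0] *)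
Record ssg d (T : measurableType d) (m : set T -> \bar R)
    (K : R -> T -> set T -> \bar R) : Prop := SSG {
  ssg_sfm : sfm m ;
  ssg_sub : forall t x, (0 < t)%R ->
    exists k : {measure set T -> \bar R}, K t x = k /\ k setT <= 1 ;
  ssg_meas : forall t, (0 < t)%R -> forall d' (S : measurableType d')
    (f : S * T -> \bar R), measurable_fun setT f -> (forall z, 0 <= f z) ->
    measurable_fun setT (fun z : S * T => \int[K t z.2]_y f (z.1, y)) ;
  ssg_ck : forall t r, (0 < t)%R -> (0 < r)%R -> forall f : T -> \bar R,
    measurable_fun setT f -> (forall z, 0 <= f z) -> forall x,
    \int[K (t + r)%R x]_y f y = \int[K t x]_y \int[K r y]_z f z ;
  ssg_sym : forall t, (0 < t)%R -> forall f g : T -> \bar R,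
    measurable_fun setT f -> (forall z, 0 <= f z) ->
    measurable_fun setT g -> (forall z, 0 <= g z) ->
    \int[m]_x (f x * \int[K t x]_y g y) = \int[m]_x (g x * \int[K t x]_y f y) }.

Lemma ssg_ksfm d (T : measurableType d) m (K : R -> T -> set T -> \bar R) t x :
  ssg m K -> (0 < t)%R -> sfm (K t x).
Proof.
move=> H t0; have [k [-> k1]] := ssg_sub H x t0.
by apply: finite_sfm; rewrite (le_lt_trans k1)// ltry.
Qed.

Lemma ssg_meas1 d (T : measurableType d) m (K : R -> T -> set T -> \bar R) t f :
  ssg m K -> (0 < t)%R -> measurable_fun setT f -> (forall z, 0 <= f z) ->
  measurable_fun setT (fun x => \int[K t x]_y f y).
Proof.
move=> H t0 mf f0.
have := @ssg_meas _ _ _ _ H t t0 _ unit (fun z => f z.2).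
move=> /(_ (measurableT_comp mf measurable_snd) (fun z => f0 _)).
exact: (measurable_fun_pair2 tt).
Qed.

(** The identity semigroup. It freezes one group of coordinates of a product, and it is the whole
    product semigroup in dimension 0. *)
Lemma ssg_dirac d (T : measurableType d) (m : set T -> \bar R) : sfm m ->
  ssg m (fun _ x => \d_x).
Proof.
move=> sm.
have dE (f : T -> \bar R) x : measurable_fun setT f ->
    \int[\d_x]_y f y = f x.
  by move=> mf; rewrite integral_dirac// diracT mul1e.
split=> //.
- by move=> t x _; exists (\d_x : {measure set T -> \bar R}); split=> //=; rewrite diracE in_setT.
- move=> t t0 d' S f mf f0.
  under eq_fun => z do rewrite (dE (fun y => f (z.1, y)) _ (measurable_fun_pair2 _ mf)).
  by under eq_fun => z do rewrite -surjective_pairing.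
- move=> t r _ _ f mf f0 x; rewrite !dE//.
  by under eq_fun => z do rewrite dE//.
- move=> t _ f g mf f0 mg g0.
  by apply: eq_integralT => x; rewrite !dE// muleC.
Qed.

(** * Products of two measures and of two semigroups *)

Section tens.
Context d1 d2 d (T1 : measurableType d1) (T2 : measurableType d2)
  (T : measurableType d).
Variables (psi : T1 * T2 -> T) (p1 : T -> T1) (p2 : T -> T2).
Hypotheses (mpsi : measurable_fun setT psi) (mp1 : measurable_fun setT p1)
  (mp2 : measurable_fun setT p2).
Hypotheses (psiK1 : forall z, p1 (psi z) = z.1) (psiK2 : forall z, p2 (psi z) = z.2).

(** The product measure transported by [psi]. The body is such that, for [psi := @vcons d], it is
    convertible to the recursive clause of [prod_measure]. *)
Definition tens (m1 : set T1 -> \bar R) (m2 : set T2 -> \bar R)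
    (A : set T) : \bar R :=
  \int[m1]_s m2 [set z | A (psi (s, z))].

Let tensE (m1 : {sigma_finite_measure set T1 -> \bar R})
    (m2 : {sigma_finite_measure set T2 -> \bar R}) :
  tens m1 m2 = pushforward (m1 \x m2) psi.
Proof.
apply/funext => A; rewrite /tens /pushforward /product_measure1.
apply: eq_integral => s _ /=; congr (m2 _); apply/seteqP; split=> z /=.
  by rewrite /xsection /= inE.
by rewrite /xsection /= inE.
Qed.

Lemma tens_sfm m1 m2 : sfm m1 -> sfm m2 -> sfm (tens m1 m2).
Proof.
move=> [m1' ->] [m2' ->]; rewrite tensE.
have /sigma_finiteP[F [TF ndF Foo]] := sigma_finiteT m1'.
have /sigma_finiteP[G [TG ndG Goo]] := sigma_finiteT m2'.
pose pm : {measure set T -> \bar R} :=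
  measure_function_pushforward__canonical__measure_function_Measure (m1' \x m2') mpsi.
apply: (sigma_finite_sfm (m := pm)).
exists (fun n => p1 @^-1` F n `&` p2 @^-1` G n).
  apply/seteqP; split => // x _.
  have [k _ Fk] : (\bigcup_n F n) (p1 x) by rewrite -TF.
  have [l _ Gl] : (\bigcup_n G n) (p2 x) by rewrite -TG.
  exists (maxn k l) => //; split => /=.
    by move: Fk; apply/subsetPset/ndF/leq_maxl.
  by move: Gl; apply/subsetPset/ndG/leq_maxr.
move=> n; have [mF FF] := Foo n; have [mG GG] := Goo n; split.
  by apply: measurableI; rewrite -[X in measurable X]setTI; [exact: mp1|exact: mp2].
rewrite /pm /= /pushforward (_ : psi @^-1` _ = F n `*` G n); last first.
  by apply/seteqP; split=> -[a b] /=; rewrite psiK1 psiK2.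
by rewrite product_measure1E// lte_mul_pinfty// ge0_fin_numE.
Qed.

Lemma tens_int m1 m2 f : sfm m1 -> sfm m2 -> measurable_fun setT f ->
  (forall x, 0 <= f x) ->
  \int[tens m1 m2]_x f x = \int[m1]_s \int[m2]_z f (psi (s, z)).
Proof.
move=> [m1' ->] [m2' ->] mf f0; rewrite tensE ge0_integral_pushforward//.
rewrite preimage_setT fubini_tonelli1//; first exact: measurableT_comp.
by move=> x; exact: f0.
Qed.

Lemma tens_fin (m1 : {measure set T1 -> \bar R}) (m2 : {measure set T2 -> \bar R}) :
  m1 setT <= 1 -> m2 setT <= 1 ->
  exists k : {measure set T -> \bar R}, tens m1 m2 = k /\ k setT <= 1.
Proof.
move=> m11 m21.
have s1 : sfm m1 by apply: finite_sfm; rewrite (le_lt_trans m11)// ltry.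
have s2 : sfm m2 by apply: finite_sfm; rewrite (le_lt_trans m21)// ltry.
have [k kE] := tens_sfm s1 s2; exists k; split => //.
apply: (@le_trans _ _ (\int[k]_(x in setT) 1)); first by rewrite integral_cst// mul1e.
rewrite -kE tens_int//.
under eq_integral do rewrite integral_cst// mul1e.
rewrite integral_cst//.
rewrite -[leRHS]mule1; exact: lee_pmul.
Qed.

Variables (m1 : set T1 -> \bar R) (m2 : set T2 -> \bar R).
Variables (K1 : R -> T1 -> set T1 -> \bar R) (K2 : R -> T2 -> set T2 -> \bar R).
Hypotheses (H1 : ssg m1 K1) (H2 : ssg m2 K2).

Lemma ktens_int t f : (0 < t)%R -> measurable_fun setT f ->
  (forall x, 0 <= f x) -> forall x1 x2,
  \int[tens (K1 t x1) (K2 t x2)]_x f x =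
  \int[K1 t x1]_s \int[K2 t x2]_z f (psi (s, z)).
Proof. 
move=> t0 mf f0 x1 x2.
exact: (tens_int (ssg_ksfm x1 H1 t0) (ssg_ksfm x2 H2 t0)). Qed.

(** The parameter space allowed in [ssg_meas] makes this possible: the inner integral is measurable
    with parameters in [S * T1], and it is then the integrand of the outer kernel, with parameters
    in [S * T2]. *)
Let mpart t d' (S : measurableType d') (f : S * T -> \bar R) : (0 < t)%R ->
  measurable_fun setT f -> (forall z, 0 <= f z) ->
  measurable_fun setT (fun z : S * T => \int[K1 t (p1 z.2)]_s
    \int[K2 t (p2 z.2)]_u f (z.1, psi (s, u))).
Proof.
move=> t0 mf f0.
pose F (z : (S * T1) * T2) := f (z.1.1, psi (z.1.2, z.2)).
have mF : measurable_fun setT F.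
  apply: (measurableT_comp mf); apply: measurable_fun_pair.
    by apply: measurableT_comp => //; exact: measurable_fst.
  apply: (measurableT_comp mpsi); apply: measurable_fun_pair => //.
  by apply: measurableT_comp => //; exact: measurable_snd.
have mG := ssg_meas H2 t0 mF (fun=> f0 _).
pose G (z : (S * T2) * T1) := \int[K2 t z.1.2]_y F ((z.1.1, z.2), y).
have mG' : measurable_fun setT G.
  apply: (measurableT_comp mG (g := fun z : (S * T2) * T1 => ((z.1.1, z.2), z.1.2))).
  apply: measurable_fun_pair.
    apply: measurable_fun_pair => //.
    by apply: measurableT_comp => //; exact: measurable_fst.
  by apply: measurableT_comp => //; exact: measurable_snd.
have G0 z : 0 <= G z.
  by rewrite /G; apply: sfm_integral_ge0 (ssg_ksfm _ H2 t0) (fun y => f0 _).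
have mH := ssg_meas H1 t0 mG' G0.
apply: (measurableT_comp mH (g := fun z : S * T => ((z.1, p2 z.2), p1 z.2))).
apply: measurable_fun_pair; last by apply: measurableT_comp => //.
by apply: measurable_fun_pair => //; exact: measurableT_comp.
Qed.

(** Tonelli's theorem reduces each property to the factors. For Chapman-Kolmogorov, the middle two
    of the four kernel integrals are exchanged. For symmetry, the kernels are moved one at a time:
    [K2] under [m2] with the first coordinate fixed, then [K1] under [m1]. *)
Lemma ssg_tens : ssg (tens m1 m2) (fun t x => tens (K1 t (p1 x)) (K2 t (p2 x))).
Proof.
have s1 := ssg_sfm H1; have s2 := ssg_sfm H2.
have k1s t x : (0 < t)%R -> sfm (K1 t x) by exact: (ssg_ksfm x H1).
have k2s t x : (0 < t)%R -> sfm (K2 t x) by exact: (ssg_ksfm x H2).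
have mf2 (f : T -> \bar R) : measurable_fun setT f ->
    measurable_fun setT (f \o psi).
  by move=> mf; exact: measurableT_comp.
have mC t (f : T -> \bar R) : (0 < t)%R -> measurable_fun setT f ->
    (forall z, 0 <= f z) -> measurable_fun setT (fun y =>
      \int[tens (K1 t (p1 y)) (K2 t (p2 y))]_z f z).
  move=> t0 mf f0; under eq_fun => y do rewrite (ktens_int t0 mf f0).
  have := @mpart t _ unit (f \o snd) t0.
  move=> /(_ (measurableT_comp mf measurable_snd) (fun=> f0 _)).
  exact: (measurable_fun_pair2 tt).
have C0 t (f : T -> \bar R) y : (0 < t)%R -> (forall z, 0 <= f z) ->
    0 <= \int[tens (K1 t (p1 y)) (K2 t (p2 y))]_z f z.
  by move=> t0 f0; apply: sfm_integral_ge0 => //; apply: tens_sfm; [exact: k1s|exact: k2s].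
have mI t (f : T1 * T2 -> \bar R) : (0 < t)%R -> measurable_fun setT f ->
    (forall z, 0 <= f z) ->
    measurable_fun setT (fun z : T1 * T2 => \int[K2 t z.2]_u f (z.1, u)).
  by move=> t0 mf f0; exact: (ssg_meas H2 t0 mf).
have I0 t (f : T1 * T2 -> \bar R) : (0 < t)%R -> (forall z, 0 <= f z) ->
    forall z : T1 * T2, 0 <= \int[K2 t z.2]_u f (z.1, u).
  by move=> t0 f0 z; apply: sfm_integral_ge0 => //; exact: k2s.
have mJ t (f : T1 * T2 -> \bar R) : (0 < t)%R -> measurable_fun setT f ->
    (forall z, 0 <= f z) ->
    measurable_fun setT (fun z : T1 * T2 => \int[K1 t z.1]_u f (u, z.2)).
  move=> t0 mf f0.
  have mfs : measurable_fun setT (f \o unstable.swap).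
    by apply: measurableT_comp => //; exact: measurable_swap.
  exact: (measurableT_comp (ssg_meas H1 t0 mfs (fun=> f0 _)) (@measurable_swap _ _ T1 T2)).
have J0 t (f : T1 * T2 -> \bar R) : (0 < t)%R -> (forall z, 0 <= f z) ->
    forall z : T1 * T2, 0 <= \int[K1 t z.1]_u f (u, z.2).
  by move=> t0 f0 z; apply: sfm_integral_ge0 => //; exact: k1s.
split.
- exact: tens_sfm.
- move=> t x t0; have [k1 [-> k11]] := ssg_sub H1 (p1 x) t0.
  by have [k2 [-> k21]] := ssg_sub H2 (p2 x) t0; exact: tens_fin.
- move=> t t0 d' S f mf f0.
  under eq_fun => z do rewrite (ktens_int t0 (measurable_fun_pair2 _ mf) (fun=> f0 _)).
  exact: mpart.
- move=> t r t0 r0 f mf f0 x.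
  have tr0 : (0 < t + r)%R by exact: addr_gt0.
  rewrite (ktens_int tr0 mf f0).
  have mIf := mI r _ r0 (mf2 _ mf) (fun=> f0 _).
  have If0 := I0 r (f \o psi) r0 (fun=> f0 _).
  transitivity (\int[K1 (t + r)%R (p1 x)]_s
     \int[K2 t (p2 x)]_v \int[K2 r v]_u f (psi (s, u))).
    apply: eq_integralT => s; apply: (ssg_ck H2) => //.
    exact: (measurable_fun_pair2 s (mf2 _ mf)).
  rewrite (ssg_ck H1) //; first last.
    by move=> s; apply: sfm_integral_ge0 => [|v]; [exact: k2s|exact: (If0 (s, v))].
    exact: (sfm_measurable_intr mIf If0 (k2s _ _ t0)).
  rewrite ktens_int//; [|exact: mC|by move=> y; exact: C0].
  apply: eq_integralT => a.
  have := sfm_tonelli mIf If0 (k1s _ a r0) (k2s _ (p2 x) t0) => /= ->.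
  by apply: eq_integralT => b; rewrite psiK1 psiK2 ktens_int.
- move=> t t0 f g mf f0 mg g0.
  have mfp := mf2 _ mf; have mgp := mf2 _ mg.
  have mM (h k : T -> \bar R) : measurable_fun setT h -> measurable_fun setT k ->
      (forall z, 0 <= k z) -> measurable_fun setT
        (fun x => h x * \int[tens (K1 t (p1 x)) (K2 t (p2 x))]_y k y).
    by move=> mh mk k0; exact: (emeasurable_funM mh (mC t k t0 mk k0)).
  have M0 (h k : T -> \bar R) : (forall z, 0 <= h z) -> (forall z, 0 <= k z) ->
      forall x, 0 <= h x * \int[tens (K1 t (p1 x)) (K2 t (p2 x))]_y k y.
    by move=> h0 k0 x; exact: (mule_ge0 (h0 x) (C0 t k x t0 k0)).
  rewrite (tens_int s1 s2 (mM f g mf mg g0) (M0 f g f0 g0)).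
  rewrite (tens_int s1 s2 (mM g f mg mf f0) (M0 g f g0 f0)).
  pose F (z : T1 * T2) := \int[K2 t z.2]_u f (psi (z.1, u)).
  pose G (z : T1 * T2) := \int[K1 t z.1]_s g (psi (s, z.2)).
  have mF : measurable_fun setT F := mI t _ t0 mfp (fun=> f0 _).
  have mG : measurable_fun setT G := mJ t _ t0 mgp (fun=> g0 _).
  have F0 z : 0 <= F z := I0 t (f \o psi) t0 (fun=> f0 _) z.
  have G0 z : 0 <= G z := J0 t (g \o psi) t0 (fun=> g0 _) z.
  transitivity (\int[m1]_a \int[m2]_b (f (psi (a, b)) * \int[K2 t b]_u G (a, u))).
    apply: eq_integralT => a; apply: eq_integralT => b; congr (_ * _).
    rewrite (ktens_int t0 mg g0) psiK1 psiK2.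
    exact: (sfm_tonelli mgp (fun=> g0 _) (k1s _ a t0) (k2s _ b t0)).
  transitivity (\int[m1]_a \int[m2]_b (G (a, b) * F (a, b))).
    apply: eq_integralT => a; exact: (ssg_sym H2 t0 (measurable_fun_pair2 a mfp)
      (fun=> f0 _) (measurable_fun_pair2 a mG) (fun=> G0 _)).
  rewrite (sfm_tonelli (emeasurable_funM mG mF) (fun z => mule_ge0 (G0 z) (F0 z)) s1 s2).
  pose H (z : T1 * T2) := g (psi z) * \int[K1 t z.1]_s F (s, z.2).
  transitivity (\int[m2]_b \int[m1]_a H (a, b)).
    apply: eq_integralT => b; under eq_integralT do rewrite muleC.
    exact: (ssg_sym H1 t0 (measurable_fun_pair1 b mF) (fun=> F0 _)
      (measurable_fun_pair1 b mgp) (fun=> g0 _)).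
  have mFF : measurable_fun setT (fun z : T1 * T2 => \int[K1 t z.1]_s F (s, z.2)).
    exact: (mJ t F t0 mF F0).
  have mH : measurable_fun setT H := emeasurable_funM mgp mFF.
  have H0 z : 0 <= H z := mule_ge0 (g0 _) (J0 t F t0 F0 z).
  rewrite -(sfm_tonelli mH H0 s1 s2).
  apply: eq_integralT => a; apply: eq_integralT => b; congr (_ * _).
  by rewrite (ktens_int t0 mf f0) psiK1 psiK2.
Qed.

End tens.
End ssg.

(** * Approximating forms *)

Section bounded_integrable.
Context d (T : measurableType d) (R : realType) (m : set T -> \bar R).
Hypothesis sm : sfm m.
Implicit Types f g : T -> R.

Definition fint f : R := fine (\int[m]_x (f x)%:E)%E.

(** This class is stable under products, under positive and negative parts and under the semigroup.
    All inner products are therefore finite reals, and identities can be transferred from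
    nonnegative functions. *)
Definition bL1 f : Prop := [/\ measurable_fun setT f,
  exists M, forall x, `|f x| <= M & m.-integrable setT (EFin \o f)].

Lemma fintE f : m.-integrable setT (EFin \o f) ->
  ((fint f)%:E = \int[m]_x (f x)%:E)%E.
Proof.
by rewrite /fint; case: sm => m' -> fi; rewrite fineK//; exact: (integrable_fin_num measurableT fi).
Qed.

Lemma fintD f g : m.-integrable setT (EFin \o f) ->
  m.-integrable setT (EFin \o g) -> fint (fun x => f x + g x) = fint f + fint g.
Proof. by rewrite /fint; case: sm => m' -> fi gi; apply: (RintegralD measurableT fi gi). Qed.

Lemma fintB f g : m.-integrable setT (EFin \o f) ->
  m.-integrable setT (EFin \o g) -> fint (fun x => f x - g x) = fint f - fint g.
Proof. by rewrite /fint; case: sm => m' -> fi gi; apply: (RintegralB measurableT fi gi). Qed.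

Lemma fintZ k f : m.-integrable setT (EFin \o f) ->
  fint (fun x => k * f x) = k * fint f.
Proof. by rewrite /fint; case: sm => m' -> fi; apply: (RintegralZl k measurableT fi). Qed.

Lemma fint_ge0 f : (forall x, 0 <= f x) -> 0 <= fint f.
Proof.
by move=> f0; apply: fine_ge0; apply: sfm_integral_ge0 => // x; rewrite lee_fin.
Qed.

Lemma le_fint f g : m.-integrable setT (EFin \o f) ->
  m.-integrable setT (EFin \o g) -> (forall x, f x <= g x) -> fint f <= fint g.
Proof.
by rewrite /fint; case: sm => m' -> fi gi fg; apply: (le_Rintegral measurableT fi gi) => x _.
Qed.

Lemma bL1D f g : bL1 f -> bL1 g -> bL1 (fun x => f x + g x).
Proof.
case: sm => m' mE [mf [M fM] fi] [mg [N gN] gi]; split.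
- exact: measurable_funD.
- by exists (M + N) => x; apply: le_trans (ler_normD _ _) _; exact: lerD.
- by move: fi gi; rewrite mE => fi gi; exact: (integrableD measurableT fi gi).
Qed.

Lemma bL1Z k f : bL1 f -> bL1 (fun x => k * f x).
Proof.
case: sm => m' mE [mf [M fM] fi]; split.
- exact: measurable_funM.
- by exists (`|k| * M) => x; rewrite normrM ler_wpM2l.
- by move: fi; rewrite mE => fi; exact: (integrableZl measurableT k fi).
Qed.

Lemma bL1B f g : bL1 f -> bL1 g -> bL1 (fun x => f x - g x).
Proof.
move=> Bf Bg; have := bL1D Bf (bL1Z (-1) Bg).
by congr bL1; apply/funext => x; rewrite mulN1r.
Qed.

Lemma bL1_le f g : measurable_fun setT f -> (forall x, `|f x| <= `|g x|) ->
  bL1 g -> bL1 f.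
Proof.
case: sm => m' mE mf fg [mg [M gM] gi]; split => //.
  by exists M => x; exact: le_trans (fg x) (gM x).
move: gi; rewrite mE => gi; apply: le_integrable gi => //.
  exact/measurable_EFinP.
by move=> x _ /=; rewrite lee_fin.
Qed.

Lemma bL1M f g : bL1 f -> measurable_fun setT g ->
  (exists M, forall x, `|g x| <= M) -> bL1 (fun x => f x * g x).
Proof.
move=> Bf mg [M gM]; have [mf _ _] := Bf.
apply: (@bL1_le _ (fun x => M * f x)); last exact: bL1Z.
  exact: measurable_funM.
move=> x; rewrite !normrM mulrC ler_wpM2r// (le_trans (gM x))//.
by rewrite ler_norm.
Qed.

Lemma bL1M2 f g : bL1 f -> bL1 g -> bL1 (fun x => f x * g x).
Proof. by move=> Bf [mg bg _]; exact: bL1M. Qed.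

Lemma bL1_int f : bL1 f -> m.-integrable setT (EFin \o f).
Proof. by case. Qed.

Definition fpos f x := Num.max (f x) 0.
Definition fneg f x := Num.max (- f x) 0.

Lemma fpos_ge0 f x : 0 <= fpos f x. Proof. by rewrite le_max lexx orbT. Qed.

Lemma fneg_ge0 f x : 0 <= fneg f x. Proof. by rewrite le_max lexx orbT. Qed.

Lemma fposnegE f : f = fun x => fpos f x - fneg f x.
Proof.
apply/funext => x; rewrite /fpos /fneg; case: (leP (f x) 0) => h.
  by rewrite max_l ?oppr_ge0// sub0r opprK.
by rewrite max_r ?subr0// oppr_le0 ltW.
Qed.

Lemma bL1_fpos f : bL1 f -> bL1 (fpos f).
Proof.
move=> Bf; have [mf _ _] := Bf.
apply: bL1_le Bf; first exact: measurable_maxr.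
by move=> x; rewrite /fpos; case: (leP (f x) 0) => _; rewrite ?normr0.
Qed.

Lemma bL1_fneg f : bL1 f -> bL1 (fneg f).
Proof.
move=> Bf; have [mf _ _] := Bf.
apply: bL1_le Bf; first by apply: measurable_maxr => //; exact: measurable_funN.
by move=> x; rewrite /fneg; case: (leP (- f x) 0) => _; rewrite ?normr0// normrN.
Qed.

Lemma bL1_posneg f : bL1 f -> exists f1 f2, [/\ bL1 f1, bL1 f2,
  forall x, 0 <= f1 x, forall x, 0 <= f2 x & f = fun x => f1 x - f2 x].
Proof.
move=> Bf; exists (fpos f), (fneg f); split.
- exact: bL1_fpos.
- exact: bL1_fneg.
- exact: fpos_ge0.
- exact: fneg_ge0.
- exact: fposnegE.
Qed.

Definition ip f g := fint (fun x => f x * g x).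

Lemma ipC f g : ip f g = ip g f.
Proof. by rewrite /ip; congr fint; apply/funext => x; rewrite mulrC. Qed.

Lemma ipBl f g h : bL1 f -> bL1 g -> bL1 h ->
  ip (fun x => f x - g x) h = ip f h - ip g h.
Proof.
move=> Bf Bg Bh; rewrite /ip -fintB; try exact/bL1_int/bL1M2.
by congr fint; apply/funext => x; rewrite mulrBl.
Qed.

Lemma ipBr f g h : bL1 f -> bL1 g -> bL1 h ->
  ip h (fun x => f x - g x) = ip h f - ip h g.
Proof. by move=> *; rewrite ipC ipBl// ![ip _ h]ipC. Qed.

Lemma ip_ge0 f : 0 <= ip f f.
Proof. by apply: fint_ge0 => x; rewrite -expr2 sqr_ge0. Qed.

Lemma ipE f g : bL1 f -> bL1 g -> ((ip f g)%:E = \int[m]_x (f x * g x)%:E)%E.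
Proof. by move=> Bf Bg; rewrite fintE//; exact/bL1_int/bL1M2. Qed.

End bounded_integrable.

(** * The operators of a semigroup and the growth of [phi] in time *)

Section semigroup_operator.
Context d (T : measurableType d) (R : realType) (m : set T -> \bar R).
Variable K : R -> T -> set T -> \bar R.
Hypothesis H : ssg m K.
Implicit Types (f g : T -> R) (t r : R).
Let sm := ssg_sfm H.
Local Notation B := (bL1 m).
Local Notation ip := (ip m).

Definition sgop t f x : R := fint (K t x) f.

Let K_sfm t x : 0 < t -> sfm (K t x). Proof. exact: (ssg_ksfm x H). Qed.

Let K_int t x f : 0 < t -> measurable_fun setT f ->
  (exists M, forall x, `|f x| <= M) -> (K t x).-integrable setT (EFin \o f).
Proof.
move=> t0 mf [M fM]; have [k [-> k1]] := ssg_sub H x t0.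
apply: measurable_bounded_integrable => //; first by rewrite (le_lt_trans k1) ?ltry.
exists M; split; rewrite ?num_real// => y My z _ /=.
by rewrite (le_trans _ (ltW My)).
Qed.

Let K_Bint t x f : 0 < t -> B f -> (K t x).-integrable setT (EFin \o f).
Proof. by move=> t0 [mf bf _]; exact: K_int. Qed.

Lemma sgopE t f x : 0 < t -> B f -> ((sgop t f x)%:E = \int[K t x]_y (f y)%:E)%E.
Proof. by move=> t0 Bf; apply: fintE; [exact: K_sfm|exact: K_Bint]. Qed.

Lemma sgopB t f g x : 0 < t -> B f -> B g ->
  sgop t (fun x => f x - g x) x = sgop t f x - sgop t g x.
Proof. by move=> t0 Bf Bg; apply: fintB; [exact: K_sfm|exact: K_Bint..]. Qed.

Lemma sgop_ge0 t f x : 0 < t -> (forall x, 0 <= f x) -> 0 <= sgop t f x.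
Proof. by move=> t0 f0; apply: fint_ge0 => //; exact: K_sfm. Qed.

Let K1 t x : 0 < t -> (\int[K t x]_y 1 <= 1)%E.
Proof.
move=> t0; have [k [-> k1]] := ssg_sub H x t0.
by rewrite integral_cst// mul1e.
Qed.

Let sgop_bound t f x M : 0 < t -> B f -> (forall x, `|f x| <= M) ->
  `|sgop t f x| <= M.
Proof.
move=> t0 Bf fM; have M0 : 0 <= M by exact: le_trans (fM x).
rewrite -lee_fin -abse_EFin sgopE//; have := K_Bint x t0 Bf.
have [k [-> k1]] := ssg_sub H x t0 => fi.
have [mf _ _] := Bf.
apply: le_trans (le_abse_integral _ _ _) _ => //; first exact/measurable_EFinP.
apply: (@le_trans _ _ (\int[k]_(x in setT) M%:E)%E).
  apply: ge0_le_integral => //.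
  - by apply: measurableT_comp => //; exact/measurable_EFinP.
  - by move=> y _; rewrite lee_fin fM.
rewrite integral_cst// -[leRHS]mule1; apply: lee_pmul => //.
Qed.

Let sgop_meas t f : 0 < t -> B f -> measurable_fun setT (sgop t f).
Proof.
move=> t0 Bf; have [f1 [f2 [B1 B2 f10 f20 ->]]] := bL1_posneg sm Bf.
have pos g : B g -> (forall x, 0 <= g x) -> measurable_fun setT (sgop t g).
  move=> Bg g0; have [mg _ _] := Bg; apply/measurable_EFinP.
  rewrite (_ : EFin \o _ = fun x => (\int[K t x]_y (g y)%:E)%E).
    by apply: (ssg_meas1 H t0) => //; exact/measurable_EFinP.
  by apply/funext => x /=; rewrite sgopE.
rewrite (_ : sgop t _ = fun x => sgop t f1 x - sgop t f2 x).
  by apply: measurable_funB; exact: pos.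
by apply/funext => x; rewrite sgopB.
Qed.

(** Symmetry moves the kernel onto the constant 1, where the sub-Markov property bounds it by 1. *)
Let sgop_int t f : 0 < t -> B f -> (forall x, 0 <= f x) ->
  (\int[m]_x (sgop t f x)%:E <= \int[m]_x (f x)%:E)%E.
Proof.
move=> t0 Bf f0; have [mf _ _] := Bf.
rewrite (@eq_integralT _ _ _ _ _ ( fun x => (1 * \int[K t x]_y (f y)%:E)%E)); last first.
  by move=> x; rewrite sgopE// mul1e.
have mf' : measurable_fun setT (EFin \o f) by exact/measurable_EFinP.
have f0' x : (0 <= (f x)%:E)%E by rewrite lee_fin.
rewrite (ssg_sym H t0 (f := fun=> 1%E) (g := EFin \o f))//.
have mI : measurable_fun setT (fun x => \int[K t x]_y 1)%E.
  exact: (ssg_meas1 H t0 (f := fun=> 1%E)).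
have I0 x : (0 <= \int[K t x]_y 1)%E by apply: sfm_integral_ge0 => //; exact: K_sfm.
have Hle x : ((EFin \o f) x * \int[K t x]_y 1 <= (f x)%:E)%E.
  by rewrite /= -[leRHS]mule1; apply: lee_pmul => //; exact: K1.
case: sm mI I0 Hle => m' -> mI I0 Hle; apply: ge0_le_integral => //.
- by move=> x _; rewrite mule_ge0//; exact: f0'.
- exact: emeasurable_funM.
Qed.

Lemma sgop_bL1 t f : 0 < t -> B f -> B (sgop t f).
Proof.
move=> t0 Bf.
have pos g : B g -> (forall x, 0 <= g x) -> B (sgop t g).
  move=> Bg g0; have [mg [M gM] gi] := Bg; split; first exact: sgop_meas.
    by exists M => x; exact: sgop_bound.
  have mA : measurable_fun setT (EFin \o sgop t g).
    by apply/measurable_EFinP; exact: sgop_meas.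
  apply/integrableP; split => //.
  rewrite (@eq_integralT _ _ _ _ _ ( fun x => (sgop t g x)%:E)); last first.
    by move=> x /=; rewrite ger0_norm// sgop_ge0.
  apply: le_lt_trans (sgop_int t0 Bg g0) _.
  by case: sm gi => m' -> gi; exact: integrable_lty.
have [f1 [f2 [B1 B2 f10 f20 ->]]] := bL1_posneg sm Bf.
rewrite (_ : sgop t _ = fun x => sgop t f1 x - sgop t f2 x).
  by apply: bL1B => //; exact: pos.
by apply/funext => x; rewrite sgopB.
Qed.

Lemma sgop_sym t f g : 0 < t -> B f -> B g -> ip (sgop t f) g = ip f (sgop t g).
Proof.
move=> t0 Bf Bg.
have pos h k : B h -> B k -> (forall x, 0 <= h x) -> (forall x, 0 <= k x) ->
    ip (sgop t h) k = ip h (sgop t k).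
  move=> Bh Bk h0 k0; have [mh _ _] := Bh; have [mk _ _] := Bk.
  apply: EFin_inj; rewrite !ipE//; try exact: sgop_bL1.
  transitivity (\int[m]_x ((EFin \o k) x * \int[K t x]_y (h y)%:E))%E.
    by apply: eq_integralT => x /=; rewrite -sgopE// mulrC EFinM.
  rewrite (ssg_sym H t0 (f := EFin \o k) (g := EFin \o h))//; first last.
  - exact/measurable_EFinP.
  - exact/measurable_EFinP.
  by apply: eq_integralT => x /=; rewrite -sgopE// EFinM.
have [f1 [f2 [F1 F2 f10 f20 ->]]] := bL1_posneg sm Bf.
have [g1 [g2 [G1 G2 g10 g20 ->]]] := bL1_posneg sm Bg.
have AE h k : B h -> B k ->
    sgop t (fun x => h x - k x) = fun x => sgop t h x - sgop t k x.
  by move=> Bh Bk; apply/funext => x; rewrite sgopB.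
rewrite !AE// !ipBl ?ipBr ?pos//; try exact: sgop_bL1.
all: by apply: bL1B => //; exact: sgop_bL1.
Qed.

Lemma sgop_ck t r f : 0 < t -> 0 < r -> B f -> sgop (t + r) f = sgop t (sgop r f).
Proof.
move=> t0 r0 Bf; have tr0 : 0 < t + r by exact: addr_gt0.
have pos g : B g -> (forall x, 0 <= g x) -> sgop (t + r) g = sgop t (sgop r g).
  move=> Bg g0; have [mg _ _] := Bg; apply/funext => x.
  apply: EFin_inj; rewrite !sgopE//; last exact: sgop_bL1.
  rewrite (ssg_ck H t0 r0 (f := EFin \o g)); first last.
  - by move=> y; rewrite lee_fin.
  - exact/measurable_EFinP.
  by apply: eq_integralT => y; rewrite sgopE.
have [f1 [f2 [F1 F2 f10 f20 ->]]] := bL1_posneg sm Bf.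
have AE s h k : 0 < s -> B h -> B k ->
    sgop s (fun x => h x - k x) = fun x => sgop s h x - sgop s k x.
  by move=> s0 Bh Bk; apply/funext => x; rewrite sgopB.
by rewrite !AE ?pos//; exact: sgop_bL1.
Qed.

(* expand [0 <= \int (f - c)^2 dK] with [c = \int f dK] and [K 1 <= 1] *)
Let sgop_jensen t f x : 0 < t -> B f ->
  sgop t f x ^+ 2 <= sgop t (fun y => f y * f y) x.
Proof.
move=> t0 Bf; have [mf [M fM] _] := Bf; set c := sgop t f x.
have Bff := bL1M2 sm Bf Bf.
have i1 : (K t x).-integrable setT (EFin \o (fun y => f y * f y)) by exact: K_Bint.
have i2 : (K t x).-integrable setT (EFin \o (fun y => 2 * c * f y)).
  by apply: K_Bint => //; exact: bL1Z.
have i3 : (K t x).-integrable setT (EFin \o (fun=> c * c)).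
  by apply: K_int => //; exists `|c * c|.
have s := K_sfm x t0.
have : 0 <= fint (K t x) (fun y => (f y * f y - 2 * c * f y) + c * c).
  apply: fint_ge0 => // y.
  by rewrite [leRHS](_ : _ = (f y - c) ^+ 2) ?sqr_ge0//; ring.
rewrite fintD//; last first.
  case: s i1 i2 => k -> i1 i2.
  by under [_ \o _]eq_fun do rewrite /= EFinB; exact: (integrableB measurableT i1 i2).
rewrite fintB// fintZ//; last exact: K_Bint.
have -> : fint (K t x) f = c by [].
have h : fint (K t x) (fun=> c * c) <= c ^+ 2.
  rewrite -lee_fin fintE// (@eq_integralT _ _ _ _ _ ( fun y => ((c * c)%:E * 1)%E)); last first.
    by move=> y; rewrite mule1.
  have [k [kE k1]] := ssg_sub H x t0.
  rewrite kE ge0_integralZl//; last by rewrite lee_fin -expr2 sqr_ge0.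
  rewrite integral_cst// mul1e expr2 -[leRHS]mule1; apply: lee_pmul => //.
  by rewrite lee_fin -expr2 sqr_ge0.
by rewrite -/(sgop t (fun y => f y * f y) x); move: h; nra.
Qed.

(** Jensen's inequality at each point, followed by the contraction in [L^1] applied to [f^2]. *)
Lemma sgop_contr t f : 0 < t -> B f -> ip (sgop t f) (sgop t f) <= ip f f.
Proof.
move=> t0 Bf; have BAf := sgop_bL1 t0 Bf; have Bff := bL1M2 sm Bf Bf.
apply: (@le_trans _ _ (fint m (sgop t (fun y => f y * f y)))).
  apply: le_fint => //; first exact/bL1_int/bL1M2.
    exact/bL1_int/sgop_bL1.
  by move=> x; rewrite -expr2; exact: sgop_jensen.
rewrite -lee_fin fintE//; last exact/bL1_int/sgop_bL1.
rewrite ipE//; apply: sgop_int => // x.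
by rewrite -expr2 sqr_ge0.
Qed.

Definition phi t f := ip f f - ip (sgop t f) f.

Let half_gt0 t : 0 < t -> 0 < t / 2. Proof. by move=> t0; rewrite divr_gt0. Qed.

(** The inner product becomes a squared norm, so that positivity and monotonicity of [phi] in time
    both reduce to contraction. *)
Lemma ip_sgop_half t f : 0 < t -> B f ->
  ip (sgop t f) f = ip (sgop (t / 2) f) (sgop (t / 2) f).
Proof.
move=> t0 Bf; have h0 := half_gt0 t0.
by rewrite {1}(splitr t) sgop_ck// sgop_sym//; exact: sgop_bL1.
Qed.

Lemma phi_ge0 t f : 0 < t -> B f -> 0 <= phi t f.
Proof.
by move=> t0 Bf; rewrite subr_ge0 ip_sgop_half// sgop_contr// half_gt0.
Qed.

Lemma phi_le_ip t f : 0 < t -> B f -> phi t f <= ip f f.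
Proof.
move=> t0 Bf; rewrite gerBl ip_sgop_half//.
by apply: ip_ge0.
Qed.

Lemma phi_monotone t r f : 0 < t -> t <= r -> B f -> phi t f <= phi r f.
Proof.
move=> t0; rewrite le_eqVlt => /predU1P[<-//|tr] Bf.
have r0 := lt_trans t0 tr; have h : 0 < (r - t) / 2 by rewrite half_gt0// subr_gt0.
have Bt : B (sgop (t / 2) f) by apply: sgop_bL1 => //; exact: half_gt0.
rewrite lerD2l lerN2 !ip_sgop_half//.
have -> : r / 2 = (r - t) / 2 + t / 2 by field.
by rewrite sgop_ck// ?half_gt0// sgop_contr.
Qed.

(* [k |-> <A_(kt) f, f>] is convex: its second differences are squared norms *)
Lemma phi_mulrn t f n : 0 < t -> B f -> phi (n.+1%:R * t) f <= n.+1%:R * phi t f.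
Proof.
move=> t0 Bf.
pose c k := if k is 0%N then ip f f else ip (sgop (k%:R * t) f) f.
have cvx k : c k.+1 - c k.+2 <= c k - c k.+1.
  have main g : B g -> 0 <= ip g g - 2 * ip (sgop t g) g + ip (sgop t g) (sgop t g).
    move=> Bg; have BA := sgop_bL1 t0 Bg.
    have := ip_ge0 sm (fun x => g x - sgop t g x).
    rewrite ipBl ?ipBr//; try exact: bL1B.
    by rewrite (ipC m g); lra.
  have key g : B g -> ip g g = c k -> ip (sgop t g) g = c k.+1 ->
      ip (sgop t g) (sgop t g) = c k.+2 -> c k.+1 - c k.+2 <= c k - c k.+1.
    by move=> Bg <- h1 h2; have := main g Bg; rewrite h1 h2; lra.
  have pos j : 0 < j.+1%:R * t by rewrite mulr_gt0.
  case: k key => [|k] key; first apply: (key f) => //=.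
  - by rewrite mul1r.
  - by rewrite ip_sgop_half// mulrAC divff// mul1r.
  (* Half of the time [(k+1) t]: applied to [sgop s f], the three inner products of [main] are by
     symmetry the values of [c] at three consecutive integers. *)
  set s := k.+1%:R * t / 2; have s0 : 0 < s by exact: half_gt0.
  have Bs : B (sgop s f) by exact: sgop_bL1.
  apply: (key (sgop s f)) => //=.
  - by rewrite ip_sgop_half.
  - rewrite -sgop_ck// -sgop_sym//; last exact: sgop_bL1 (addr_gt0 _ _) _.
    rewrite -sgop_ck//; last exact: addr_gt0.
    by congr (ip (sgop _ f) f); rewrite /s -[k.+2]addn1 natrD; field.
  - rewrite -sgop_ck// ip_sgop_half//.
    by congr (ip (sgop _ f) (sgop _ f)); rewrite /s -[k.+3]addn2 -[k.+1]addn1 !natrD; field.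
have dec k : c k - c k.+1 <= c 0%N - c 1%N.
  by elim: k => // k IH; exact: le_trans (cvx k) IH.
have tel k : c 0%N - c k <= k%:R * (c 0%N - c 1%N).
  elim: k => [|k IH]; first by rewrite subrr mul0r.
  by have := dec k; rewrite -natr1 mulrDl mul1r; move: IH; lra.
by have := tel n.+1; rewrite /phi /= mul1r.
Qed.

(** By [phi_mulrn] the quotient [phi t f / t] does not decrease when [t] is replaced by [t / n]. A
    value above [e] would thus persist along a sequence of times tending to 0. *)
Lemma phi_le_limit f (e : R) : B f ->
  (fun t => phi t f / t) @ (0 : R)^'+ --> e ->
  forall t, 0 < t -> phi t f <= e * t.
Proof.
move=> Bf fe t t0; rewrite -ler_pdivrMr// leNgt; apply/negP => lt_e.
have [del /= del0 hdel] := cvgr_lt _ fe _ lt_e.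
pose n := Num.truncn (t / del).
have n0 : 0 < n.+1%:R :> R by [].
have tn0 : 0 < t / n.+1%:R by exact: divr_gt0.
have tn : t / n.+1%:R < del.
  rewrite ltr_pdivrMr// mulrC -ltr_pdivrMr//.
  by have /andP[_] := truncn_itv (ltW (divr_gt0 t0 del0)).
have := hdel (t / n.+1%:R); rewrite /ball /= sub0r normrN gtr0_norm//.
move=> /(_ tn tn0); rewrite ltNge => /negP; apply.
have := phi_mulrn n tn0 Bf; rewrite mulrC divfK ?gt_eqF// => hn.
rewrite ler_pdivrMr// (le_trans hn)// [leRHS](_ : _ = n.+1%:R * phi (t / n.+1%:R) f)//.
by field; rewrite !gt_eqF//=.
Qed.

(** The limit is the supremum of the quotients, which is finite because [phi_mulrn] carries the
    bound from small times to all times. If the quotient at [t0] is nearly the supremum and [t] is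
    small, choose [n] with [t0 <= (n+1) t <= t0 + t]; then [phi t0 f <= (n+1) phi t f], and the
    excess [t] costs less than the tolerance. *)
Lemma phi_cvg f (C del : R) : B f -> 0 < del ->
  (forall t, 0 < t < del -> phi t f <= C * t) ->
  exists e : R, (fun t => phi t f / t) @ (0 : R)^'+ --> e.
Proof.
move=> Bf del0 hC.
have bd t : 0 < t -> phi t f / t <= C.
  move=> t0; pose n := Num.truncn (t / del).
  have n0 : 0 < n.+1%:R :> R by [].
  have tn0 : 0 < t / n.+1%:R by exact: divr_gt0.
  have tn : t / n.+1%:R < del.
    rewrite ltr_pdivrMr// mulrC -ltr_pdivrMr//.
    by have /andP[_] := truncn_itv (ltW (divr_gt0 t0 del0)).
  have := phi_mulrn n tn0 Bf; rewrite mulrC divfK ?gt_eqF// => hn.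
  rewrite ler_pdivrMr// (le_trans hn)//.
  have /hC : 0 < t / n.+1%:R < del by rewrite tn0.
  rewrite -(ler_pM2l n0) => /le_trans; apply.
  by rewrite [leLHS](_ : _ = C * t)//; field; rewrite gt_eqF.
pose S := [set phi t f / t | t in [set t | 0 < t]].
have hS : has_sup S.
  split; first by exists (phi 1 f / 1), 1 => //=.
  by exists C => _ /= [t t0 <-]; exact: bd.
exists (sup S); apply/cvgrPdist_le => e e0.
have [_ [t0 /= t00 <-] ht0] := sup_adherent (divr_gt0 e0 (ltr0Sn _ 1)) hS.
have le1 t : 0 < t -> phi t f / t <= sup S.
  by move=> tpos; apply: sup_upper_bound => //; exists t.
have [Se|Se] := leP (sup S - e) 0.
  near=> t; have tpos : 0 < t by [].
  rewrite ger0_norm ?subr_ge0 ?le1// lerBlDr -lerBlDl.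
  by apply: le_trans Se _; rewrite divr_ge0 ?phi_ge0// ltW.
have S0 : 0 < sup S by move: Se; rewrite subr_gt0; exact: lt_trans.
near=> t; have tpos : 0 < t by [].
rewrite ger0_norm ?subr_ge0 ?le1// lerBlDr -lerBlDl.
pose n := Num.truncn (t0 / t).
have /andP[n1 n2] := truncn_itv (ltW (divr_gt0 t00 tpos)).
have n0 : 0 < n.+1%:R :> R by [].
have h1 : t0 <= n.+1%:R * t by rewrite -ler_pdivrMr// ltW.
have h2 : n.+1%:R * t <= t0 + t.
  by rewrite -natr1 mulrDl mul1r lerD2r -ler_pdivlMr.
have h3 : phi t0 f <= n.+1%:R * phi t f.
  exact: le_trans (phi_monotone t00 h1 Bf) (phi_mulrn _ tpos Bf).
have h4 : (sup S - e / 2) * t0 < phi t0 f by rewrite -ltr_pdivlMr.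
rewrite ler_pdivlMr//.
have h5 : sup S * t <= e / 2 * t0.
  rewrite -ler_pdivlMl//; near: t; apply: nbhs_right_le.
  by rewrite !mulr_gt0 ?divr_gt0// invr_gt0.
rewrite -(ler_pM2l n0); apply: le_trans h3.
apply: le_trans (ltW h4).
have : (sup S - e) * (n.+1%:R * t) <= (sup S - e) * (t0 + t) by rewrite ler_pM2l.
by have := mulr_gt0 e0 tpos; move: h5; nra.
Unshelve. all: by end_near. Qed.

(** The parallelogram identity for [g] and [f - g], from which the nonnegative term
    [phi t (2 g - f)] is dropped. *)
Lemma phi_quadratic t f g : 0 < t -> B f -> B g ->
  phi t f <= 2 * phi t g + 2 * phi t (fun x => f x - g x).
Proof.
move=> t0 Bf Bg.
have Bfg := bL1B sm Bf Bg; have Af := sgop_bL1 t0 Bf; have Ag := sgop_bL1 t0 Bg.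
have Ad := bL1B sm Bg Bfg.
have := phi_ge0 t0 Ad; rewrite /phi.
have AE h k : B h -> B k ->
    sgop t (fun x => h x - k x) = fun x => sgop t h x - sgop t k x.
  by move=> Bh Bk; apply/funext => x; rewrite sgopB.
have BA := sgop_bL1 t0 Bfg.
rewrite !AE//.
rewrite !(ipBl sm, ipBr sm)//; try by [exact: bL1B|apply: bL1B => //; exact: bL1B].
have := sgop_sym t0 Bg Bf; have := ipC m f g.
rewrite (ipC m g (sgop t f)).
lra.
Qed.

(** Expanding the square, this amounts to [|A_{t/2} f|^2 <= <A_{t/2} f, f>], where the right side is
    [|A_{t/4} f|^2]; contraction concludes. *)
Lemma ip_sub_sgop_le t f : 0 < t -> B f ->
  ip (fun x => f x - sgop (t / 2) f x) (fun x => f x - sgop (t / 2) f x) <= phi t f.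
Proof.
move=> t0 Bf; have h0 := half_gt0 t0; have hh0 := half_gt0 h0.
have BA := sgop_bL1 h0 Bf; have BAA := sgop_bL1 hh0 Bf.
rewrite /phi (ip_sgop_half t0)//.
have : ip (sgop (t / 2) f) (sgop (t / 2) f) <= ip (sgop (t / 2) f) f.
  rewrite (ip_sgop_half h0)//.
  have -> : sgop (t / 2) f = sgop (t / 2 / 2) (sgop (t / 2 / 2) f).
    by rewrite -sgop_ck// -splitr.
  exact: sgop_contr.
rewrite !(ipBl sm, ipBr sm)//; last exact: bL1B.
by rewrite (ipC m f (sgop (t / 2) f)); lra.
Qed.

End semigroup_operator.

(** * The form of a composition of two semigroups *)

Section product_phi.
Context d (T : measurableType d) (R : realType) (m : set T -> \bar R).
Variables KA KP KQ : R -> T -> set T -> \bar R.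
Hypotheses (HA : ssg m KA) (HP : ssg m KP) (HQ : ssg m KQ).
Hypothesis APQ : forall t f, 0 < t -> bL1 m f ->
  sgop KA t f = sgop KP t (sgop KQ t f).

(** With [g = Q_{t/2} f], half times give exactly [phi^A f = phi^Q f + phi^P g]. Then
    [phi^P g <= 2 phi^P f + 2 |g - f|^2], and the last norm is at most [phi^Q f]: this is the origin
    of 2 and of [3 = 1 + 2]. *)
Lemma phi_product_le t f : 0 < t -> bL1 m f ->
  phi m KA t f <= 2 * phi m KP t f + 3 * phi m KQ t f.
Proof.
move=> t0 Bf; have h0 : 0 < t / 2 by rewrite divr_gt0.
have sm := ssg_sfm HA.
have BQ := sgop_bL1 HQ h0 Bf.
have -> : phi m KA t f = phi m KQ t f + phi m KP t (sgop KQ (t / 2) f).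
  rewrite /phi (ip_sgop_half HA)// APQ// (ip_sgop_half HP t0 BQ).
  by rewrite (ip_sgop_half HQ t0 Bf); ring.
have := phi_quadratic HP t0 BQ Bf.
set h := fun x => _ - _.
have Bh : bL1 m h by exact: bL1B.
have := phi_le_ip HP t0 Bh; have := ip_sub_sgop_le HQ t0 Bf.
have -> : ip m h h = ip m (fun x => f x - sgop KQ (t / 2) f x)
                          (fun x => f x - sgop KQ (t / 2) f x).
  by rewrite /ip; congr fint; apply/funext => x; rewrite /h; ring.
lra.
Qed.

End product_phi.

(* [KP] acts as [K1] on the fibres [j z], and [m] disintegrates along them *)
Section lift_phi.
Context d d1 d2 (T : measurableType d) (T1 : measurableType d1)
  (T2 : measurableType d2) (R : realType).
Variables (m : set T -> \bar R) (m1 : set T1 -> \bar R) (m2 : set T2 -> \bar R).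
Variables (KP : R -> T -> set T -> \bar R) (K1 : R -> T1 -> set T1 -> \bar R).
Variable j : T2 -> T1 -> T.
Hypotheses (HP : ssg m KP) (H1 : ssg m1 K1) (s2 : sfm m2).
Hypothesis mj : forall z, measurable_fun setT (j z).
Hypothesis m_fib : forall h : T -> \bar R, measurable_fun setT h ->
  (forall x, 0 <= h x)%E ->
  measurable_fun setT (fun z => \int[m1]_s h (j z s))%E /\
  (\int[m]_x h x = \int[m2]_z \int[m1]_s h (j z s))%E.
Hypothesis KP_fib : forall t z s (h : T -> \bar R), 0 < t ->
  measurable_fun setT h -> (forall x, 0 <= h x)%E ->
  (\int[KP t (j z s)]_x h x = \int[K1 t s]_s' h (j z s'))%E.

Let fib_fint h : bL1 m h -> (forall z, bL1 m1 (h \o j z)) ->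
  m2.-integrable setT (EFin \o (fun z => fint m1 (h \o j z))) /\
  fint m h = fint m2 (fun z => fint m1 (h \o j z)).
Proof.
move=> Bh Bhj; have s := ssg_sfm HP; have s1 := ssg_sfm H1.
have pos g : bL1 m g -> (forall z, bL1 m1 (g \o j z)) -> (forall x, 0 <= g x) ->
    m2.-integrable setT (EFin \o (fun z => fint m1 (g \o j z))) /\
    fint m g = fint m2 (fun z => fint m1 (g \o j z)).
  move=> [mg bg gi] Bgj g0.
  have mg' : measurable_fun setT (EFin \o g) by exact/measurable_EFinP.
  have g0' x : (0 <= (g x)%:E)%E by rewrite lee_fin.
  have [mI IE] := m_fib mg' g0'.
  have E z : ((fint m1 (g \o j z))%:E = \int[m1]_s (EFin \o g) (j z s))%E.
    by rewrite fintE//; case: (Bgj z).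
  have Efun : EFin \o (fun z => fint m1 (g \o j z)) =
      fun z => (\int[m1]_s (EFin \o g) (j z s))%E.
    by apply/funext => z /=; rewrite E.
  split; last by rewrite {1}/fint IE /fint; congr fine; apply: eq_integralT => z; rewrite -E.
  apply/integrableP; split; first by rewrite Efun.
  rewrite (@eq_integralT _ _ _ _ _ (fun z => \int[m1]_s (EFin \o g) (j z s))%E).
    rewrite -IE; case: s gi => m' -> gi; exact: (integrable_lty measurableT gi).
  by move=> z /=; rewrite ger0_norm -?E//; apply: fint_ge0 => // y; exact: g0.
have Bj1 z : bL1 m1 (fpos h \o j z) := bL1_fpos s1 (Bhj z).
have Bj2 z : bL1 m1 (fneg h \o j z) := bL1_fneg s1 (Bhj z).
have [i1 e1] := pos _ (bL1_fpos s Bh) Bj1 (fpos_ge0 h).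
have [i2 e2] := pos _ (bL1_fneg s Bh) Bj2 (fneg_ge0 h).
have jE : (fun z => fint m1 (h \o j z)) =
    fun z => fint m1 (fpos h \o j z) - fint m1 (fneg h \o j z).
  apply/funext => z; rewrite -fintB//; try by [case: (Bj1 z)|case: (Bj2 z)].
  by congr fint; rewrite {1}(fposnegE h).
split.
  rewrite jE (_ : EFin \o _ = (EFin \o (fun z => fint m1 (fpos h \o j z))) \-
     (EFin \o (fun z => fint m1 (fneg h \o j z))))%E//.
  by case: s2 i1 i2 => m' -> i1 i2; exact: (integrableB measurableT i1 i2).
rewrite jE fintB// -e1 -e2 -fintB//; try exact: bL1_int (bL1_fpos _ _);
  try exact: bL1_int (bL1_fneg _ _).
by rewrite {1}(fposnegE h).
Qed.

Let sgop_fib t z f : 0 < t -> bL1 m f -> bL1 m1 (f \o j z) ->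
  (sgop KP t f) \o j z = sgop K1 t (f \o j z).
Proof.
move=> t0 Bf Bfj; apply/funext => x /=; rewrite /sgop.
have [mf _ _] := Bf.
have E (h : T -> R) : measurable_fun setT h -> (forall x, 0 <= h x) ->
    fint (KP t (j z x)) h = fint (K1 t x) (h \o j z).
  move=> mh h0; rewrite /fint (KP_fib z x (h := EFin \o h))//.
  exact/measurable_EFinP.
have s := ssg_sfm HP; have s' := ssg_sfm H1.
have Bp := bL1_fpos s Bf; have Bn := bL1_fneg s Bf.
have Bjp : bL1 m1 (fpos f \o j z) := bL1_fpos s' Bfj.
have Bjn : bL1 m1 (fneg f \o j z) := bL1_fneg s' Bfj.
have fjE : f \o j z = fun s => (fpos f \o j z) s - (fneg f \o j z) s.
  by rewrite {1}(fposnegE f).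
rewrite -/(sgop KP t f (j z x)) -/(sgop K1 t (f \o j z) x) {1}(fposnegE f) fjE.
rewrite (sgopB HP)// (sgopB H1)// /sgop !E//; try by [case: Bp|case: Bn].
- exact: fneg_ge0.
- exact: fpos_ge0.
Qed.

(** The operator acts inside each fibre, so both inner products in [phi] disintegrate over the
    base. *)
Lemma phi_fib f : bL1 m f -> (forall z, bL1 m1 (f \o j z)) ->
  forall t, 0 < t -> m2.-integrable setT (EFin \o (fun z => phi m1 K1 t (f \o j z)))
    /\ phi m KP t f = fint m2 (fun z => phi m1 K1 t (f \o j z)).
Proof.
move=> Bf Bfj t t0; have s := ssg_sfm HP; have s1 := ssg_sfm H1.
have [i1 e1] := fib_fint (bL1M2 s Bf Bf) (fun z => bL1M2 s1 (Bfj z) (Bfj z)).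
have BA := sgop_bL1 HP t0 Bf.
have BAj z : bL1 m1 (sgop KP t f \o j z).
  by rewrite sgop_fib//; exact: (sgop_bL1 H1).
have [i2 e2] := fib_fint (bL1M2 s BA Bf) (fun z => bL1M2 s1 (BAj z) (Bfj z)).
have E : (fun z => phi m1 K1 t (f \o j z)) =
  (fun z => fint m1 ((fun x => f x * f x) \o j z) -
            fint m1 ((fun x => sgop KP t f x * f x) \o j z)).
  apply/funext => z; rewrite /phi /ip; congr (_ - _); congr fint.
  by rewrite -sgop_fib.
split.
  rewrite E; case: s2 i1 i2 => m' -> i1 i2.
  exact: (integrableB measurableT i1 i2).
by rewrite E fintB// -e1 -e2.
Qed.

(** A bound uniform over the fibres integrates to a finite one because the fibres on which [f] is
    not zero are indexed by a set of finite measure. *)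
Lemma phi_fib_le f t (C : R) (D : set T2) : bL1 m f ->
  (forall z, bL1 m1 (f \o j z)) -> 0 < t ->
  measurable D -> (m2 D < +oo)%E ->
  (forall z, D z -> phi m1 K1 t (f \o j z) <= C) ->
  (forall z, ~ D z -> forall s, f (j z s) = 0) ->
  phi m KP t f <= C * fine (m2 D).
Proof.
move=> Bf Bfj t0 mD Doo hD h0; have [i e] := phi_fib Bf Bfj t0.
have s1 := ssg_sfm H1.
have i1 : m2.-integrable setT (EFin \o (\1_D : T2 -> R)).
  case: s2 Doo => m' -> Doo; apply/integrableP; split.
    exact/measurable_EFinP/measurable_indic.
  rewrite (eq_integral (fun x => (\1_D x)%:E)); last first.
    by move=> y _ /=; rewrite ger0_norm.
  by rewrite integral_indic// setIT.
have iD : m2.-integrable setT (EFin \o (fun z => C * \1_D z)).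
  by case: s2 i1 => m' -> i1; exact: (integrableZl measurableT C i1).
have -> : C * fine (m2 D) = fint m2 (fun z => C * \1_D z).
  rewrite (fintZ s2 C i1); congr (_ * _); rewrite /fint; congr fine.
  by case: s2 => m' ->; rewrite integral_indic// setIT.
rewrite e; apply: le_fint => // z; rewrite indicE.
have [zD|zD] := boolP (z \in D); first by rewrite mulr1; apply: hD; exact: set_mem.
rewrite mulr0 /phi.
have -> : f \o j z = fun=> 0.
  by apply/funext => y /=; apply: h0 => Dz; rewrite mem_set in zD.
by rewrite /ip /fint; under eq_fun do rewrite mulr0; under [X in _ - fine X]eq_integralT do rewrite mulr0; rewrite subrr.
Qed.

End lift_phi.

(** * Product measures on row vectors *)

Section borelV.
Context {R : realType}.

Lemma borelV_open d (A : set 'rV[R]_d) : open A -> measurable (A : set (borelV R d)).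
Proof. by move=> oA; exact: sub_sigma_algebra. Qed.

Lemma borelV_closed d (A : set 'rV[R]_d) : closed A -> measurable (A : set (borelV R d)).
Proof.
move=> cA; rewrite -[A]setCK; apply: measurableC; apply: borelV_open.
exact: closed_openC.
Qed.

Lemma continuous_borelV_measurable d (f : 'rV[R]_d -> R) : continuous f ->
  measurable_fun (setT : set (borelV R d)) f.
Proof.
move=> cf; apply: (measurability _ (RGenOInfty.measurableE R)) => _ [_ [a ->] <-].
rewrite setTI; apply: borelV_open.
have -> : f @^-1` `]a, +oo[%classic = f @^-1` [set x | a < x].
  by apply/seteqP; split=> x /=; rewrite in_itv /= andbT.
by apply: open_comp => [x _|]; [exact: cf|exact: open_gt].
Qed.

Lemma coord_measurable d (i : 'I_d) :
  measurable_fun (setT : set (borelV R d)) (fun x : 'rV[R]_d => x ord0 i).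
Proof. by apply: continuous_borelV_measurable => x; exact: coord_continuous. Qed.

(* an open set is a countable union of balls with rational centre and radius *)
Lemma measurable_fun_borelV dT (T : measurableType dT) d (g : T -> 'rV[R]_d) :
  (forall i, measurable_fun setT (fun x => g x ord0 i)) ->
  measurable_fun setT (g : T -> borelV R d).
Proof.
move=> mg; apply: (@measurability _ _ _ (borelV R d) setT g (@open 'rV[R]_d)) => // _ [A oA <-].
rewrite setTI.
pose c (q : {ffun 'I_d -> rat}) (i : 'I_d) : R := ratr (q i).
pose Q : set ({ffun 'I_d -> rat} * nat) := [set z |
  forall x : 'rV[R]_d, (forall i, `|x ord0 i - c z.1 i| < z.2.+1%:R^-1) -> A x].
pose F (z : {ffun 'I_d -> rat} * nat) := [set x | Q z /\
  forall i, `|g x ord0 i - c z.1 i| < z.2.+1%:R^-1].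
have -> : g @^-1` A = \bigcup_z F z.
  apply/seteqP; split => x /=; last by move=> [z _ [Qz]]; exact: Qz.
  move=> Agx.
  have /nbhs_ballP[e /= e0 he] : nbhs (g x) A by exact: open_nbhs_nbhs.
  pose k := Num.truncn (2 / e).
  have k0 : 0 < k.+1%:R :> R by [].
  have ke : k.+1%:R^-1 < e / 2.
    have /andP[_] := truncn_itv (ltW (divr_gt0 (ltr0Sn R 1) e0)).
    rewrite -/k => h; rewrite -(invf_div 2 e) ltf_pV2// ?posrE ?divr_gt0//.
  have hq i : {q : rat | `|g x ord0 i - ratr q| < k.+1%:R^-1}.
    apply: cid; have : g x ord0 i - k.+1%:R^-1 < g x ord0 i + k.+1%:R^-1.
      by rewrite ltrD2l gt0_cp// invr_gt0.
    move=> /rat_in_itvoo[q]; rewrite in_itv/= => /andP[q1 q2]; exists q.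
    by rewrite distrC ltr_distl q1 q2.
  exists ([ffun i => sval (hq i)], k) => //; split => /=.
    move=> y hy; apply: he; split => // i j /=; rewrite (ord1 i).
    rewrite /ball /=; have := hy j; rewrite /c ffunE; have := svalP (hq j).
    set q := ratr _ => h1 h2; rewrite -(subrKA q).
    apply: le_lt_trans (ler_normD _ _) _; rewrite [e]splitr.
    by rewrite ltrD// ?(distrC q) (lt_trans _ ke).
  by move=> i; rewrite /c ffunE; exact: svalP (hq i).
apply: countable_bigcupT_measurable; first exact: countableP.
move=> z; have [Qz|nQz] := pselect (Q z); last first.
  by rewrite (_ : F z = set0)// -subset0 => x [].
have -> : F z = \bigcap_(i in [set` [set: 'I_d]%SET]) [set x | `|g x ord0 i - c z.1 i| < z.2.+1%:R^-1].
  apply/seteqP; split => [x [_ h] i _|x h]; first exact: h.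
  by split => // i; apply: h => /=; rewrite inE.
apply: fin_bigcap_measurable => // i _.
rewrite -[X in measurable X]setTI.
have mh : measurable_fun setT (fun x => `|g x ord0 i - c z.1 i|).
  by apply: measurableT_comp => //; exact: measurable_funB.
have := mh measurableT `]-oo, z.2.+1%:R^-1[%classic (measurable_itv _).
by congr measurable; apply/seteqP; split=> x /=; rewrite in_itv.
Qed.

Definition vcons d (z : R * 'rV[R]_d) : 'rV[R]_d.+1 := row_mx (z.1%:M : 'rV[R]_1) z.2.
Definition vhead d (x : 'rV[R]_d.+1) : R := x ord0 ord0.
Definition vtail d (x : 'rV[R]_d.+1) : 'rV[R]_d := \row_j x ord0 (lift ord0 j).

Lemma vcons0 d z : vcons z ord0 (ord0 : 'I_d.+1) = z.1.
Proof.
have -> : (ord0 : 'I_d.+1) = lshift d (ord0 : 'I_1) by exact: val_inj.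
by apply: etrans (row_mxEl _ _ _ _) _; rewrite mxE.
Qed.

Lemma vconsS d z (j : 'I_d) : vcons z ord0 (lift ord0 j) = z.2 ord0 j.
Proof.
have -> : lift ord0 j = rshift 1 j :> 'I_d.+1 by exact: val_inj.
exact: row_mxEr.
Qed.

Lemma vconsK1 d z : vhead (vcons z : 'rV_d.+1) = z.1. Proof. exact: vcons0. Qed.

Lemma vconsK2 d z : vtail (vcons z : 'rV_d.+1) = z.2.
Proof. by apply/rowP => j; rewrite mxE vconsS. Qed.

Lemma measurable_vcons d :
  measurable_fun setT (@vcons d : (R * borelV R d)%type -> borelV R d.+1).
Proof.
apply: measurable_fun_borelV => i; case: (unliftP ord0 i) => [j ->|->]; last first.
  by under eq_fun do rewrite vcons0; exact: measurable_fst.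
under eq_fun do rewrite vconsS.
exact: (measurableT_comp (@coord_measurable d j) measurable_snd).
Qed.

Lemma measurable_vhead d : measurable_fun setT (@vhead d : borelV R d.+1 -> R).
Proof. exact: coord_measurable. Qed.

Lemma measurable_vtail d : measurable_fun setT (@vtail d : borelV R d.+1 -> borelV R d).
Proof.
apply: measurable_fun_borelV => i; under eq_fun do rewrite mxE.
exact: coord_measurable.
Qed.

Lemma prod_measureS d (mu : 'I_d.+1 -> set R -> \bar R) :
  prod_measure mu = tens (@vcons d : (R * borelV R d)%type -> borelV R d.+1)
    (mu ord0) (prod_measure (fun j => mu (lift ord0 j))).
Proof. by []. Qed.

Lemma prod_measure0 (mu : 'I_0 -> set R -> \bar R) :
  prod_measure mu = (\d_((0 : 'rV[R]_0) : borelV R 0) : set (borelV R 0) -> \bar R).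
Proof. by []. Qed.

Lemma sfm_prod_measure d (mu : 'I_d -> set R -> \bar R) :
  (forall i, sfm (mu i)) -> sfm (prod_measure mu : set (borelV R d) -> \bar R).
Proof.
elim: d mu => [mu _|d IH mu smu].
  rewrite prod_measure0; apply: (@finite_sfm _ _ _ (\d_((0 : 'rV[R]_0) : borelV R 0))).
  by rewrite /= diracE in_setT ltry.
rewrite prod_measureS; apply: tens_sfm => //.
- exact: measurable_vcons.
- exact: measurable_vhead.
- exact: measurable_vtail.
- exact: vconsK1.
- exact: vconsK2.
- exact: IH.
Qed.

Lemma integral_prod_measureS d (mu : 'I_d.+1 -> set R -> \bar R)
    (f : borelV R d.+1 -> \bar R) : (forall i, sfm (mu i)) ->
  measurable_fun setT f -> (forall x, 0 <= f x)%E ->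
  (\int[(prod_measure mu : set (borelV R d.+1) -> \bar R)]_x f x =
   \int[mu ord0]_s \int[(prod_measure (fun j => mu (lift ord0 j)) :
      set (borelV R d) -> \bar R)]_z f (vcons (s, z)))%E.
Proof.
move=> smu mf f0; rewrite prod_measureS (tens_int _ (smu ord0))//.
- exact: measurable_vcons.
- exact: sfm_prod_measure.
Qed.

Lemma cartesian_product_ssg d (m : 'I_d -> set R -> \bar R)
    (K : 'I_d -> R -> R -> set R -> \bar R) : (forall i, ssg (m i) (K i)) ->
  ssg (prod_measure m : set (borelV R d) -> \bar R)
      (fun t (x : borelV R d) => prod_measure (fun i => K i t (x ord0 i))).
Proof.
elim: d m K => [m K _|d IH m K H].
  rewrite (_ : (fun t x => _) = fun (_ : R) (x : borelV R 0) => \d_x).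
    apply: ssg_dirac; rewrite prod_measure0.
    apply: (@finite_sfm _ _ _ (\d_((0 : 'rV[R]_0) : borelV R 0))).
    by rewrite /= diracE in_setT ltry.
  by apply/funext => t; apply/funext => x; rewrite prod_measure0 (thinmx0 x).
have := ssg_tens (@measurable_vcons d) (@measurable_vhead d) (@measurable_vtail d)
  (@vconsK1 d) (@vconsK2 d) (H ord0) (IH _ _ (fun j => H (lift ord0 j))).
rewrite -prod_measureS; congr ssg; apply/funext => t; apply/funext => x.
rewrite prod_measureS; congr tens; congr prod_measure; apply/funext => j.
by rewrite mxE.
Qed.

End borelV.

(** * Bounding the form on a product of two spaces by sections *)

Section tens_phi.
Context d1 d2 d (T1 : measurableType d1) (T2 : measurableType d2)
  (T : measurableType d) (R : realType).
Variables (psi : T1 * T2 -> T) (p1 : T -> T1) (p2 : T -> T2).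
Hypotheses (mpsi : measurable_fun setT psi) (mp1 : measurable_fun setT p1)
  (mp2 : measurable_fun setT p2).
Hypotheses (psiK1 : forall z, p1 (psi z) = z.1) (psiK2 : forall z, p2 (psi z) = z.2).
Variables (m1 : set T1 -> \bar R) (m2 : set T2 -> \bar R).
Variables (K1 : R -> T1 -> set T1 -> \bar R) (K2 : R -> T2 -> set T2 -> \bar R).
Hypotheses (H1 : ssg m1 K1) (H2 : ssg m2 K2).
Let s1 := ssg_sfm H1.
Let s2 := ssg_sfm H2.

Let m := tens psi m1 m2.
Let KA t x := tens psi (K1 t (p1 x)) (K2 t (p2 x)).
(** Only the first component moves, the second carrying the identity semigroup; [KQ] is the reverse,
    and [APQ] factors [KA] through the two. *)
Let KP (t : R) x := tens psi (K1 t (p1 x)) (\d_(p2 x) : set T2 -> \bar R).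
Let KQ (t : R) x := tens psi (\d_(p1 x) : set T1 -> \bar R) (K2 t (p2 x)).

Let HA : ssg m KA.
Proof. exact: (ssg_tens mpsi mp1 mp2 psiK1 psiK2 H1 H2). Qed.

Let HP : ssg m KP.
Proof. exact: (ssg_tens mpsi mp1 mp2 psiK1 psiK2 H1 (ssg_dirac s2)). Qed.

Let HQ : ssg m KQ.
Proof. exact: (ssg_tens mpsi mp1 mp2 psiK1 psiK2 (ssg_dirac s1) H2). Qed.

Let int_dirac d' (S : measurableType d') (x : S) (h : S -> \bar R) :
  measurable_fun setT h -> (\int[(\d_x : set S -> \bar R)]_y h y = h x)%E.
Proof. by move=> mh; rewrite integral_dirac// diracE in_setT mul1e. Qed.

Let KP_int t x (h : T -> \bar R) : 0 < t -> measurable_fun setT h ->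
  (forall y, 0 <= h y)%E ->
  (\int[KP t x]_y h y = \int[K1 t (p1 x)]_s h (psi (s, p2 x)))%E.
Proof.
move=> t0 mh h0; rewrite /KP (ktens_int mpsi H1 (ssg_dirac s2) t0 mh h0).
apply: eq_integralT => s; rewrite (@int_dirac _ _ _ (fun z => h (psi (s, z))))//.
exact: (measurable_fun_pair2 s (measurableT_comp mh mpsi)).
Qed.

Let KQ_int t x (h : T -> \bar R) : 0 < t -> measurable_fun setT h ->
  (forall y, 0 <= h y)%E ->
  (\int[KQ t x]_y h y = \int[K2 t (p2 x)]_z h (psi (p1 x, z)))%E.
Proof.
move=> t0 mh h0; rewrite /KQ (ktens_int mpsi (ssg_dirac s1) H2 t0 mh h0).
rewrite (@int_dirac _ _ _ (fun s => \int[K2 t (p2 x)]_z h (psi (s, z)))%E)//.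
exact: (sfm_measurable_intr (measurableT_comp mh mpsi) (fun=> h0 _) (ssg_ksfm _ H2 t0)).
Qed.

Let APQ t f : 0 < t -> bL1 m f -> sgop KA t f = sgop KP t (sgop KQ t f).
Proof.
move=> t0 Bf; have sm := ssg_sfm HA.
have pos g : bL1 m g -> (forall x, 0 <= g x) ->
    sgop KA t g = sgop KP t (sgop KQ t g).
  move=> Bg g0; have [mg _ _] := Bg; apply/funext => x.
  have BQ := sgop_bL1 HQ t0 Bg; have [mQ _ _] := BQ.
  have mg' : measurable_fun setT (EFin \o g) by exact/measurable_EFinP.
  have g0' y : (0 <= (EFin \o g) y)%E by rewrite lee_fin.
  apply: EFin_inj; rewrite (sgopE HA)// (sgopE HP)//.
  rewrite (ktens_int mpsi H1 H2 t0 mg' g0').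
  rewrite (KP_int x t0 (h := EFin \o sgop KQ t g)); first last.
  - by move=> y; rewrite lee_fin (sgop_ge0 HQ).
  - exact/measurable_EFinP.
  apply: eq_integralT => s; rewrite /= (sgopE HQ)// (KQ_int _ t0 mg' g0').
  by rewrite psiK1 psiK2.
have [f1 [f2 [F1 F2 f10 f20 ->]]] := bL1_posneg sm Bf.
have EA : sgop KA t (fun x => f1 x - f2 x) = fun x => sgop KA t f1 x - sgop KA t f2 x.
  by apply/funext => x; rewrite (sgopB HA).
have EQ : sgop KQ t (fun x => f1 x - f2 x) = fun x => sgop KQ t f1 x - sgop KQ t f2 x.
  by apply/funext => x; rewrite (sgopB HQ).
have EP : sgop KP t (fun x => sgop KQ t f1 x - sgop KQ t f2 x) =
    fun x => sgop KP t (sgop KQ t f1) x - sgop KP t (sgop KQ t f2) x.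
  by apply/funext => x; rewrite (sgopB HP)//; exact: (sgop_bL1 HQ).
by rewrite EA EQ EP !pos.
Qed.

(** The coefficients 2 and 3 are those of [phi_product_le]; each of the two terms is then integrated
    over the coordinate that stays fixed. *)
Lemma tens_phi_le f t (C1 C2 : R) (D1 : set T1) (D2 : set T2) : bL1 m f ->
  (forall z, bL1 m1 (fun s => f (psi (s, z)))) ->
  (forall s, bL1 m2 (fun z => f (psi (s, z)))) -> 0 < t ->
  measurable D1 -> (m1 D1 < +oo)%E -> measurable D2 -> (m2 D2 < +oo)%E ->
  (forall z, D2 z -> phi m1 K1 t (fun s => f (psi (s, z))) <= C1) ->
  (forall z, ~ D2 z -> forall s, f (psi (s, z)) = 0) ->
  (forall s, D1 s -> phi m2 K2 t (fun z => f (psi (s, z))) <= C2) ->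
  (forall s, ~ D1 s -> forall z, f (psi (s, z)) = 0) ->
  phi m KA t f <= 2 * (C1 * fine (m2 D2)) + 3 * (C2 * fine (m1 D1)).
Proof.
move=> Bf B1 B2 t0 mD1 D1oo mD2 D2oo h2 h2' h1 h1'.
apply: le_trans (phi_product_le HA HP HQ APQ t0 Bf) _.
apply: lerD; rewrite ler_pM2l//.
- apply: (@phi_fib_le _ _ _ _ _ _ R m m1 m2 KP K1 (fun z s => psi (s, z))) => //.
  + move=> h mh h0; have mhp := measurableT_comp mh mpsi; split.
      exact: (sfm_measurable_intl mhp (fun=> h0 _) s1).
    rewrite /m (tens_int mpsi s1 s2 mh h0).
    exact: (sfm_tonelli mhp (fun=> h0 _) s1 s2).
  + move=> t' z s h t'0 mh h0; rewrite (KP_int _ t'0 mh h0) psiK1.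
    by apply: eq_integralT => y; rewrite psiK2.
- apply: (@phi_fib_le _ _ _ _ _ _ R m m2 m1 KQ K2 (fun s z => psi (s, z))) => //.
  + move=> h mh h0; have mhp := measurableT_comp mh mpsi; split.
      exact: (sfm_measurable_intr mhp (fun=> h0 _) s2).
    by rewrite /m (tens_int mpsi s1 s2 mh h0).
  + move=> t' s z h t'0 mh h0; rewrite (KQ_int _ t'0 mh h0) psiK2.
    by apply: eq_integralT => y; rewrite psiK1.
Qed.

End tens_phi.

(** * Functions on a box that are Lipschitz in each coordinate *)

Section boxfun.
Context {R : realType}.

Definition cbox d (a b : 'I_d -> R) : set 'rV[R]_d :=
  [set x | forall i, a i <= x ord0 i <= b i].

(** Fixing a coordinate preserves this class with the same [M] and [L]. The constants are parameters
    because the bound in dimension one has to be uniform over all sections of a function. *)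
Definition boxfun d (a b : 'I_d -> R) (M L : R) (f : 'rV[R]_d -> R) : Prop :=
  [/\ measurable_fun (setT : set (borelV R d)) f, forall x, `|f x| <= M,
      forall x, ~ cbox a b x -> f x = 0
    & forall i (x y : 'rV[R]_d), (forall j, j != i -> x ord0 j = y ord0 j) ->
        `|f x - f y| <= L * `|x ord0 i - y ord0 i|].

Definition itvfun (a b M L : R) (g : R -> R) : Prop :=
  [/\ measurable_fun setT g, forall x, `|g x| <= M,
      forall x, ~ (a <= x <= b) -> g x = 0
    & forall x y, `|g x - g y| <= L * `|x - y|].

Lemma measurable_cbox d (a b : 'I_d -> R) : measurable (cbox a b : set (borelV R d)).
Proof.
have -> : cbox a b = \bigcap_(i in [set` [set: 'I_d]%SET])
    [set x | a i <= x ord0 i <= b i].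
  by apply/seteqP; split => [x h i _|x h i]; [exact: h|apply: h => /=; rewrite inE].
apply: fin_bigcap_measurable => // i _.
have := coord_measurable i measurableT (measurable_itv `[a i, b i]).
by rewrite setTI; congr measurable; apply/seteqP; split=> x /=; rewrite in_itv.
Qed.

Lemma prod_measure_cbox_fin d (m : 'I_d -> set R -> \bar R) (a b : 'I_d -> R) :
  (forall i, sfm (m i)) -> (forall i, m i `[a i, b i]%classic < +oo)%E ->
  (prod_measure m (cbox a b) < +oo)%E.
Proof.
elim: d m a b => [m a b _ _|d IH m a b sm moo].
  by rewrite prod_measure0 diracE; case: (_ \in _); rewrite ltry.
have IHd := IH _ _ _ (fun j => sm (lift ord0 j)) (fun j => moo (lift ord0 j)).
rewrite prod_measureS /tens.
set m' := prod_measure _ in IHd *.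
have sm' : sfm (m' : set (borelV R d) -> \bar R) by exact: sfm_prod_measure.
rewrite (@eq_integralT _ _ _ _ _ (fun s => (m' (cbox (fun j => a (lift ord0 j)) (fun j => b (lift ord0 j))) *
   (\1_(`[a ord0, b ord0]%classic) s)%:E)%E)); last first.
  move=> s; rewrite indicE; have [sI|sI] := boolP (s \in _).
    rewrite mule1; congr (m' _); apply/seteqP; split => z /= h.
      by move=> j; have := h (lift ord0 j); rewrite vconsS.
    move=> i; case: (unliftP ord0 i) => [j ->|->]; first by rewrite vconsS; exact: h.
    by rewrite vcons0; move/set_mem: sI => /=; rewrite in_itv.
  rewrite mule0 (_ : [set z | _] = set0); last first.
    rewrite -subset0 => z /= /(_ ord0); rewrite vcons0 /= => h.
    by move/negP: sI; apply; apply/mem_set; rewrite /= in_itv.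
  by case: sm' => k ->; rewrite measure0.
case: sm' IHd => k -> IHd; have := moo ord0; case: (sm ord0) => k0 -> k0oo.
rewrite ge0_integralZl//; last exact/measurable_EFinP/measurable_indic.
rewrite integral_indic// setIT.
by rewrite lte_mul_pinfty// ge0_fin_numE.
Qed.

Lemma bL1_bounded_support d' (T : measurableType d') (m : set T -> \bar R) (D : set T)
    (f : T -> R) (M : R) : sfm m -> measurable D -> (m D < +oo)%E ->
  measurable_fun setT f -> (forall x, `|f x| <= M) -> (forall x, ~ D x -> f x = 0) ->
  bL1 m f.
Proof.
move=> sm mD Doo mf fM f0; apply: (@bL1_le _ _ _ _ sm _ (fun x => M * \1_D x)) => //.
- move=> x; rewrite normrM indicE.
  have [xD|xD] := boolP (x \in D).
    by rewrite normr1 mulr1 (le_trans (fM x))// ler_norm.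
  by rewrite f0 ?normr0 ?mulr0// => Dx; rewrite mem_set in xD.
- apply: bL1Z => //; split; first exact: measurable_indic.
    by exists 1 => x; rewrite indicE; case: (_ \in _); rewrite ?normr1 ?normr0.
  apply/integrableP; split; first exact/measurable_EFinP/measurable_indic.
  rewrite (@eq_integralT _ _ _ _ _ (fun x => (\1_D x)%:E)); last first.
    by move=> y /=; rewrite ger0_norm.
  by case: sm Doo => k -> Doo; rewrite integral_indic// setIT.
Qed.

Lemma boxfun_bL1 d (m : 'I_d -> set R -> \bar R) (a b : 'I_d -> R) M L f :
  (forall i, sfm (m i)) -> (forall i, m i `[a i, b i]%classic < +oo)%E ->
  boxfun a b M L f -> bL1 (prod_measure m : set (borelV R d) -> \bar R) f.
Proof.
move=> sm moo [mf fM f0 _].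
apply: (@bL1_bounded_support _ (borelV R d) _ (cbox a b) f M) => //.
- exact: sfm_prod_measure.
- exact: measurable_cbox.
- exact: prod_measure_cbox_fin.
Qed.

Lemma itvfun_bL1 (m : set R -> \bar R) a b M L g : sfm m ->
  (m `[a, b]%classic < +oo)%E -> itvfun a b M L g -> bL1 m g.
Proof.
move=> sm moo [mg gM g0 _]; apply: (@bL1_bounded_support _ R _ `[a, b]%classic g M) => //.
Qed.

Lemma boxfun_head d (a b : 'I_d.+1 -> R) M L f z : boxfun a b M L f ->
  itvfun (a ord0) (b ord0) M L (fun s => f (vcons (s, z))).
Proof.
move=> [mf fM f0 fL]; split => //.
- exact: (@measurable_fun_pair1 _ _ _ R (borelV R d) R (f \o @vcons R d) z
    (measurableT_comp mf (@measurable_vcons R d))).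
- by move=> x xab; apply: f0 => /(_ ord0); rewrite vcons0.
- move=> x y; have := fL ord0 (vcons (x, z)) (vcons (y, z)).
  rewrite !vcons0; apply => j; case: (unliftP ord0 j) => [k ->|->]; last by rewrite eqxx.
  by rewrite !vconsS.
Qed.

Lemma boxfun_tail d (a b : 'I_d.+1 -> R) M L f s : boxfun a b M L f ->
  boxfun (fun j => a (lift ord0 j)) (fun j => b (lift ord0 j)) M L
    (fun z => f (vcons (s, z))).
Proof.
move=> [mf fM f0 fL]; split => //.
- exact: (@measurable_fun_pair2 _ _ _ R (borelV R d) R (f \o @vcons R d) s
    (measurableT_comp mf (@measurable_vcons R d))).
- by move=> x xab; apply: f0 => h; apply: xab => j; have := h (lift ord0 j); rewrite vconsS.
- move=> i x y xy; have := fL (lift ord0 i) (vcons (s, x)) (vcons (s, y)).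
  rewrite !vconsS; apply => j; case: (unliftP ord0 j) => [k ->|->]; last by rewrite !vcons0.
  by rewrite !vconsS => ki; apply: xy; apply: contra_neq ki => ->.
Qed.

(** Induction on [d], splitting off the first coordinate with [tens_phi_le]. The constant is chosen
    before the function, since the hypothesis is applied to infinitely many sections at once. *)
Lemma phi_boxfun d (m : 'I_d -> set R -> \bar R) (K : 'I_d -> R -> R -> set R -> \bar R)
    (a b : 'I_d -> R) (M L : R) :
  (forall i, ssg (m i) (K i)) -> (forall i, m i `[a i, b i]%classic < +oo)%E ->
  (forall i, exists C, forall g, itvfun (a i) (b i) M L g ->
     forall t, 0 < t -> phi (m i) (K i) t g <= C * t) ->
  exists C, forall f, boxfun a b M L f -> forall t, 0 < t ->
    phi (prod_measure m : set (borelV R d) -> \bar R)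
      (fun t (x : borelV R d) => prod_measure (fun i => K i t (x ord0 i))) t f <= C * t.
Proof.
elim: d m K a b => [|d IH] m K a b H moo hC.
  (* In dimension 0 the kernels are Dirac masses: the semigroup is the identity and [phi]
     vanishes. *)
  exists 0 => f _ t t0; rewrite mul0r.
  have -> : (fun t (x : borelV R 0) => prod_measure (fun i => K i t (x ord0 i))) =
      fun (_ : R) (x : borelV R 0) => (\d_x : set (borelV R 0) -> \bar R).
    by apply/funext => r; apply/funext => x; rewrite prod_measure0 (thinmx0 x).
  have mT (h : 'rV[R]_0 -> R) : measurable_fun (setT : set (borelV R 0)) h.
    move=> _ Y _; rewrite setTI; have [Y0|Y0] := pselect (Y (h 0)).
      by rewrite (_ : h @^-1` Y = setT)// -subTset => x _ /=; rewrite (thinmx0 x).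
    by rewrite (_ : h @^-1` Y = set0)// -subset0 => x /=; rewrite (thinmx0 x).
  rewrite /phi subr_le0 le_eqVlt; apply/orP; left; apply/eqP; congr ip.
  apply/funext => x; rewrite /sgop /fint integral_dirac//; first by rewrite diracE in_setT mul1e.
  by have := mT f; move/measurable_EFinP.
have [C2 hC2] := IH _ _ _ _ (fun j => H (lift ord0 j)) (fun j => moo (lift ord0 j))
  (fun j => hC (lift ord0 j)).
have [C1 hC1] := hC ord0.
have sm i := ssg_sfm (H i).
pose D2 : set (borelV R d) := cbox (fun j => a (lift ord0 j)) (fun j => b (lift ord0 j)).
set m2 := prod_measure (fun j => m (lift ord0 j)).
exists (2 * (C1 * fine (m2 D2)) + 3 * (C2 * fine (m ord0 `[a ord0, b ord0]%classic))).
move=> f bf t t0.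
have KE : (fun t (x : borelV R d.+1) => prod_measure (fun i => K i t (x ord0 i))) =
   (fun t x => tens (@vcons R d : (R * borelV R d)%type -> borelV R d.+1)
      (K ord0 t (vhead x)) (prod_measure (fun j => K (lift ord0 j) t (vtail x ord0 j)))).
  apply/funext => r; apply/funext => x.
  have <- : (fun j => K (lift ord0 j) r (x ord0 (lift ord0 j))) =
      (fun j => K (lift ord0 j) r (vtail x ord0 j)).
    by apply/funext => j; rewrite mxE.
  by rewrite prod_measureS.
have Bf := boxfun_bL1 sm moo bf.
rewrite KE prod_measureS.
have := @tens_phi_le _ _ _ _ _ _ R _ _ _ (@measurable_vcons R d) (@measurable_vhead R d)
  (@measurable_vtail R d) (@vconsK1 R d) (@vconsK2 R d) (m ord0) m2 (K ord0) _ (H ord0)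
  (cartesian_product_ssg (fun j => H (lift ord0 j))) f t (C1 * t) (C2 * t)
  `[a ord0, b ord0]%classic D2 Bf.
move=> /(_ (fun z => itvfun_bL1 (sm ord0) (moo ord0) (boxfun_head z bf))).
move=> /(_ (fun s => boxfun_bL1 (fun j => sm (lift ord0 j))
   (fun j => moo (lift ord0 j)) (boxfun_tail s bf)) t0).
move=> /(_ (measurable_itv _) (moo ord0) (measurable_cbox _ _)).
move=> /(_ (prod_measure_cbox_fin (fun j => sm (lift ord0 j)) (fun j => moo (lift ord0 j)))).
move=> h; rewrite [leRHS](_ : _ = 2 * (C1 * t * fine (m2 D2)) +
   3 * (C2 * t * fine (m ord0 `[a ord0, b ord0]%classic))); last by ring.
apply: h.
- by move=> z _; apply: hC1 => //; exact: boxfun_head bf.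
- move=> z zD s; case: bf => _ _ f0 _; apply: f0 => h; apply: zD => j.
  by have := h (lift ord0 j); rewrite vconsS.
- by move=> s _; apply: hC2 => //; exact: boxfun_tail bf.
- move=> s sD z; case: bf => _ _ f0 _; apply: f0 => h; apply: sD => /=.
  by rewrite in_itv /=; have := h ord0; rewrite vcons0.
Qed.

End boxfun.

(** * Extending identities from sets to nonnegative functions *)

Section nnfunctional.
Local Open Scope ereal_scope.
Context d (T : measurableType d) (R : realType).
Implicit Types (F G : (T -> \bar R) -> \bar R) (f g h : T -> \bar R).
Import HBNNSimple.

Definition mnn f := measurable_fun setT f /\ forall x, 0 <= f x.

(** What an integral and an iterated kernel integral have in common: additivity, homogeneity and
    monotone convergence. Symmetry, which is given for sets, is extended to functions through this
    interface. *)
Record nnfunctional F : Prop := Nnfunctional {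
  nnf_D : forall f g, mnn f -> mnn g -> F (fun x => f x + g x) = F f + F g ;
  nnf_Z : forall (c : R) f, (0 <= c)%R -> mnn f -> F (fun x => c%:E * f x) = c%:E * F f ;
  nnf_cvg : forall (f_ : nat -> T -> \bar R) f, (forall n, mnn (f_ n)) ->
    (forall x, nondecreasing_seq (f_ ^~ x)) -> mnn f ->
    (forall x, f_ ^~ x @ \oo --> f x) -> (fun n => F (f_ n)) @ \oo --> F f }.

(** Linearity gives agreement on simple functions, and the increasing approximation of [f] by simple
    functions does the rest. *)
Lemma nnfunctional_ext F G : nnfunctional F -> nnfunctional G ->
  (forall A, measurable A -> F (fun x => (\1_A x)%:E) = G (fun x => (\1_A x)%:E)) ->
  forall f, mnn f -> F f = G f.
Proof.
move=> nF nG FG f [mf f0].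
have ind A : measurable A -> mnn (fun x => (\1_A x)%:E).
  by move=> mA; split=> [|x]; [exact/measurable_EFinP/measurable_indic|rewrite lee_fin].
have mnn0 : mnn (fun=> 0) by split => //.
have F0 H : nnfunctional H -> H (fun=> 0) = 0.
  move=> nH; have H0 := nnf_Z nH (lexx 0%R) mnn0.
  transitivity (H (fun=> 0%:E * 0)); last by rewrite H0 mul0e.
  by congr H; apply/funext => x; rewrite mul0e.
have sums (s : seq R) (A : R -> set T) : (forall r, r \in s -> (0 <= r)%R) ->
    (forall r, measurable (A r)) ->
    mnn (fun x => \sum_(r <- s) r%:E * (\1_(A r) x)%:E) /\
    F (fun x => \sum_(r <- s) r%:E * (\1_(A r) x)%:E) =
    G (fun x => \sum_(r <- s) r%:E * (\1_(A r) x)%:E).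
  move=> + mA; elim: s => [_|r s IH hs].
    by under eq_fun do rewrite big_nil; rewrite !F0.
  have r0 : (0 <= r)%R by apply: hs; rewrite inE eqxx.
  have [ms es] := IH (fun q qs => hs q ltac:(by rewrite inE qs orbT)).
  under eq_fun do rewrite big_cons.
  have mr : mnn (fun x => r%:E * (\1_(A r) x)%:E).
    have [mi i0] := ind _ (mA r); split; first exact: measurable_funeM.
    by move=> x; rewrite mule_ge0.
  split.
    split; first exact: emeasurable_funD mr.1 ms.1.
    by move=> x; apply: adde_ge0; [exact: mr.2|exact: ms.2].
  rewrite (nnf_D nF mr ms) (nnf_D nG mr ms) es.
  by rewrite (nnf_Z nF r0 (ind _ (mA r))) (nnf_Z nG r0 (ind _ (mA r))) FG.
pose f_ := nnsfun_approx measurableT mf.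
have fE n : (fun x => (f_ n x)%:E) = fun x =>
    \sum_(r <- fset_set (range (f_ n : T -> R))) r%:E * (\1_(f_ n @^-1` [set r]) x)%:E.
  apply/funext => x; rewrite fimfunE fsbig_finite//= -sumEFin.
  by apply: eq_bigr => r _; rewrite EFinM.
have range0 n r : r \in fset_set (range (f_ n)) -> (0 <= r)%R.
  by rewrite in_fset_set; [move=> /set_mem[x _ <-]; exact: fun_ge0|exact: fimfunP].
have S n := sums (fset_set (range (f_ n))) (fun r => f_ n @^-1` [set r])
  (range0 n) (fun r => ltac:(exact: measurable_sfunP)).
have mf_ n : mnn (fun x => (f_ n x)%:E) by rewrite fE; exact: (S n).1.
have nd x : nondecreasing_seq (fun n => (f_ n x)%:E).
  by move=> n m nm; rewrite lee_fin; exact/lefP/nd_nnsfun_approx.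
have cv x : (fun n => (f_ n x)%:E) @ \oo --> f x.
  by apply: cvg_nnsfun_approx.
have cF := nnf_cvg nF mf_ nd (conj mf f0) cv.
have cG := nnf_cvg nG mf_ nd (conj mf f0) cv.
apply: (@cvg_unique _ _ ((fun n => F (fun x => (f_ n x)%:E)) @ \oo)) => //.
rewrite (_ : (fun n => F _) = fun n => G (fun x => (f_ n x)%:E))//.
by apply/funext => n; rewrite fE (S n).2.
Qed.

End nnfunctional.

Section kernel_functional.
Local Open Scope ereal_scope.
Context d (T : measurableType d) (R : realType).

(** Multiplication is not continuous at [+oo * 0]. When the limit is 0, monotonicity makes every
    term 0 and the products are constant. *)
Lemma nondecreasing_cvgeZl (u : nat -> \bar R) (l h : \bar R) : 0 <= h ->
  (forall n, 0 <= u n) -> nondecreasing_seq u -> u @ \oo --> l ->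
  (fun n => h * u n) @ \oo --> h * l.
Proof.
move=> h0 u0 nu ul; have ule n : u n <= l.
  have -> : l = ereal_sup (range u).
    apply: cvg_unique ul _ => //; exact: ereal_nondecreasing_cvgn.
  by apply: ereal_sup_ubound; exists n.
case: h h0 => [r r0|_|//]; first by apply: cvgeZl.
have : 0 <= l by exact: le_trans (u0 0%N) (ule 0%N).
rewrite le_eqVlt => /predU1P[l0|l0].
  rewrite -l0 mule0; apply: cvg_near_cst; apply: nearW => n.
  suff -> : u n = 0 by rewrite mule0.
  by apply/eqP; rewrite eq_le u0 l0 ule.
apply: cvgeM => //; last exact: cvg_cst.
by rewrite mule_defE (gt_eqF l0).
Qed.

Variable m : {measure set T -> \bar R}.
Variable h : T -> \bar R.
Hypothesis mh : mnn h.

Lemma nnfunctional_integral : nnfunctional (fun f => \int[m]_x f x).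
Proof.
split.
- by move=> f g [mf f0] [mg g0]; rewrite ge0_integralD.
- by move=> c f c0 [mf f0]; rewrite ge0_integralZl.
- move=> f_ f mf_ nd [mf f0] cv.
  have := @cvg_monotone_convergence _ _ _ m setT measurableT f_ (fun n => (mf_ n).1)
     (fun n x _ => (mf_ n).2 x) (fun x _ => nd x).
  rewrite (_ : \int[m]_(x in _) _ = \int[m]_x f x)//.
  by apply: eq_integralT => x; apply/cvg_lim => //; exact: cv.
Qed.

Lemma nnfunctional_comp (F : (T -> \bar R) -> \bar R)
    (Phi : (T -> \bar R) -> (T -> \bar R)) :
  nnfunctional F -> (forall f, mnn f -> mnn (Phi f)) ->
  (forall x, nnfunctional (fun f => Phi f x)) -> 
  (forall f g, mnn f -> mnn g -> (forall x, f x <= g x) -> forall x, Phi f x <= Phi g x) ->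
  nnfunctional (fun f => F (Phi f)).
Proof.
move=> nF mPhi nPhi lePhi; split.
- move=> f g mf mg; rewrite -(nnf_D nF (mPhi _ mf) (mPhi _ mg)); congr F.
  by apply/funext => x; rewrite (nnf_D (nPhi x)).
- move=> c f c0 mf; rewrite -(nnf_Z nF c0 (mPhi _ mf)); congr F.
  by apply/funext => x; rewrite (nnf_Z (nPhi x)).
- move=> f_ f mf_ nd mf cv; apply: (nnf_cvg nF).
  + by move=> n; exact: mPhi.
  + by move=> x n k nk; apply: lePhi => // y; exact: nd.
  + exact: mPhi.
  + by move=> x; exact: (nnf_cvg (nPhi x)).
Qed.

Lemma nnfunctional_mulx x : nnfunctional (fun f => h x * f x).
Proof.
have [mh' h0] := mh; split.
- by move=> f g [_ f0] [_ g0]; rewrite ge0_muleDr.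
- by move=> c f c0 _; rewrite muleCA.
- move=> f_ f mf_ nd [_ f0] cv; apply: nondecreasing_cvgeZl => //.
  by move=> n; exact: (mf_ n).2.
Qed.

Lemma nnfunctional_mul : nnfunctional (fun f => \int[m]_x (h x * f x)).
Proof.
have [mh' h0] := mh.
apply: (nnfunctional_comp (Phi := fun f x => h x * f x) nnfunctional_integral).
- move=> f [mf f0]; split; first exact: emeasurable_funM.
  by move=> x; exact: mule_ge0.
- exact: nnfunctional_mulx.
- by move=> f g _ _ fg x; exact: lee_wpmul2l.
Qed.

Variable K : T -> {measure set T -> \bar R}.
Hypothesis mK : forall f : T -> \bar R, mnn f -> measurable_fun setT (fun x => \int[K x]_y f y).

Lemma nnfunctional_kernel : nnfunctional (fun f => \int[m]_x (h x * \int[K x]_y f y)).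
Proof.
apply: (nnfunctional_comp (Phi := fun f x => \int[K x]_y f y) nnfunctional_mul).
- by move=> f mf; split => [|x]; [exact: mK|apply: integral_ge0 => y _; exact: mf.2].
- move=> x; split.
  + by move=> f g [mf f0] [mg g0]; rewrite ge0_integralD.
  + by move=> c f c0 [mf f0]; rewrite ge0_integralZl.
  + move=> f_ f mf_ nd [mf f0] cv.
    have := @cvg_monotone_convergence _ _ _ (K x) setT measurableT f_ (fun n => (mf_ n).1)
       (fun n x _ => (mf_ n).2 x) (fun x _ => nd x).
    rewrite (_ : \int[K x]_(x in _) _ = \int[K x]_x f x)//.
    by apply: eq_integralT => y; apply/cvg_lim => //; exact: cv.
- move=> f g [mf f0] [mg g0] fg x; apply: ge0_le_integral => //.
Qed.

End kernel_functional.

(** The extension is made one argument at a time: in [g] with [f] an indicator, then in [f]. At each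
    stage one side is a weighted integral and the other an iterated kernel integral. *)
Lemma kernel_sym d (T : measurableType d) (R : realType)
    (m : {measure set T -> \bar R}) (K : T -> {measure set T -> \bar R}) :
  (forall f : T -> \bar R, mnn f -> measurable_fun setT (fun x => \int[K x]_y f y)%E) ->
  (forall A B, measurable A -> measurable B ->
    (\int[m]_(x in A) K x B = \int[m]_(x in B) K x A)%E) ->
  forall f g, mnn f -> mnn g ->
    (\int[m]_x (f x * \int[K x]_y g y) = \int[m]_x (g x * \int[K x]_y f y))%E.
Proof.
move=> mK symK.
have ind (A : set T) : measurable A -> mnn (fun x => (\1_A x)%:E : \bar R).
  by move=> mA; split=> [|x]; [exact/measurable_EFinP/measurable_indic|rewrite lee_fin].
have KA x A : measurable A -> (\int[K x]_y (\1_A y)%:E = K x A)%E.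
  by move=> mA; rewrite integral_indic// setIT.
have mKA f : mnn f -> mnn (fun x => \int[K x]_y f y)%E.
  move=> mf; split; first exact: mK.
  by move=> x; apply: integral_ge0 => y _; exact: mf.2.
have indE A B : measurable A -> measurable B ->
    (\int[m]_x ((\1_A x)%:E * \int[K x]_y (\1_B y)%:E) = \int[m]_(x in A) K x B)%E.
  move=> mA mB; rewrite [RHS]integral_mkcond; apply: eq_integralT => x.
  rewrite KA// patchE indicE; case: (x \in A); first by rewrite mul1e.
  by rewrite mul0e.
have step A g : measurable A -> mnn g ->
    (\int[m]_x ((\1_A x)%:E * \int[K x]_y g y) = \int[m]_x (g x * \int[K x]_y (\1_A y)%:E))%E.
  move=> mA mg.
  under [RHS]eq_integralT do rewrite muleC.
  have agree B : measurable B -> (\int[m]_x ((\1_A x)%:E * \int[K x]_y (\1_B y)%:E) =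
      \int[m]_x (\int[K x]_y (\1_A y)%:E * (\1_B x)%:E))%E.
    by move=> mB; under [RHS]eq_integralT do rewrite muleC; rewrite !indE// symK.
  exact: (nnfunctional_ext (nnfunctional_kernel m (ind _ mA) mK)
    (nnfunctional_mul m (mKA _ (ind _ mA))) agree mg).
move=> f g mf mg.
under [LHS]eq_integralT do rewrite muleC.
have agree A : measurable A -> (\int[m]_x (\int[K x]_y g y * (\1_A x)%:E) =
    \int[m]_x (g x * \int[K x]_y (\1_A y)%:E))%E.
  by move=> mA; under [LHS]eq_integralT do rewrite muleC; exact: step.
exact: (nnfunctional_ext (nnfunctional_mul m (mKA _ mg))
  (nnfunctional_kernel m mg mK) agree mf).
Qed.

(** * One-dimensional diffusions *)

Section killed_kernel.
Context (R : realType) (I : set R).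
Variable p : R.-spker R ~> R.
Context d (S : measurableType d).

(** Only the values of the transition function at points of [I] are constrained. Setting the kernel
    to zero off [I] gives a semigroup on the whole line; the component in [S] fits the shape of
    [ssg_meas]. *)
Definition killed of measurable I := fun z : S * R =>
  mscale (\1_I z.2 : R)%:nng (p z.2) : {measure set R -> \bar R}.

Hypothesis mI : measurable I.

Let killedE z A : killed mI z A = ((\1_I z.2)%:E * p z.2 A)%E.
Proof. by []. Qed.

Let killed_meas U : measurable U -> measurable_fun setT (killed mI ^~ U).
Proof.
move=> mU; under eq_fun do rewrite killedE.
apply: emeasurable_funM.
  apply/measurable_EFinP.
  rewrite (_ : (fun x => _) = (\1_I : R -> R) \o (snd : S * R -> R))//.
  apply: measurableT_comp; first exact: measurable_indic.
  exact: measurable_snd.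
exact: (@measurableT_comp _ _ _ (S * R)%type R _ (p ^~ U) _ snd
  (measurable_kernel p U mU) measurable_snd).
Qed.

HB.instance Definition _ := isKernel.Build _ _ _ _ R (killed mI) killed_meas.

Let killed_le1 : (ereal_sup [set killed mI x setT | x in setT] <= 1)%E.
Proof.
apply: ge_ereal_sup => _ /= [z _ <-]; rewrite killedE -[leRHS]mule1.
apply: lee_pmul => //; first by rewrite lee_fin indicE; case: (_ \in _).
exact: sprob_kernel_le1.
Qed.

HB.instance Definition _ :=
  Kernel_isSubProbability.Build _ _ _ _ R (killed mI) killed_le1.

End killed_kernel.

Section minimal_ssg.
Context (R : realType) (I : set R) (m : {measure set R -> \bar R}).
Variable p : R -> R.-spker R ~> R.

Definition ktrans (t x : R) (A : set R) : \bar R := ((\1_I x)%:E * p t x A)%E.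

Lemma ktransE t x : I x -> ktrans t x = p t x.
Proof.
by move=> Ix; apply/funext => A; rewrite /ktrans indicE mem_set// mul1e.
Qed.

Let ktrans0 t x A : ~ I x -> ktrans t x A = 0%E.
Proof. by move=> Ix; rewrite /ktrans indicE memNset// mul0e. Qed.

Hypotheses (oI : open I) (sfm_m : sfm m) (mI0 : m (~` I) = 0%E).
Hypothesis Hp : symmetric_transition I m p.

Let mI : measurable I. Proof. exact: open_measurable. Qed.

Let ktrans_killed t d (S : measurableType d) (z : S * R) :
  ktrans t z.2 = killed (p t) mI z.
Proof. by []. Qed.

Let ktrans_sfm t x : sfm (ktrans t x).
Proof.
rewrite (ktrans_killed t (tt, x)); apply: finite_sfm.
by rewrite (le_lt_trans (sprob_kernel_le1 (killed (p t) mI) _))// ltry.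
Qed.

(** Off [I] both sides of Chapman-Kolmogorov are 0. On [I] the kernel agrees with [p], and the
    killing of the second kernel restricts the integral to [I], as in the hypothesis. *)
Lemma ktrans_ssg : ssg m ktrans.
Proof.
have [p0 pck psym] := Hp.
have meas t d' (S : measurableType d') (f : S * R -> \bar R) :
    measurable_fun setT f -> (forall z, 0 <= f z)%E ->
    measurable_fun setT (fun z : S * R => \int[ktrans t z.2]_y f (z.1, y))%E.
  move=> mf f0.
  have := @measurable_fun_integral_finite_kernel _ _ (S * R)%type R R
    (fun w => f (w.1.1, w.2)) (killed (p t) mI) (fun=> f0 _).
  apply; apply: (measurableT_comp mf); apply: measurable_fun_pair => //.
  exact: (measurableT_comp measurable_fst measurable_fst).
split => //.
- move=> t x t0; exists (killed (p t) mI (tt, x)); split => //.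
  exact: (sprob_kernel_le1 (killed (p t) mI)).
- by move=> t t0; exact: meas.
- move=> t r t0 r0 f mf f0 x.
  have [Ix|Ix] := pselect (I x); last first.
    have Z t' g : (forall x, 0 <= g x)%E -> (\int[ktrans t' x]_y g y = 0)%E.
      move=> g0; rewrite (_ : ktrans t' x = mzero) ?integral_measure_zero//.
      by apply/funext => A; exact: ktrans0.
    by rewrite !Z// => y; exact: sfm_integral_ge0.
  rewrite (ktransE (t + r) Ix).
  have := @integral_kcomp _ _ _ R R R R (p t) (killed (p r) mI) x f f0 mf.
  rewrite (ktransE t Ix) => <-.
  apply: eq_measure_integral => A mA _ /=.
  rewrite pck// /kcomp integral_mkcond; apply: eq_integralT => y.
  rewrite patchE; have [Iy|Iy] := boolP (y \in I).
    by change (p r y A = ktrans r y A); rewrite ktransE//; exact: set_mem.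
  change (0%E = ktrans r y A); rewrite ktrans0// => Iy'; rewrite mem_set in Iy => //.
- move=> t t0 f g mf f0 mg g0.
  apply: (@kernel_sym _ R R m (fun x => killed (p t) mI (tt, x))) => //.
    move=> h [mh h0].
    have := meas t _ unit (h \o snd) (measurableT_comp mh measurable_snd) (fun=> h0 _).
    exact: (measurable_fun_pair2 tt).
  move=> A B mA mB.
  (* The two sets may be cut down to [I]: the kernel is killed at starting points off [I], and from
     points of [I] it does not charge the complement. *)
  have red A' B' : measurable A' -> measurable B' ->
      (\int[m]_(x in A') ktrans t x B' = \int[m]_(x in A' `&` I) p t x (B' `&` I))%E.
    move=> mA' mB'; rewrite [LHS]integral_mkcond [RHS]integral_mkcond.
    apply: eq_integralT => x; rewrite !patchE in_setI.
    have [Ix|Ix] := boolP (x \in I); last first.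
      by rewrite andbF; case: ifP => // _; rewrite /ktrans indicE (negbTE Ix) mul0e.
    rewrite andbT; case: ifP => // _; rewrite /ktrans indicE Ix mul1e.
    rewrite [in LHS](_ : B' = (B' `&` I) `|` (B' `&` ~` I)); last first.
      by rewrite -setIUr setUv setIT.
    rewrite measureU//; first last.
    + by rewrite setIACA setICr setI0.
    + by apply: measurableI => //; exact: measurableC.
    + exact: measurableI.
    rewrite -[RHS]adde0; congr (_ + _)%E.
    apply/eqP; rewrite eq_le measure_ge0 andbT -(p0 t x t0 (set_mem Ix)).
    apply: le_measure; [apply/mem_set|apply/mem_set|exact: subIsetr].
      by apply: measurableI => //; exact: measurableC.
    exact: measurableC.
  have := psym t (A `&` I) (B `&` I) t0 (measurableI _ _ mA mI) (measurableI _ _ mB mI)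
    (@subIsetr _ _ _) (@subIsetr _ _ _).
  move=> h; apply: etrans (red A B mA mB) _; rewrite h; exact/esym/red.
Qed.

End minimal_ssg.

Lemma sfm_integral_mkcond d (T : measurableType d) (R : realType)
    (m : set T -> \bar R) D f : sfm m ->
  (\int[m]_(x in D) f x = \int[m]_x (f \_ D) x)%E.
Proof. by move=> [m' ->]; exact: integral_mkcond. Qed.

(** * The Dirichlet form of a process as a limit of [phi t u / t] *)

Section approx.
Context d (T : measurableType d) (R : realType) (D : set T).
Variables (m : set T -> \bar R) (K p : R -> T -> set T -> \bar R).
Hypotheses (mD : measurable D) (H : ssg m K).
Hypothesis Kp : forall t x, 0 < t -> D x -> K t x = p t x.

Lemma L2_bL1 u : bL1 m u -> (forall x, ~ D x -> u x = 0) -> L2 D m u.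
Proof.
move=> Bu u0; have [mu _ _] := Bu; split; first exact: measurable_funTS.
rewrite (sfm_integral_mkcond _ _ (ssg_sfm H)) (@eq_integralT _ _ _ _ _ (fun x => (u x * u x)%:E)); last first.
  move=> x; rewrite patchE; have [Dx|Dx] := boolP (x \in D); first by rewrite expr2.
  by rewrite u0 ?mul0r// => Dx'; rewrite mem_set in Dx.
have := bL1_int (bL1M2 (ssg_sfm H) Bu Bu).
by case: (ssg_sfm H) => m' -> /(integrable_lty measurableT).
Qed.

(** As [u] vanishes off [D], integrals over [D] are integrals over the whole space, and inside them
    [K] may stand for [p]. *)
Lemma approx_formE u t : bL1 m u -> (forall x, ~ D x -> u x = 0) -> 0 < t ->
  approx_form D m p t u = (phi m K t u / t)%:E.
Proof.
move=> Bu u0 t0; rewrite /approx_form /phi.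
have E1 : (\int[m]_(x in D) ((u x) ^+ 2)%:E = (ip m u u)%:E)%E.
  rewrite (ipE (ssg_sfm H) Bu Bu) (sfm_integral_mkcond _ _ (ssg_sfm H)); apply: eq_integralT => x.
  rewrite patchE; have [Dx|Dx] := boolP (x \in D); first by rewrite expr2.
  by rewrite u0 ?mul0r// => Dx'; rewrite mem_set in Dx.
have BA := sgop_bL1 H t0 Bu.
have E2 : (\int[m]_(x in D) ((u x)%:E * \int[p t x]_(y in D) (u y)%:E) =
    (ip m (sgop K t u) u)%:E)%E.
  rewrite (ipE (ssg_sfm H) BA Bu) (sfm_integral_mkcond _ _ (ssg_sfm H)); apply: eq_integralT => x.
  rewrite patchE; have [Dx|Dx] := boolP (x \in D); last first.
    by rewrite u0 ?mulr0// => Dx'; rewrite mem_set in Dx.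
  rewrite mulrC EFinM (sgopE H)// -Kp//; last exact: set_mem.
  congr (_ * _)%E; rewrite (sfm_integral_mkcond _ _ (ssg_ksfm x H t0)); apply: eq_integralT => y.
  rewrite patchE; have [Dy|Dy] := boolP (y \in D) => //.
  by rewrite u0// => Dy'; rewrite mem_set in Dy.
by rewrite E1 E2 -EFinB -EFinM mulrC.
Qed.

Lemma dirichlet_formP u (e : R) : bL1 m u -> (forall x, ~ D x -> u x = 0) ->
  dirichlet_form D m p u e <-> (fun t => phi m K t u / t) @ (0 : R)^'+ --> e.
Proof.
move=> Bu u0.
have E : {near (0 : R)^'+, (fun t => (phi m K t u / t)%:E) =1
    (fun t => approx_form D m p t u)}.
  by near=> t; rewrite approx_formE.
have E' : {near (0 : R)^'+, (fun t => approx_form D m p t u) =1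
    (fun t => (phi m K t u / t)%:E)}.
  by near=> t; rewrite approx_formE.
split.
  move=> [_ ae].
  have : (fun t => (phi m K t u / t)%:E) @ (0 : R)^'+ --> e%:E.
    by apply: cvg_trans ae; exact: near_eq_cvg.
  by move=> /fine_cvgP[].
move=> cv; split; first exact: L2_bL1.
apply: (cvg_trans (near_eq_cvg E)); by apply/fine_cvgP; split => //; exact: nearW.
Unshelve. all: by end_near. Qed.

End approx.

Lemma ge0_integral_mrestr d (T : measurableType d) (R : realType)
    (m : {measure set T -> \bar R}) (D : set T) (mD : measurable D) (f : T -> \bar R) :
  mnn f -> (\int[mrestr m mD]_x f x = \int[m]_(x in D) f x)%E.
Proof.
move=> mf.
have mnnD : mnn (fun x => (\1_D x)%:E : \bar R).
  by split=> [|x]; [exact/measurable_EFinP/measurable_indic|rewrite lee_fin].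
rewrite (nnfunctional_ext (nnfunctional_integral (mrestr m mD))
  (nnfunctional_mul m mnnD) _ mf).
  rewrite [RHS]integral_mkcond; apply: eq_integralT => x; rewrite patchE indicE.
  by case: (x \in D); rewrite ?mul1e ?mul0e.
move=> A mA; rewrite integral_indic// setIT.
transitivity (\int[m]_x (\1_(A `&` D) x)%:E)%E.
  by rewrite integral_indic ?setIT//; exact: measurableI.
apply: eq_integralT => x; rewrite !indicE in_setI andbC.
by case: (x \in D); rewrite ?mul1e ?mul0e.
Qed.

(** * The inverse scale and the energy in the scale variable *)

Section scale.
Context {R : realType} (I : set R) (s : R -> R).
Hypotheses (oI : open_interval I) (hs : scaling_function I s).
Let J := s @` I.
Let t := scale_inv I s.

Lemma scale_lt x y : I x -> I y -> (s x < s y) = (x < y).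
Proof.
move=> Ix Iy; have [smon _ _] := hs.
have [xy|yx|->] := ltgtP x y.
- by rewrite smon.
- by apply/negbTE; rewrite -leNgt ltW// smon.
- by rewrite ltxx.
Qed.

Lemma scale_le x y : I x -> I y -> (s x <= s y) = (x <= y).
Proof. by move=> Ix Iy; rewrite leNgt scale_lt// -leNgt. Qed.

Lemma scale_inj : {in I &, injective s}.
Proof.
move=> x y /set_mem Ix /set_mem Iy sxy.
by apply/eqP; rewrite eq_le -(scale_le Ix Iy) -(scale_le Iy Ix) sxy lexx.
Qed.

Lemma scale_invK x : I x -> t (s x) = x.
Proof. by move=> Ix; exact: (pinvKV (fun=> 0) scale_inj (mem_set Ix)). Qed.

Lemma scale_invP y : J y -> I (t y) /\ s (t y) = y.
Proof. by move=> [x Ix <-]; rewrite scale_invK. Qed.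

Lemma scale_inv_lt y z : J y -> J z -> (t y < t z) = (y < z).
Proof.
by move=> /scale_invP[Iy {2}<-] /scale_invP[Iz {2}<-]; rewrite scale_lt.
Qed.

Lemma scale_inv_le y z : J y -> J z -> (t y <= t z) = (y <= z).
Proof. by move=> Jy Jz; rewrite leNgt scale_inv_lt// -leNgt. Qed.

Lemma scale_cts_itv a b : I a -> I b -> {within `[a, b], continuous s}.
Proof.
move=> Ia Ib; have [_ cs _] := hs; have [_ iI _] := oI.
apply: continuous_in_subspaceT => x /set_mem; rewrite /= in_itv /= => xab.
by apply: cs; exact: (iI a b Ia Ib).
Qed.

Lemma scale_between a b y : I a -> I b -> s a <= y <= s b -> J y /\ a <= t y <= b.
Proof.
move=> Ia Ib /andP[ay yb]; have sab := le_trans ay yb.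
have ab : a <= b by rewrite -scale_le.
have [|c cab <-] := IVT (v := y) ab (scale_cts_itv Ia Ib).
  by rewrite ge_min ay le_max yb orbT.
have Ic : I c by have [_ iI _] := oI; apply: (iI a b Ia Ib); move: cab; rewrite in_itv.
split; first by exists c.
by rewrite scale_invK//; move: cab; rewrite in_itv.
Qed.

Lemma scale_image_interval : is_interval J.
Proof. by move=> _ _ [x Ix <-] [y Iy <-] z xzy; have [] := scale_between Ix Iy xzy. Qed.

Lemma interval_around x (e : R) : I x -> 0 < e ->
  exists a b, [/\ I a, I b, x - e < a, b < x + e & a < x < b].
Proof.
move=> Ix e0; have [opI _ _] := oI.
have : \forall r \near (0 : R)^'+, `[x - r, x + r]%classic `<=` I /\ 0 < r < e.
  near=> r; split; first by near: r; exact: open_itvcc_subset.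
  by apply/andP; split => //; near: r; exact: nbhs_right_lt.
move=> /filter_ex[r [rI /andP[r0 re]]].
exists (x - r), (x + r); split.
- by apply: rI; rewrite /= in_itv /= lexx /=; lra.
- by apply: rI; rewrite /= in_itv /= lexx andbT; lra.
- by rewrite ltrD2l ltrN2.
- by rewrite ltrD2l.
- by rewrite gtrBl ltrDl r0.
Unshelve. all: by end_near. Qed.

(** The intermediate value theorem on a small interval around [t y]. Both openness of [J] and
    continuity of [t] are read off from it. *)
Lemma scale_image_nbhs y (e : R) : J y -> 0 < e -> exists2 del, 0 < del &
  forall z, `|y - z| < del -> J z /\ `|t y - t z| < e.
Proof.
move=> [x Ix <-] e0; rewrite scale_invK//.
have [a [b [Ia Ib ha hb /andP[ax xb]]]] := interval_around Ix e0.
exists (Num.min (s x - s a) (s b - s x)).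
  by rewrite lt_min !subr_gt0 !scale_lt// ax.
move=> z; rewrite lt_min => /andP[h1 h2].
have [|Jz /andP[az zb]] := @scale_between a b z Ia Ib.
  move: h1 h2; rewrite !ltr_distl; case: (leP z (s x)) => zx; lra.
split => //; rewrite distrC ltr_distl (lt_le_trans ha az) /=.
exact: le_lt_trans zb hb.
Qed.

Lemma scale_image_open : open J.
Proof.
rewrite openE => y Jy; have [del del0 h] := scale_image_nbhs Jy ltr01.
by exists del => //= z yz; have [] := h z yz.
Qed.

Lemma scale_inv_continuous y : J y -> {for y, continuous t}.
Proof.
move=> Jy; apply/cvgrPdist_lt => e e0.
have [del del0 h] := scale_image_nbhs Jy e0.
by exists del => //= z yz; have [] := h z yz.
Qed.

Let mI : measurable I. Proof. by case: oI => opI _ _; exact: open_measurable. Qed.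

Let mJ : measurable J. Proof. exact: open_measurable scale_image_open. Qed.

Let tau := t \_ J.

Let mtau : measurable_fun setT tau.
Proof.
apply/(measurable_restrictT t mJ).
apply: open_continuous_measurable_fun; first exact: scale_image_open.
by move=> y /set_mem; exact: scale_inv_continuous.
Qed.

(** The Stieltjes measure is the image of Lebesgue measure on [J] under the inverse scale, extended
    by 0 so as to be measurable on the line. This makes a measure of a bare set function and gives
    the change of variable. *)
Let scale_measureE :
  scale_measure I s = pushforward (mrestr lebesgue_measure mJ) tau.
Proof.
apply/funext => A; rewrite /scale_measure /pushforward /mrestr; congr lebesgue_measure.
apply/seteqP; split => [_ [x [Ax Ix] <-]|y [Ay Jy]].
  have Jsx : J (s x) by exists x.
  by split => //=; rewrite /tau patchE mem_set//= scale_invK.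
move: Ay; rewrite /= /tau patchE mem_set// => Ay.
by have [It st] := scale_invP Jy; exists (t y).
Qed.

Let eq_scale_integral (f g : R -> \bar R) : (forall x, I x -> f x = g x) ->
  (\int[scale_measure I s]_(x in I) f x = \int[scale_measure I s]_(x in I) g x)%E.
Proof.
move=> fg; rewrite scale_measureE.
apply: (@eq_integral _ _ _ (measure_function_pushforward__canonical__measure_function_Measure
  (mrestr lebesgue_measure mJ) mtau)) => x /set_mem; exact: fg.
Qed.

Lemma scale_integral (G : R -> \bar R) : measurable_fun I G ->
  (forall x, 0 <= G x)%E ->
  (\int[scale_measure I s]_(x in I) G x = \int[lebesgue_measure]_(y in J) G (t y))%E.
Proof.
move=> mG G0; rewrite scale_measureE.
rewrite ge0_integral_pushforward//.
rewrite integral_mkcond ge0_integral_mrestr; last first.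
  split; last by move=> x; rewrite patchE; case: ifP => // _; exact: G0.
  apply/(measurable_restrictT _ _).1.
    by rewrite -[X in measurable X]setTI; exact: mtau.
  apply: (@measurable_comp _ _ _ _ _ _ I) => //.
    by move=> _ [x ? <-].
  exact: measurable_funTS.
apply: eq_integral => y /set_mem Jy; rewrite patchE.
have tauE : tau y = t y by rewrite /tau patchE mem_set.
rewrite mem_set /= ?tauE//; by have [] := scale_invP Jy.
Qed.

Lemma scale_derivE (w ph : R -> R) x : (forall x, I x -> w x = ph (s x)) -> I x ->
  scale_deriv I s w x = derive1 ph (s x).
Proof.
move=> wph Ix; rewrite /scale_deriv !derive1E; apply: near_eq_derive.
have Jsx : J (s x) by exists x.
have : \forall y \near s x, J y by apply: open_nbhs_nbhs; split => //; exact: scale_image_open.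
apply: filterS => y Jy /=; have [It st] := scale_invP Jy.
by rewrite wph// st.
Qed.

Lemma energy_core (w ph : R -> R) : (forall x, I x -> w x = ph (s x)) ->
  continuous (derive1 ph) ->
  energy I s w w =
  ((2^-1)%:E * \int[lebesgue_measure]_(y in J) ((derive1 ph y) ^+ 2)%:E)%E.
Proof.
move=> wph cph; rewrite /energy; congr (_ * _)%E.
pose G x : \bar R := ((derive1 ph (s x)) ^+ 2)%:E.
have mG : measurable_fun I G.
  apply/measurable_EFinP; apply: measurable_funX.
  apply: open_continuous_measurable_fun; first by case: oI.
  move=> x /set_mem Ix; apply: continuous_comp; last exact: cph.
  by have [_ cs _] := hs; exact: cs.
transitivity (\int[scale_measure I s]_(x in I) G x)%E.
  apply: eq_scale_integral => x Ix.
  by rewrite /G (scale_derivE wph)// expr2.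
have G0 x : (0 <= G x)%E by rewrite lee_fin sqr_ge0.
rewrite (scale_integral mG G0).
apply: eq_integral => y /set_mem Jy; rewrite /G.
by have [_ ->] := scale_invP Jy.
Qed.

End scale.

(** * From increments of the inverse scale to energy bounds *)

Section step_sum.
Context {R : realType}.
Implicit Types (F c : nat -> R).

Lemma telescope_step F c (k N : nat) : (k < N)%N ->
  (forall j, (j < k)%N -> c j = 1) -> (forall j, (k < j)%N -> c j = 0) ->
  \sum_(j < N) (F j.+1 - F j) * c j = F k - F 0%N + (F k.+1 - F k) * c k.
Proof.
move=> kN c1 c0; rewrite -(big_mkord xpredT (fun j => (F j.+1 - F j) * c j)).
rewrite (big_cat_nat (leq0n k) (ltnW kN)) /=; congr (_ + _).
  rewrite -(telescope_sumr _ (leq0n k)); apply: eq_big_nat => j /andP[_ jk].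
  by rewrite c1// mulr1.
rewrite big_ltn// [X in _ + X]big_nat_cond big1 ?addr0// => j /andP[/andP[kj _] _].
by rewrite c0// mulr0.
Qed.

End step_sum.

Section core_approx.
Context {R : realType}.
Variables (sg : R -> R) (B : R).
Hypotheses (sgC : forall n, Ck n sg) (sg0 : forall x, x <= 0 -> sg x = 0)
  (sg1 : forall x, 1 <= x -> sg x = 1) (sg01 : forall x, 0 <= sg x <= 1)
  (sgB : forall x : R, `|derive1 sg x| <= B * (0 < x < 1)%R%:R).
Variables (F : nat -> R) (al h : R) (N : nat).
Hypotheses (h0 : 0 < h).
Let Y (k : nat) : R := al + k%:R * h.

(* smooth, with value [F k - F 0] at the node [Y k] *)
Definition interp (y : R) : R :=
  \sum_(k < N) (F k.+1 - F k) * sg ((y - al) / h - k%:R).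

Lemma interp_Ck n : Ck n interp.
Proof.
apply: (@Ck_sum _ n N (fun k y => (F k.+1 - F k) * sg ((y - al) / h - k%:R))) => k.
apply: CkM; first exact: Ck_cst.
apply: Ck_comp => //; apply: CkD; last exact: Ck_cst.
apply: CkM; last exact: Ck_cst.
by apply: CkD; [exact: Ck_id|exact: Ck_cst].
Qed.

Lemma interp_derive y : derive1 interp y =
  \sum_(k < N) (F k.+1 - F k) / h * derive1 sg ((y - al) / h - k%:R).
Proof.
apply: is_derive_derive1.
have -> : interp = \sum_(k < N) (fun y => (F k.+1 - F k) * sg ((y - al) / h - k%:R)).
  by apply/funext => z; rewrite fct_sumE.
suff dk (k : 'I_N) : is_derive y 1 (fun y => (F k.+1 - F k) * sg ((y - al) / h - k%:R))
    ((F k.+1 - F k) / h * derive1 sg ((y - al) / h - k%:R)).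
  exact: (is_derive_sum dk).
have [dsg _] := CkS_elim (sgC 1).
have d1 : is_derive y 1 (fun y => (y - al) / h - k%:R) h^-1.
  have -> : (fun y => (y - al) / h - k%:R) = (fun y => h^-1 *: y + (- (al / h) - k%:R)).
    by apply/funext => z; rewrite /GRing.scale /=; ring.
  have := is_deriveD (is_deriveZ h^-1 (is_derive_id y 1))
     (is_derive_cst (- (al / h) - k%:R) y 1).
  by rewrite /GRing.scale /= mulr1 addr0.
have := is_deriveZ (F k.+1 - F k) 
   (@is_derive1_comp _ sg (fun y => (y - al) / h - k%:R) y _ _ (dsg ((y - al) / h - k%:R)) d1).
by rewrite /GRing.scale /= mulrA mulrAC.
Qed.

Lemma interp_cell y k : (k < N)%N -> Y k <= y <= Y k.+1 ->
  interp y = F k - F 0%N + (F k.+1 - F k) * sg ((y - al) / h - k%:R).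
Proof.
move=> kN /andP[y1 y2].
apply: (telescope_step F (c := fun j => sg ((y - al) / h - j%:R))) => // j jk.
  apply: sg1; rewrite lerBrDr ler_pdivlMr// lerBrDl; apply: le_trans y1.
  by rewrite lerD2l ler_pM2r// nat1r ler_nat.
apply: sg0; rewrite subr_le0 ler_pdivrMr// lerBlDl; apply: le_trans y2 _.
by rewrite lerD2l ler_pM2r// ler_nat.
Qed.

Lemma interp_left y : y <= al -> interp y = 0.
Proof.
move=> yal; rewrite /interp big1// => k _; rewrite sg0 ?mulr0//.
rewrite subr_le0 ler_pdivrMr// (le_trans (_ : _ <= 0)) ?subr_le0//.
by rewrite mulr_ge0// ltW.
Qed.

Lemma interp_right y : Y N <= y -> interp y = F N - F 0%N.
Proof.
move=> yN; rewrite /interp -(big_mkord xpredT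
  (fun k => (F k.+1 - F k) * sg ((y - al) / h - k%:R))).
rewrite -(telescope_sumr _ (leq0n N)); apply: eq_big_nat => k /andP[_ kN].
rewrite sg1 ?mulr1// lerBrDr ler_pdivlMr// lerBrDl; apply: le_trans yN.
by rewrite lerD2l ler_pM2r// nat1r ler_nat.
Qed.

Lemma find_cell y : al <= y < Y N -> exists2 k, (k < N)%N & Y k <= y <= Y k.+1.
Proof.
move=> /andP[y1 y2]; pose k := Num.truncn ((y - al) / h).
have z0 : 0 <= (y - al) / h by rewrite divr_ge0 ?subr_ge0// ltW.
have /andP[k1 k2] := truncn_itv z0.
have Yk : Y k <= y by rewrite /Y addrC -lerBrDr -ler_pdivlMr.
exists k.
  by rewrite -(ltr_nat R) -(ltr_pM2r h0) -(ltrD2l al); exact: le_lt_trans Yk y2.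
by rewrite Yk /Y addrC -lerBlDr -ler_pdivrMr// ltW.
Qed.

(** At each point at most one step is in transition, so squaring the sum produces no cross terms. *)
Lemma interp_derive_sqr y : (derive1 interp y) ^+ 2 <=
  \sum_(k < N) ((F k.+1 - F k) / h * B) ^+ 2 * \1_(`]Y k, Y k.+1[%classic) y.
Proof.
rewrite interp_derive; set z := (y - al) / h.
have inz (k : nat) : (0 < z - k%:R < 1) = (y \in `]Y k, Y k.+1[%classic).
  rewrite mem_setE in_itv /= /Y subr_gt0 ltrBlDr /z ltr_pdivlMr// ltr_pdivrMr//.
  by rewrite ltrBrDl ltrBlDl -nat1r.
have nn (k : nat) : 0 <= ((F k.+1 - F k) / h * B) ^+ 2 * \1_(`]Y k, Y k.+1[%classic) y.
  by rewrite mulr_ge0 ?sqr_ge0.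
have B0 : 0 <= B.
  have := sgB (2^-1); rewrite invr_gt0 ltr0Sn invf_lt1// ltr1n mulr1.
  exact: le_trans.
have [[k hk]|nk] := pselect (exists k : 'I_N, 0 < z - k%:R < 1); last first.
  rewrite big1 ?expr0n /=; first by apply: sumr_ge0 => k _.
  move=> k _; have := sgB (z - k%:R).
  have -> : (0 < z - k%:R < 1) = false by apply/negbTE/negP => zk; apply: nk; exists k.
  by rewrite mulr0 normr_le0 => /eqP ->; rewrite mulr0.
rewrite (bigD1 k)//= big1 ?addr0.
  rewrite (bigD1 k)//= -[leLHS]addr0 lerD//; last by apply: sumr_ge0.
  rewrite indicE -inz hk mulr1 -[leLHS]real_normK ?num_real// -[leRHS]real_normK ?num_real//.
  rewrite lerXn2r ?nnegrE// !normrM ler_wpM2l// (ger0_norm B0).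
  by have := sgB (z - k%:R); rewrite hk mulr1.
move=> j jk; have := sgB (z - j%:R).
have -> : (0 < z - j%:R < 1) = false.
  apply/negbTE/negP => /andP[j1 j2]; move/andP: hk => [k1 k2].
  move/negP: jk; apply; apply/eqP/val_inj => /=.
  have [jk|kj|//] := ltngtP (val j) (val k).
  + have : (nat_of_ord j)%:R + 1 <= (nat_of_ord k)%:R :> R by rewrite natr1 ler_nat.
    by move=> jk1; exfalso; move: j2 k1 jk1; lra.
  + have : (nat_of_ord k)%:R + 1 <= (nat_of_ord j)%:R :> R by rewrite natr1 ler_nat.
    by move=> jk1; exfalso; move: k2 j1 jk1; lra.
by rewrite mulr0 normr_le0 => /eqP ->; rewrite mulr0.
Qed.

Lemma interp_energy (D : set R) : measurable D ->
  (\int[lebesgue_measure]_(y in D) ((derive1 interp y) ^+ 2)%:E <=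
   (\sum_(k < N) ((F k.+1 - F k) / h * B) ^+ 2 * h)%:E)%E.
Proof.
move=> mD.
have cd : continuous (derive1 interp).
  move=> x; apply: differentiable_continuous; apply/derivable1_diffP.
  exact: (@Ck_derivable _ 2 _ (interp_Ck 2) 1 x).
have md : measurable_fun setT (derive1 interp) by exact: continuous_measurable_fun.
pose c (k : nat) := ((F k.+1 - F k) / h * B) ^+ 2.
apply: (@le_trans _ _ (\int[lebesgue_measure]_y (\sum_(k < N)
    (c k)%:E * (\1_(`]Y k, Y k.+1[%classic) y)%:E)))%E.
  apply: (@le_trans _ _ (\int[lebesgue_measure]_y ((derive1 interp y) ^+ 2)%:E)%E).
    apply: ge0_subset_integral => //.
    - exact/measurable_EFinP/measurable_funX.
    - by move=> x _; rewrite lee_fin sqr_ge0.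
  apply: ge0_le_integral => //.
  - by move=> x _; rewrite lee_fin sqr_ge0.
  - exact/measurable_EFinP/measurable_funX.
  - apply: emeasurable_sum => k; apply: measurable_funeM.
    exact/measurable_EFinP/measurable_indic.
  - move=> y _; rewrite (_ : (\sum_(k < N) _)%E = (\sum_(k < N) c k * \1_(`]Y k, Y k.+1[%classic) y)%:E).
      by rewrite lee_fin; exact: interp_derive_sqr.
    by rewrite -sumEFin; apply: eq_bigr => k _; rewrite EFinM.
rewrite ge0_integral_sum//; first last.
- by move=> k x _; rewrite mule_ge0// lee_fin sqr_ge0.
- by move=> k; apply: measurable_funeM; exact/measurable_EFinP/measurable_indic.
rewrite -sumEFin; apply: lee_sum => k _.
rewrite ge0_integralZl//; last first.
- by rewrite lee_fin sqr_ge0.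
- exact/measurable_EFinP/measurable_indic.
rewrite integral_indic// setIT.
have Yk : @lebesgue_measure R `]Y k, Y k.+1[%classic = h%:E.
  rewrite lebesgue_measure_itv /= lte_fin ifT; last by rewrite /Y ltrD2l ltr_pM2r// ltr_nat.
  by rewrite -EFinB /Y -natr1; congr EFin; ring.
by rewrite [X in (_ * X)%E](_ : _ = h%:E)// -EFinM.
Qed.

End core_approx.

(** * The semigroup of a minimal diffusion *)

Section minimal_core.
Context {R : realType} (I : set R) (s : R -> R) (m : {measure set R -> \bar R})
  (p : R -> R.-spker R ~> R).
Hypotheses (oI : open_interval I) (hs : scaling_function I s)
  (hm : speed_measure I m) (hX : minimal_diffusion I s m p).

Let opI : open I. Proof. by case: oI. Qed.
Let mI : measurable I. Proof. exact: open_measurable. Qed.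

Lemma itv_subset a b : I a -> I b -> `[a, b]%classic `<=` I.
Proof.
move=> Ia Ib x /=; rewrite in_itv /= => xab.
by have [_ iI _] := oI; exact: (iI a b Ia Ib).
Qed.

Lemma speed_itv_fin a b : I a -> I b -> (m `[a, b]%classic < +oo)%E.
Proof.
move=> Ia Ib; have [_ mK _] := hm; apply: mK; first exact: segment_compact.
exact: itv_subset.
Qed.

(** The complement of [I] is null, and [I] is covered by the countably many compact intervals whose
    ends are rational points of [I]. *)
Lemma speed_sfm : sfm m.
Proof.
apply: sigma_finite_sfm.
pose G (ab : rat * rat) := if `[< I (ratr ab.1) /\ I (ratr ab.2) >]
    then `[ratr ab.1 : R, ratr ab.2]%classic else ~` I.
pose F n := if n is n'.+1 then oapp G (~` I) (unpickle n') else ~` I.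
have mCI : (m (~` I) < +oo)%E by have [-> _ _] := hm; rewrite ltry.
exists F.
  apply/seteqP; split => // x _; have [Ix|nIx] := pselect (I x); last by exists 0%N.
  have [a [b [Ia Ib _ _ /andP[ax xb]]]] := interval_around oI Ix ltr01.
  have [q1 q1in] := rat_in_itvoo ax; have [q2 q2in] := rat_in_itvoo xb.
  exists (pickle (q1, q2)).+1; first exact: Logic.I.
  rewrite /F pickleK /= /G; have [_ iI _] := oI.
  move: q1in q2in; rewrite !in_itv /= => /andP[aq1 q1x] /andP[xq2 q2b].
  case: asboolP => [_|[]]; first by rewrite /= in_itv /= !ltW.
  split; apply: (iI a b Ia Ib); apply/andP; split; apply/ltW => //.
    exact: lt_trans q1x xb.
  exact: lt_trans ax xq2.
have mG q : measurable (G q) /\ (m (G q) < +oo)%E.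
  rewrite /G; case: asboolP => [[Iq1 Iq2]|_]; last by split => //; exact: measurableC.
  by split => //; exact: speed_itv_fin.
have mC : measurable (~` I) /\ (m (~` I) < +oo)%E by split => //; exact: measurableC.
by case=> [//|n]; rewrite /F; case: unpickle => [q|//]; exact: mG.
Qed.

Lemma minimal_ssg : ssg m (ktrans I p).
Proof.
by have [sX _] := hX; exact: (ktrans_ssg opI speed_sfm sX).
Qed.

Lemma minimal_dirichletP u (e : R) : bL1 m u -> (forall x, ~ I x -> u x = 0) ->
  minimal_form I s m u e <-> (fun t => phi m (ktrans I p) t u / t) @ (0 : R)^'+ --> e.
Proof.
move=> Bu u0; have [_ hX2] := hX; rewrite -hX2.
have Kp t x : 0 < t -> I x -> ktrans I p t x = p t x by move=> _; exact: ktransE.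
exact: (@dirichlet_formP _ R R I m (ktrans I p) (fun t x => p t x) minimal_ssg Kp u e Bu u0).
Qed.

(** A core function is approximated by the constant sequence, so its energy is the limit of
    [phi t w / t] and bounds all these quotients. *)
Lemma core_phi_le w ph (e : R) : bL1 m w -> (forall x, ~ I x -> w x = 0) ->
  (forall x, I x -> w x = ph (s x)) -> Ccinfty1 (s @` I) ph ->
  continuous (derive1 ph) -> energy I s w w = e%:E ->
  forall t, 0 < t -> phi m (ktrans I p) t w <= e * t.
Proof.
move=> Bw w0 wph Cph cph we; apply: (phi_le_limit minimal_ssg Bw).
apply/(minimal_dirichletP e Bw w0); split.
  exact: (@L2_bL1 _ R R I m (ktrans I p) minimal_ssg w Bw w0).
exists (fun=> w); split.
- by move=> _; exists ph.
- rewrite (_ : (fun n : nat => _) = fun=> 0%E); first exact: cvg_cst.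
  apply/funext => n; rewrite -[RHS](@integral0_eq _ _ _ m I (fun=> 0%E))//.
  by apply: eq_integral => x _; rewrite subrr expr0n.
- move=> eps eps0; exists 0%N => n k _ _.
  rewrite (@energy_core _ I s oI hs _ (fun=> 0)).
  + rewrite integral0_eq ?mule0 ?lee_fin ?ltW// => y _.
    by rewrite (is_derive_derive1 (is_derive_cst 0 y 1)) expr0n.
  + by move=> x _; rewrite /= subrr.
  + rewrite (_ : derive1 _ = fun=> 0); first exact: cst_continuous.
    by apply/funext => y; rewrite (is_derive_derive1 (is_derive_cst 0 y 1)).
- by rewrite we; exact: cvg_cst.
Qed.

End minimal_core.

Lemma ip_le_measure d (T : measurableType d) (R : realType) (m : set T -> \bar R)
    (f : T -> R) (D : set T) (c : R) : sfm m -> bL1 m f -> measurable D ->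
  (m D < +oo)%E -> 0 <= c -> (forall x, D x -> f x ^+ 2 <= c) ->
  (forall x, ~ D x -> f x = 0) -> ip m f f <= c * fine (m D).
Proof.
move=> sm Bf mD Doo c0 fc f0.
have iff := bL1_int (bL1M2 sm Bf Bf); have eq_ip := ipE sm Bf Bf.
case: sm Doo iff eq_ip => m' -> Doo iff eq_ip.
rewrite -lee_fin eq_ip EFinM fineK; last first.
  by rewrite ge0_fin_numE ?measure_ge0.
rewrite -(setIT D) -integral_indic// -ge0_integralZl//; last first.
  exact/measurable_EFinP/measurable_indic.
apply: ge0_le_integral => //.
- by move=> x _; rewrite lee_fin -expr2 sqr_ge0.
- by have /integrableP[] := iff.
- by apply: measurable_funeM; exact/measurable_EFinP/measurable_indic.
- move=> x _; rewrite -EFinM lee_fin -expr2 indicE.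
  have [xD|xD] := boolP (x \in D); first by rewrite mulr1; apply: fc; exact: set_mem.
  by rewrite f0 ?expr0n ?mulr0// => Dx; rewrite mem_set in xD.
Qed.

(** * Smooth interpolation of Lipschitz functions in the scale variable *)

Section itvfun_phi.
Context {R : realType} (I : set R) (s : R -> R) (m : {measure set R -> \bar R})
  (p : R -> R.-spker R ~> R).
Hypotheses (oI : open_interval I) (hs : scaling_function I s)
  (hm : speed_measure I m) (hX : minimal_diffusion I s m p).
Variables (a b C0 : R).
Hypotheses (Ia : I a) (Ib : I b) (ab : a < b).
Let t := scale_inv I s.
Let step (N : nat) := (s b - s a) / N%:R.
Let node (N k : nat) := s a + k%:R * step N.
Hypothesis hC0 : forall N, (0 < N)%N ->
  \sum_(k < N) (t (node N k.+1) - t (node N k)) ^+ 2 <= C0 * step N.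

Let sab : s a < s b. Proof. by rewrite (scale_lt hs). Qed.
Let step_gt0 N : (0 < N)%N -> 0 < step N.
Proof. by move=> N0; rewrite divr_gt0 ?subr_gt0 ?ltr0n. Qed.
Let node_last N : (0 < N)%N -> node N N = s b.
Proof. by move=> N0; rewrite /node /step mulrC divfK ?subrKC// pnatr_eq0 -lt0n. Qed.

Let C0_ge0 : 0 <= C0.
Proof.
have h1 : 0 < step 1 by exact: step_gt0.
rewrite -(pmulr_lge0 _ h1); apply: le_trans (hC0 (ltnSn 0)).
by apply: sumr_ge0 => k _; exact: sqr_ge0.
Qed.

Let node_J N k : (0 < N)%N -> (k <= N)%N -> (s @` I) (node N k).
Proof.
move=> N0 kN; have [|//] := @scale_between _ I s oI hs a b (node N k) Ia Ib.
apply/andP; split; first by rewrite lerDl mulr_ge0// ltW// step_gt0.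
by rewrite -(node_last N0) lerD2l ler_pM2r ?step_gt0// ler_nat.
Qed.

Section approximation.
Variables (sg : R -> R) (B : R).
Hypotheses (sgC : forall n, Ck n sg) (sg0 : forall x, x <= 0 -> sg x = 0)
  (sg1 : forall x, 1 <= x -> sg x = 1) (sg01 : forall x, 0 <= sg x <= 1)
  (sgB : forall x : R, `|derive1 sg x| <= B * (0 < x < 1)%R%:R).
Variables (g : R -> R) (M L : R).
Hypothesis hg : itvfun a b M L g.

Let gL x y : `|g x - g y| <= L * `|x - y|. Proof. by case: hg. Qed.

Let L0 : 0 <= L.
Proof. by have := gL 1 0; rewrite subr0 normr1 mulr1; exact: le_trans. Qed.

(** Used at [a] and [b]: by continuity [g] vanishes at both ends. The interpolation then returns to
    0 at the last node, so that it has compact support in the image of [s] and gives a core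
    function. *)
Let end0 c : (forall e : R, 0 < e -> exists2 x, `|c - x| <= e & g x = 0) -> g c = 0.
Proof.
move=> h; apply/eqP; rewrite -normr_le0; apply/ler_addgt0Pr => e e0; rewrite add0r.
have L10 : 0 < L + 1 by rewrite ltr_wpDl.
have [x cx gx] := h (e / (L + 1)) (divr_gt0 e0 L10).
have := gL c x; rewrite gx subr0 => /le_trans; apply.
apply: (@le_trans _ _ ((L + 1) * `|c - x|)); first by rewrite ler_wpM2r// lerDl.
by rewrite -ler_pdivlMl// mulrC.
Qed.

Let ga : g a = 0.
Proof.
apply: end0 => e e0; exists (a - e); first by rewrite opprB addrC subrK gtr0_norm.
by case: hg => _ _ g0 _; apply: g0; rewrite (_ : a <= a - e = false)//; apply/negbTE; rewrite -ltNge gtrBl.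
Qed.

Let gb : g b = 0.
Proof.
apply: end0 => e e0; exists (b + e); first by rewrite opprD addNKr normrN gtr0_norm.
case: hg => _ _ g0 _; apply: g0; rewrite (_ : b + e <= b = false) ?andbF//.
by apply/negbTE; rewrite -ltNge ltrDl.
Qed.

Variables (N : nat).
Hypothesis N0 : (0 < N)%N.
Let h := step N.
Let h0 : 0 < h. Proof. exact: step_gt0. Qed.
Let F k := g (t (node N k)).
Let ph := interp sg F (s a) h N.
Let w x := if x \in I then ph (s x) else 0.

Let FN : F N = 0.
Proof. by rewrite /F node_last// /t scale_invK. Qed.
Let F0 : F 0%N = 0.
Proof. by rewrite /F /node mul0r addr0 /t scale_invK. Qed.

Let ph_left y : y <= s a -> ph y = 0.
Proof. exact: (interp_left sg0 F N h0). Qed.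

Let ph_right y : s b <= y -> ph y = 0.
Proof.
move=> yb; rewrite /ph (interp_right (al := s a) (h := h) sg1 F h0).
  by rewrite FN F0 subrr.
by rewrite -/(node N N) node_last.
Qed.

Let wE x : I x -> w x = ph (s x).
Proof. by move=> Ix; rewrite /w mem_set. Qed.

Let w_off x : ~ `[a, b]%classic x -> w x = 0.
Proof.
rewrite /= in_itv /= /w; case: ifPn => // /set_mem Ix nx.
have [xa|ax] := leP x a; first by rewrite ph_left// (scale_le hs).
have [xb|bx] := leP x b; first by exfalso; apply: nx; rewrite ltW.
by rewrite ph_right// (scale_le hs)// ltW.
Qed.

Let stepL k : (k < N)%N -> (F k.+1 - F k) ^+ 2 <= L ^+ 2 * (t (node N k.+1) - t (node N k)) ^+ 2.
Proof.
move=> kN; rewrite -exprMn -[leLHS]real_normK ?num_real// -[leRHS]real_normK ?num_real//.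
by rewrite lerXn2r ?nnegrE// normrM (ger0_norm L0); exact: gL.
Qed.

(** In the cell of [s x], bounded by [s u] and [s v], the difference is a convex combination of
    [g x - g u] and [g x - g v], hence at most [L (v - u)]. The square of [v - u] is a single term
    of the sum in [hC0]. *)
Let w_dist x : (g x - w x) ^+ 2 <= L ^+ 2 * (C0 * h).
Proof.
have c0 : 0 <= L ^+ 2 * (C0 * h) by rewrite mulr_ge0 ?sqr_ge0// mulr_ge0// ltW.
have [xab|nx] := boolP (x \in `[a, b]); last first.
  have nx' : ~ `[a, b]%classic x by move=> /=; exact/negP.
  by rewrite w_off//; case: hg => _ _ -> // _; rewrite subrr expr0n.
have Ix : I x by exact: (itv_subset oI Ia Ib xab).
move: xab; rewrite in_itv /= le_eqVlt => /andP[/predU1P[<-|ax] xb].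
  by rewrite ga wE// ph_left// subrr expr0n.
move: xb; rewrite le_eqVlt => /predU1P[->|xb].
  by rewrite gb wE// ph_right// subrr expr0n.
have sx : s a <= s x < s a + N%:R * h.
  by rewrite -/(node N N) node_last// (scale_le hs)// (scale_lt hs)// ltW.
have [k kN hk] := find_cell h0 sx.
have hk' : node N k <= s x <= node N k.+1 by [].
rewrite wE// /ph (interp_cell (al := s a) (h := h) sg0 sg1 F h0 kN hk).
rewrite F0 subr0; set q := sg _; have /andP[q0 q1] : 0 <= q <= 1 by exact: sg01.
pose u := t (node N k); pose v := t (node N k.+1).
have Jk := node_J N0 (ltnW kN); have Jk1 := node_J N0 kN.
have [Iu su] := scale_invP hs Jk; have [Iv sv] := scale_invP hs Jk1.
have /andP[ux xv] : u <= x <= v.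
  by rewrite -(scale_le hs Iu Ix) -(scale_le hs Ix Iv) su sv.
have d1 : `|g x - g u| <= L * (v - u).
  apply: (le_trans (gL _ _)); rewrite ler_wpM2l// ger0_norm ?subr_ge0//.
  by rewrite lerD2r.
have d2 : `|g x - g v| <= L * (v - u).
  apply: (le_trans (gL _ _)); rewrite ler_wpM2l// distrC ger0_norm ?subr_ge0//.
  by rewrite lerD2l lerN2.
have d3 : `|g x - (F k + (F k.+1 - F k) * q)| <= L * (v - u).
  have -> : g x - (F k + (F k.+1 - F k) * q) = (1 - q) * (g x - g u) + q * (g x - g v).
    by rewrite /F -/u -/v; ring.
  apply: (le_trans (ler_normD _ _)); rewrite !normrM (ger0_norm q0).
  rewrite ger0_norm ?subr_ge0//.
  have -> : L * (v - u) = (1 - q) * (L * (v - u)) + q * (L * (v - u)) by ring.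
  by rewrite lerD// ler_wpM2l// subr_ge0.
rewrite -real_normK ?num_real//; apply: (@le_trans _ _ ((L * (v - u)) ^+ 2)).
  by rewrite lerXn2r ?nnegrE// mulr_ge0// subr_ge0 (le_trans ux).
rewrite exprMn ler_wpM2l ?sqr_ge0//; apply: le_trans (hC0 N0).
rewrite (bigD1 (Ordinal kN))//= lerDl; apply: sumr_ge0 => j _; exact: sqr_ge0.
Qed.

Let ph_cont : continuous ph.
Proof.
move=> x; apply: differentiable_continuous; apply/derivable1_diffP.
exact: (@Ck_derivable _ 1 _ (interp_Ck sgC F (s a) h N 1) 0 x).
Qed.

Let dph_cont : continuous (derive1 ph).
Proof.
move=> x; apply: differentiable_continuous; apply/derivable1_diffP.
exact: (@Ck_derivable _ 2 _ (interp_Ck sgC F (s a) h N 2) 1 x).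
Qed.

Let w_bL1 : bL1 m w.
Proof.
apply: (@bL1_bounded_support R _ R m `[a, b]%classic w (\sum_(k < N) `|F k.+1 - F k|)).
- exact: (speed_sfm oI hm).
- exact: measurable_itv.
- exact: (speed_itv_fin oI hm).
- have mI : measurable I by apply: open_measurable; case: oI.
  rewrite (_ : w = (ph \o s) \_ I); last by apply/funext => x; rewrite patchE.
  apply/(measurable_restrictT _ mI); apply: open_continuous_measurable_fun; first by case: oI.
  move=> x /set_mem Ix; apply: continuous_comp; last exact: ph_cont.
  by have [_ cs _] := hs; exact: cs.
- have sum0 : 0 <= \sum_(k < N) `|F k.+1 - F k| by apply: sumr_ge0.
  move=> x; rewrite /w; case: ifP => _; last by rewrite normr0.
  apply: (le_trans (ler_norm_sum _ _ _)); apply: ler_sum => k _.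
  rewrite normrM ler_piMr// ger0_norm; first by have /andP[] := sg01 ((s x - s a) / h - k%:R).
  by have /andP[] := sg01 ((s x - s a) / h - k%:R).
- exact: w_off.
Qed.

(** The Dirichlet integral of the interpolation carries a factor [1 / h], which cancels against the
    [h] in the bound on squared increments: the energy is bounded independently of [N]. *)
Let w_phi_le (r : R) : 0 < r -> phi m (ktrans I p) r w <= 2^-1 * (B ^+ 2 * L ^+ 2 * C0) * r.
Proof.
have oJ := scale_image_open oI hs; have mJ := open_measurable oJ.
have eE := energy_core oI hs wE dph_cont.
set iE := (\int[_]_(y in _) _)%E in eE.
have iE0 : (0 <= iE)%E by apply: integral_ge0 => y _; rewrite lee_fin sqr_ge0.
have iEle : (iE <= (B ^+ 2 * L ^+ 2 * C0)%:E)%E.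
  apply: (le_trans (interp_energy sgC sgB F (s a) N h0 mJ)); rewrite lee_fin.
  have -> : \sum_(k < N) ((F k.+1 - F k) / h * B) ^+ 2 * h =
      \sum_(k < N) (B ^+ 2 / h) * (F k.+1 - F k) ^+ 2.
    by apply: eq_bigr => k _; rewrite !exprMn; field; rewrite gt_eqF.
  rewrite -mulr_sumr; apply: (@le_trans _ _ (B ^+ 2 / h * (L ^+ 2 * (C0 * h)))).
    apply: ler_wpM2l; first by rewrite divr_ge0 ?sqr_ge0// ltW.
    have le_sq : \sum_(k < N) (F k.+1 - F k) ^+ 2 <=
        \sum_(k < N) L ^+ 2 * (t (node N k.+1) - t (node N k)) ^+ 2.
      by apply: ler_sum => k _; exact: stepL.
    apply: (le_trans le_sq).
    by rewrite -mulr_sumr ler_wpM2l ?sqr_ge0// hC0.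
  by rewrite le_eqVlt; apply/orP; left; apply/eqP; field; rewrite gt_eqF.
have iEfin : iE \is a fin_num by rewrite ge0_fin_numE// (le_lt_trans iEle)// ltry.
move=> r0; apply: (@le_trans _ _ ((2^-1 * fine iE) * r)); last first.
  by rewrite ler_pM2r// ler_wpM2l// -lee_fin fineK.
apply: (core_phi_le oI hs hm hX w_bL1 _ wE _ dph_cont _ r0).
- move=> x nIx; apply: w_off => xab; apply: nIx.
  exact: (itv_subset oI Ia Ib).
- split.
    by move=> n x; exact: (@Ck_derivable _ n.+1 _ (interp_Ck sgC F (s a) h N n.+1) n x).
  have sub : closure [set x | ph x != 0] `<=` `[s a, s b]%classic.
    have := @itv_closed _ R (s a) (s b); rewrite closure_id => ->.
    apply: closure_subset => y /= py; rewrite in_itv /= !leNgt; apply/andP; split; apply/negP => hy;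
      move/negP: py; apply; apply/eqP; [exact/ph_left/ltW|exact/ph_right/ltW].
  split; last first.
    move=> y /sub /=; rewrite in_itv /= => yab.
    by have [] := @scale_between _ I s oI hs a b y Ia Ib yab.
  apply: (@subclosed_compact _ _ `[s a, s b]%classic) => //.
  - exact: closed_closure.
  - exact: segment_compact.
- by rewrite eE -(fineK iEfin).
Qed.

Lemma itvfun_phi_step (r : R) : 0 < r ->
  phi m (ktrans I p) r g <= B ^+ 2 * L ^+ 2 * C0 * r
    + 2 * (L ^+ 2 * (C0 * step N) * fine (m `[a, b]%classic)).
Proof.
move=> r0; have H := minimal_ssg oI hm hX.
have sm := speed_sfm oI hm.
have Bg := itvfun_bL1 sm (speed_itv_fin oI hm Ia Ib) hg.
apply: (le_trans (phi_quadratic H r0 Bg w_bL1)).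
have Bgw := bL1B sm Bg w_bL1.
apply: lerD.
  have := w_phi_le r0; set q := phi _ _ _ _ => hq.
  have -> : B ^+ 2 * L ^+ 2 * C0 * r = 2 * (2^-1 * (B ^+ 2 * L ^+ 2 * C0) * r) by field.
  by rewrite ler_pM2l.
rewrite ler_pM2l//; apply: (le_trans (phi_le_ip H r0 Bgw)).
apply: ip_le_measure => //.
- exact: (speed_itv_fin oI hm).
- by rewrite mulr_ge0 ?sqr_ge0// mulr_ge0// ltW// step_gt0.
- by move=> x nx; rewrite w_off//; case: hg => _ _ -> // _; rewrite subrr.
Qed.

End approximation.

(** The time [r] is fixed while the number of nodes grows. The main term does not involve [N] and
    the remainder is of order [1 / N]. *)
Lemma itvfun_phi_le M L : exists C, forall g, itvfun a b M L g ->
  forall r : R, 0 < r -> phi m (ktrans I p) r g <= C * r.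
Proof.
have [sg [sgC sg0 sg1 sg01 [B sgB]]] := @smooth_transition R.
exists (B ^+ 2 * L ^+ 2 * C0) => g hg r r0; apply/ler_addgt0Pr => e e0.
pose c := 2 * (L ^+ 2 * (C0 * (s b - s a)) * fine (m `[a, b]%classic)).
pose N := (Num.truncn (`|c| / e)).+1.
have N0 : 0 < N%:R :> R by [].
apply: (le_trans (itvfun_phi_step sgC sg0 sg1 sg01 sgB hg (ltn0Sn _ : (0 < N)%N) r0)).
rewrite lerD2l (_ : 2 * _ = c / N%:R); last by rewrite /c /step; ring.
rewrite ler_pdivrMr// mulrC -ler_pdivrMr//.
apply: (@le_trans _ _ (`|c| / e)); first by rewrite ler_pM2r ?invr_gt0// ler_norm.
by rewrite ltW// truncnS_gt// .
Qed.

End itvfun_phi.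

(** * From energy bounds to increments of the inverse scale *)

Section increments.
Context {R : realType}.

Lemma sqr_increment_le (ph : R -> R) (l r : R) : l < r ->
  (forall x, derivable ph x 1) -> continuous (derive1 ph) ->
  (((ph r - ph l) ^+ 2 / (r - l))%:E <=
   \int[lebesgue_measure]_(y in `[l, r]) ((derive1 ph y) ^+ 2)%:E)%E.
Proof.
move=> lr dph cdph; have rl0 : 0 < r - l by rewrite subr_gt0.
(* [2 c d - c^2 <= d^2], with [c] the average slope *)
pose c := (ph r - ph l) / (r - l).
pose G y := 2 * c * ph y - c ^+ 2 * y.
have dph' (x : R) : is_derive x 1 ph (derive1 ph x) by exact: derivable_is_derive1.
have dG (x : R) : is_derive x 1 G (2 * c * derive1 ph x - c ^+ 2).
  have := is_deriveB (is_deriveZ (2 * c) (dph' x)) (is_deriveZ (c ^+ 2) (is_derive_id x 1)).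
  by rewrite /GRing.scale /= mulr1.
have cG' : continuous (fun y => 2 * c * derive1 ph y - c ^+ 2).
  by move=> x; apply: cvgB; [apply: cvgM; [exact: cvg_cst|exact: cdph]|exact: cvg_cst].
have cG : continuous G.
  move=> x; apply: differentiable_continuous; apply/derivable1_diffP.
  by have [] := dG x.
have GE : (\int[lebesgue_measure]_(y in `[l, r]) (2 * c * derive1 ph y - c ^+ 2)%:E =
    ((ph r - ph l) ^+ 2 / (r - l))%:E)%E.
  rewrite (@continuous_FTC2 R _ G l r lr).
  - rewrite -EFinB; congr EFin; rewrite /G /c; field; rewrite gt_eqF//.
  - exact: continuous_subspaceT.
  - split.
    + by move=> x _; have [] := dG x.
    + exact/cvg_at_right_filter/cG.
    + exact/cvg_at_left_filter/cG.
  - by move=> x _; exact: (is_derive_derive1 (dG x)).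
rewrite -GE; apply: le_integral => //.
- apply: continuous_compact_integrable; first exact: segment_compact.
  exact: continuous_subspaceT.
- apply: (@continuous_compact_integrable R (fun y => derive1 ph y ^+ 2)); first exact: segment_compact.
  apply: continuous_subspaceT => x; rewrite /continuous_at.
  rewrite (_ : (fun y => _) = (fun y => derive1 ph y * derive1 ph y)).
    by apply: cvgM; exact: cdph.
  by apply/funext => y; rewrite expr2.
- move=> x _; rewrite lee_fin -subr_ge0.
  by rewrite (_ : _ - _ = (derive1 ph x - c) ^+ 2) ?sqr_ge0//; ring.
Qed.

Definition nonoverlapping n (l r : 'I_n -> R) : Prop :=
  forall k k', k != k' -> r k <= l k' \/ r k' <= l k.

(** The integrals are over open intervals because non-overlapping closed ones may share ends; the
    indicators then sum to at most 1. *)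
Lemma sum_integral_itv_le n (l r : 'I_n -> R) (D : set R) (f : R -> \bar R) :
  nonoverlapping l r -> measurable D -> (forall k, `]l k, r k[%classic `<=` D) ->
  measurable_fun setT f -> (forall x, 0 <= f x)%E ->
  (\sum_(k < n) \int[lebesgue_measure]_(y in `]l k, r k[) f y <=
   \int[lebesgue_measure]_(y in D) f y)%E.
Proof.
move=> no mD lrD mf f0.
pose g k y : \bar R := ((\1_(`]l k, r k[%classic) y)%:E * f y)%E.
have mg k : measurable_fun setT (g k).
  by apply: emeasurable_funM => //; exact/measurable_EFinP/measurable_indic.
have g0 k y : (0 <= g k y)%E by rewrite mule_ge0// lee_fin.
have gE k : (\int[lebesgue_measure]_(y in `]l k, r k[) f y =
    \int[lebesgue_measure]_y g k y)%E.
  rewrite integral_mkcond; apply: eq_integralT => y; rewrite patchE /g indicE.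
  by case: (y \in _); rewrite ?mul1e ?mul0e.
rewrite (eq_bigr _ (fun k _ => gE k)) -ge0_integral_sum//.
rewrite [leRHS]integral_mkcond; apply: ge0_le_integral => //.
- by move=> y _; apply: sume_ge0.
- exact: emeasurable_sum.
- by apply/(measurable_restrictT _ mD); exact: measurable_funTS.
move=> y _; rewrite patchE.
have [[k yk]|nk] := pselect (exists k, `]l k, r k[%classic y); last first.
  rewrite big1 => [|k _]; first by case: ifP.
  rewrite /g indicE memNset ?mul0e// => yk; apply: nk; exists k => //.
rewrite (bigD1 k)//= big1 ?adde0.
  by rewrite /g indicE !mem_set ?mul1e//; exact: lrD yk.
move=> j jk; rewrite /g indicE memNset ?mul0e// => yj.
move: yk yj; rewrite /= !in_itv /= => /andP[k1 k2] /andP[j1 j2].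
have [rl|rl] := no _ _ jk.
- by move: (lt_le_trans j2 rl) => /(lt_trans k1); rewrite ltxx.
- by move: (lt_le_trans k2 rl) => /(lt_trans j1); rewrite ltxx.
Qed.

End increments.

(** * Increments of the inverse scale from a core approximation *)

Section square_variation.
Context {R : realType} (I : set R) (s : R -> R) (m : {measure set R -> \bar R}).
Hypotheses (oI : open_interval I) (hs : scaling_function I s) (hm : speed_measure I m).
Let t := scale_inv I s.
Let opI : open I. Proof. by case: oI. Qed.
Let mI : measurable I. Proof. exact: open_measurable. Qed.

(** Chebyshev's inequality: if [w n] stayed at distance [th] from [u] on all of [W], the squared
    distance would be at least [th^2 m(W)], which is positive because the speed measure charges
    every nonempty open set. *)
Lemma L2_cvg_exists_close (w : nat -> R -> R) (u : R -> R) (W : set R) (th : R) :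
  (forall n, measurable_fun I (w n)) -> measurable_fun I u ->
  (\int[m]_(x in I) ((w n x - u x) ^+ 2)%R%:E)%E @[n --> \oo] --> 0%E ->
  open W -> W `<=` I -> W !=set0 -> 0 < th ->
  \forall n \near \oo, exists2 x, W x & `|w n x - u x| < th.
Proof.
move=> mw mu wu oW WI W0 th0; have [_ _ mpos] := hm.
have mW := open_measurable oW.
have : ((0 : \bar R) < (th ^+ 2)%:E * m W)%E.
  by rewrite mule_gt0 ?mpos// lte_fin exprn_gt0.
move=> c0.
have h : \forall n \near \oo,
    (\int[m]_(x in I) ((w n x - u x) ^+ 2)%:E < (th ^+ 2)%:E * m W)%E.
  exact: (wu _ (open_ereal_lt' c0)).
apply: filterS h => n hn.
apply: contrapT => nx.
have : ((th ^+ 2)%:E * m W <= \int[m]_(x in I) ((w n x - u x) ^+ 2)%:E)%E.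
  have md : measurable_fun I (fun x => ((w n x - u x) ^+ 2)%:E : \bar R).
    apply/measurable_EFinP; apply: measurable_funX; exact: measurable_funB.
  apply: (@le_trans _ _ (\int[m]_(x in W) ((w n x - u x) ^+ 2)%:E)%E).
    rewrite -integral_cst//; apply: ge0_le_integral => //.
    - by move=> x _; rewrite lee_fin sqr_ge0.
    - exact: measurable_funS md.
    - move=> x Wx; rewrite lee_fin -[leRHS]real_normK ?num_real// lerXn2r ?nnegrE//; first exact: ltW.
      by rewrite leNgt; apply/negP => hlt; apply: nx; exists x.
  by apply: ge0_subset_integral => // x _; rewrite lee_fin sqr_ge0.
by move=> /(lt_le_trans hn); rewrite ltxx.
Qed.

(** Core functions increase almost as much as [u] over slightly shrunk intervals, and Cauchy-Schwarz
    in the scale variable converts that increase into energy. Half of the increment survives the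
    shrinking and the approximation, hence a factor 4; the [1/2] in the energy makes it 8. *)
Lemma square_variation_le (u : R -> R) (e a b c : R) : minimal_form I s m u e ->
  I a -> I b -> (forall x, a <= x <= b -> u x = x - c) ->
  forall n (l r : 'I_n -> R),
  (forall k, s a <= l k /\ l k <= r k /\ r k <= s b) -> nonoverlapping l r ->
  \sum_(k < n) (t (r k) - t (l k)) ^+ 2 / (r k - l k) <= 8 * e.
Proof.
move=> [[mu _] [w [wcore wu _ we]]] Ia Ib uE n l r lr no.
have /choice[ph hph] : forall j, exists ph, Ccinfty1 (s @` I) ph /\
    forall x, I x -> w j x = ph (s x).
  by move=> j; have [ph phC wph] := wcore j; exists ph.
have dph j x : derivable (ph j) x 1 by have [[/(_ 0%N x)]] := hph j.
have cph j : continuous (ph j).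
  by move=> x; apply: differentiable_continuous; apply/derivable1_diffP; exact: dph.
have cdph j : continuous (derive1 (ph j)).
  move=> x; apply: differentiable_continuous; apply/derivable1_diffP.
  by have [[/(_ 1%N x)]] := hph j.
have mw j : measurable_fun I (w j).
  apply: (@eq_measurable_fun _ _ _ _ I (ph j \o s)).
    by move=> x /set_mem Ix /=; have [_ ->] := hph j.
  apply: open_continuous_measurable_fun => // x /set_mem Ix.
  by apply: continuous_comp; [have [_ + _] := hs; apply|exact: cph].
have itvJ k : `]l k, r k[%classic `<=` s @` I.
  move=> y /=; rewrite in_itv /= => /andP[ly yr]; have [al [_ rb]] := lr k.
  have [|//] := @scale_between _ I s oI hs a b y Ia Ib.
  by rewrite (le_trans al (ltW ly)) (le_trans (ltW yr) rb).
have close k : \forall j \near \oo,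
    (((t (r k) - t (l k)) ^+ 2 / (r k - l k) / 4)%:E <=
     \int[lebesgue_measure]_(y in `]l k, r k[) ((derive1 (ph j) y) ^+ 2)%:E)%E.
  have [al [lrk rb]] := lr k.
  have [Jl /andP[atl tlb]] := @scale_between _ I s oI hs a b _ Ia Ib
    (introT andP (conj al (le_trans lrk rb))).
  have [Jr /andP[atr trb]] := @scale_between _ I s oI hs a b _ Ia Ib
    (introT andP (conj (le_trans al lrk) rb)).
  move: lrk; rewrite le_eqVlt => /predU1P[<-|lrk].
    by apply: nearW => j; rewrite !subrr expr0n /= !mul0r; apply: integral_ge0 => y _;
      rewrite lee_fin sqr_ge0.
  set X0 := scale_inv I s (l k) in atl tlb *; set X1 := scale_inv I s (r k) in atr trb *.
  have X01 : X0 < X1 by rewrite (scale_inv_lt hs).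
  (* The points [x0] and [x1] lie within [q] of the ends, so [x1 - x0 > 6 q]; the two approximation
     errors take away at most [2 q], leaving [4 q], half the length. *)
  pose q := (X1 - X0) / 8; have q0 : 0 < q by rewrite divr_gt0 ?subr_gt0.
  have X1E : X1 = X0 + 8 * q by rewrite /q; field.
  have sub x : X0 < x < X1 -> I x /\ a <= x <= b.
    move=> /andP[x0 x1]; have axb : a <= x <= b.
      by rewrite (le_trans atl (ltW x0)) (le_trans (ltW x1) trb).
    by split => //; have [_ iI _] := oI; exact: (iI a b).
  have W0 : `]X0, X0 + q[%classic `<=` I.
    move=> x /=; rewrite in_itv /= => /andP[x0 x1].
    by have [] := sub x; [apply/andP; split; lra|].
  have W1 : `]X1 - q, X1[%classic `<=` I.
    move=> x /=; rewrite in_itv /= => /andP[x0 x1].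
    by have [] := sub x; [apply/andP; split; lra|].
  have := L2_cvg_exists_close mw mu wu (@itv_open _ _ _ _) W0 _ q0.
  have := L2_cvg_exists_close mw mu wu (@itv_open _ _ _ _) W1 _ q0.
  have ne1 : `]X1 - q, X1[%classic !=set0.
    by exists (X1 - q / 2); rewrite /= in_itv /=; apply/andP; split; lra.
  have ne0 : `]X0, X0 + q[%classic !=set0.
    by exists (X0 + q / 2); rewrite /= in_itv /=; apply/andP; split; lra.
  move=> /(_ ne1) + /(_ ne0); apply: filterS2 => j [x1 x1W cx1] [x0 x0W cx0].
  move: x1W x0W; rewrite /= !in_itv /= => /andP[x11 x12] /andP[x01 x02].
  have [Ix0 abx0] : I x0 /\ a <= x0 <= b by apply: sub; apply/andP; split; lra.
  have [Ix1 abx1] : I x1 /\ a <= x1 <= b by apply: sub; apply/andP; split; lra.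
  have x0x1 : x0 < x1 by lra.
  have ls0 : l k < s x0.
    by have [It <-] := scale_invP hs Jl; rewrite (scale_lt hs).
  have s1r : s x1 < r k.
    by have [It <-] := scale_invP hs Jr; rewrite (scale_lt hs).
  have s01 : s x0 < s x1 by rewrite (scale_lt hs).
  have [_ wph] := hph j.
  move: cx0 cx1; rewrite !uE// !wph// !ltr_norml => /andP[_ c0] /andP[c1 _].
  apply: (@le_trans _ _ (\int[lebesgue_measure]_(y in `[s x0, s x1])
      ((derive1 (ph j) y) ^+ 2)%:E)%E); last first.
    apply: ge0_subset_integral => //.
    - apply: measurable_funTS; apply/measurable_EFinP; apply: measurable_funX.
      exact: continuous_measurable_fun.
    - by move=> x _; rewrite lee_fin sqr_ge0.
    - move=> y /=; rewrite !in_itv /= => /andP[y0 y1].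
      by rewrite (lt_le_trans ls0 y0) (le_lt_trans y1 s1r).
  apply: le_trans (sqr_increment_le s01 (dph j) (cdph j)); rewrite lee_fin.
  have P0 : 4 * q <= ph j (s x1) - ph j (s x0) by lra.
  have P1 : (4 * q) ^+ 2 <= (ph j (s x1) - ph j (s x0)) ^+ 2.
    have q4 : 0 <= 4 * q by lra.
    by rewrite lerXn2r ?nnegrE// (le_trans q4).
  have -> : (X1 - X0) ^+ 2 / (r k - l k) / 4 = (4 * q) ^+ 2 / (r k - l k).
    by rewrite /q; field; rewrite subr_eq0 gt_eqF.
  apply: (@le_trans _ _ ((4 * q) ^+ 2 / (s x1 - s x0))).
    rewrite ler_wpM2l ?sqr_ge0// lef_pV2 ?posrE ?subr_gt0//.
    by rewrite lerB// ltW.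
  by rewrite ler_wpM2r// invr_ge0 subr_ge0 ltW.
have oJ := scale_image_open oI hs; have mJ := open_measurable oJ.
have : (((\sum_(k < n) (t (r k) - t (l k)) ^+ 2 / (r k - l k)) / 8)%:E <= e%:E)%E.
  rewrite -(cvg_lim _ we)//; apply: lime_ge; first by apply/cvg_ex; exists e%:E.
  (* There are finitely many intervals, so a single late term of the sequence serves them all. *)
  have close' : \forall j \near \oo, forall k : 'I_n,
      (((t (r k) - t (l k)) ^+ 2 / (r k - l k) / 4)%:E <=
       \int[lebesgue_measure]_(y in `]l k, r k[) ((derive1 (ph j) y) ^+ 2)%:E)%E.
    exact: filter_forall.
  apply: filterS close' => j hj.
  rewrite (energy_core oI hs (hph j).2 (cdph j)).
  have -> : (\sum_(k < n) (t (r k) - t (l k)) ^+ 2 / (r k - l k)) / 8 =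
      2^-1 * \sum_(k < n) (t (r k) - t (l k)) ^+ 2 / (r k - l k) / 4.
    by rewrite -mulr_suml; field.
  rewrite EFinM lee_pmul2l// -sumEFin.
  apply: (le_trans (lee_sum _ (fun k _ => hj k))).
  apply: sum_integral_itv_le => //.
  - apply/measurable_EFinP; apply: measurable_funX; exact: continuous_measurable_fun.
  - by move=> x; rewrite lee_fin sqr_ge0.
by rewrite lee_fin ler_pdivrMr// mulrC.
Qed.

End square_variation.

(** * Difference quotients and measurability of the derivative *)

Section derive1_facts.
Context {R : realType}.
Implicit Types (f : R -> R) (J : set R).

Lemma derivable_approx f y (eps : R) : derivable f y 1 -> 0 < eps ->
  exists2 del, 0 < del & forall h, `|h| < del ->
    `|f (y + h) - f y - derive1 f y * h| <= eps * `|h|.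
Proof.
move=> df e0.
have c : h^-1 *: (f (h + y) - f y) @[h --> (0 : R)^'] --> derive1 f y.
  by rewrite derive1E; have := df; rewrite /derivable /derive;
     under eq_fun do rewrite /GRing.scale /= mulr1; exact.
have /cvgrPdist_lt/(_ _ e0) [/= del del0 hd] := c.
exists del => // h hdel; have [->|h0] := eqVneq h 0.
  by rewrite addr0 subrr mulr0 subrr normr0 mulr0.
have hb : ball_ Num.Def.normr 0 del h by rewrite /= sub0r normrN.
have := hd h hb h0; rewrite /GRing.scale /= => hq.
have -> : f (y + h) - f y - derive1 f y * h = - h * (derive1 f y - h^-1 * (f (h + y) - f y)).
  by rewrite [h + y]addrC; field.
by rewrite normrM normrN mulrC ler_wpM2r// ltW.
Qed.

(** Here [y] lies in the interval without being one of its ends, as a point of a grid cell does. The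
    errors on the two sides of [y] add up to [eps (r - l)]. *)
Lemma derivable_quotient f y : derivable f y 1 -> forall eps : R, 0 < eps ->
  exists2 del, 0 < del & forall l r, l <= y <= r -> l < r -> r - l < del ->
    `|(f r - f l) / (r - l) - derive1 f y| <= eps.
Proof.
move=> df eps e0; have [del del0 hd] := derivable_approx df e0.
exists del => // l r /andP[ly yr] lr rl; have rl0 : 0 < r - l by rewrite subr_gt0.
have hr : `|f r - f y - derive1 f y * (r - y)| <= eps * (r - y).
  have := hd (r - y); rewrite subrKC ger0_norm ?subr_ge0//; apply.
  by apply: le_lt_trans rl; rewrite lerD2l lerN2.
have hl : `|f l - f y - derive1 f y * (l - y)| <= eps * (y - l).
  have := hd (l - y); rewrite subrKC distrC ger0_norm ?subr_ge0//; apply.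
  by apply: le_lt_trans rl; rewrite lerD2r.
have -> : (f r - f l) / (r - l) - derive1 f y =
    ((f r - f y - derive1 f y * (r - y)) - (f l - f y - derive1 f y * (l - y))) / (r - l).
  by field; rewrite gt_eqF.
rewrite normrM normfV (gtr0_norm rl0) ler_pdivrMr//.
apply: (le_trans (ler_normB _ _)); apply: (le_trans (lerD hr hl)).
by rewrite le_eqVlt; apply/orP; left; apply/eqP; ring.
Qed.

Lemma near_eq_derive1 f g (y : R) : {near y, f =1 g} -> derive1 f y = derive1 g y.
Proof. by move=> fg; rewrite !derive1E; exact: near_eq_derive. Qed.

(** [derive1] is a limit, which takes the default value [point] when it does not exist. Thus it is
    constant on the set of points of non-derivability. *)
Lemma derive1_point f y : ~ derivable f y 1 -> derive1 f y = point.
Proof.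
move=> nd; rewrite /derive1; apply: dvgP => cv; apply: nd; rewrite /derivable.
by under eq_fun do rewrite /GRing.scale /= mulr1; exact: cv.
Qed.

(** Derivability is a Cauchy condition on difference quotients. Restricted to rational increments it
    defines a measurable set [A]; on [A] the derivative is a limit of the quotients [G n], and on
    the rest of [J] it is constant. *)
Lemma measurable_derive1 J f : open J -> {in J, continuous f} ->
  measurable_fun J (derive1 f).
Proof.
move=> oJ cf; have mJ := open_measurable oJ.
pose tau := f \_ J.
have mtau : measurable_fun setT tau.
  by apply/(measurable_restrictT _ mJ); exact: open_continuous_measurable_fun.
have nJ y : J y -> \forall z \near y, J z.
  by move=> Jy; apply: open_nbhs_nbhs; split.
have tauE y : J y -> tau y = f y by move=> Jy; rewrite /tau patchE mem_set.
have ntau y : J y -> {near y, tau =1 f}.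
  by move=> /nJ; apply: filterS => z; exact: tauE.
have ctau y : J y -> {for y, continuous tau}.
  move=> Jy; suff : tau x @[x --> y] --> f y by rewrite -(tauE y Jy).
  apply: cvg_trans (cf y (mem_set Jy)).
  by apply: near_eq_cvg; have := ntau y Jy; apply: filterS => z ->.
pose Q (h y : R) := (tau (y + h) - tau y) / h.
have mQ h : measurable_fun setT (Q h).
  apply: measurable_funM => //; apply: measurable_funB => //.
  by apply: (measurableT_comp mtau); exact: measurable_funD.
pose small (j : nat) (q : rat) := (q != 0) && (`|ratr q : R| < j.+1%:R^-1).
pose S k j := \bigcap_n [set y | forall p q, unpickle n = Some (p, q) ->
  small j p -> small j q -> `|Q (ratr p) y - Q (ratr q) y| <= k.+1%:R^-1].
have SP k j y : S k j y <-> forall p q, small j p -> small j q ->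
    `|Q (ratr p) y - Q (ratr q) y| <= k.+1%:R^-1.
  split=> [h p q|h n _ p q _]; last exact: h.
  by apply: (h (pickle (p, q)) Logic.I); rewrite pickleK.
pose A := J `&` \bigcap_k \bigcup_j S k j.
have mS k j : measurable (S k j).
  apply: bigcapT_measurable => n; case E : (unpickle n) => [[p q]|]; last first.
    by rewrite (_ : mkset _ = setT)//; apply/seteqP; split => // y _ ? ?.
  have [/andP[sp sq]|spq] := boolP (small j p && small j q); last first.
    rewrite (_ : mkset _ = setT)//; apply/seteqP; split => // y _ p' q' [<- <-] sp sq.
    by move: spq; rewrite sp sq.
  rewrite (_ : mkset _ = setT `&`
      (fun y => `|Q (ratr p) y - Q (ratr q) y|) @^-1` `]-oo, k.+1%:R^-1]); last first.
    rewrite setTI; apply/seteqP; split => y /=; rewrite in_itv /=.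
      by move=> /(_ p q erefl sp sq).
    by move=> h p' q' [<- <-].
  apply: measurableT_comp => //.
  exact: measurable_funB.
have mA : measurable A.
  apply: measurableI => //; apply: bigcapT_measurable => k.
  by apply: bigcupT_measurable => j.
have Q1 n : n.+1%:R^-1 != 0 :> R by rewrite invr_eq0 pnatr_eq0.
have small_inv j n : (j < n)%N -> small j n.+1%:R^-1.
  move=> jn; have rE : ratr (n.+1%:R^-1) = n.+1%:R^-1 :> R by rewrite fmorphV /= ratr_nat.
  rewrite /small rE invr_eq0 pnatr_eq0 andTb.
  by rewrite ger0_norm// ltf_pV2 ?posrE// ltr_nat ltnS.
(* rational increments suffice, by continuity *)
have AP y : J y -> derivable f y 1 <-> A y.
  move=> Jy; split => [df|[_ Ay]].
    split => // k _; have [del del0 hd] := derivable_approx df (divr_gt0 ltr01 (ltr0Sn R (2 * k.+1))).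
    have [del' /= del'0 hd'] := nJ y Jy.
    pose j := Num.truncn (Num.max (del^-1) (del'^-1)).
    exists j => //; apply/SP => p q.
    have key r : small j r -> `|Q (ratr r) y - derive1 f y| <= (2 * k.+1)%:R^-1.
      move=> /andP[r0]; set h : R := ratr r => hr.
      have h0 : h != 0 by rewrite fmorph_eq0.
      have hdel : `|h| < Num.min del del'.
        apply: (lt_le_trans hr); rewrite le_min -[del in X in X && _]invrK -[del' in X in _ && X]invrK.
        rewrite !lef_pV2 ?posrE ?invr_gt0//; apply/andP; split.
          by apply: (@le_trans _ _ (Num.max (del^-1) (del'^-1)));
             [rewrite le_max lexx|exact/ltW/truncnS_gt].
        by apply: (@le_trans _ _ (Num.max (del^-1) (del'^-1)));
             [rewrite le_max lexx orbT|exact/ltW/truncnS_gt].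
      move: hdel; rewrite lt_min => /andP[h1 h2].
      have Jyh : J (y + h) by apply: hd'; rewrite /= opprD addNKr normrN.
      rewrite /Q !tauE//.
      have -> : (f (y + h) - f y) / h - derive1 f y = (f (y + h) - f y - derive1 f y * h) / h.
        by field.
      rewrite normrM normfV ler_pdivrMr ?normr_gt0//; apply: (le_trans (hd h h1)).
      rewrite ler_wpM2r// div1r lef_pV2 ?posrE// ler_nat//.
    move=> /key kp /key kq.
    have := lerD kp kq; rewrite [X in _ + X]distrC => h.
    apply: (le_trans (ler_distD (derive1 f y) _ _)); apply: (le_trans h).
    have -> : (2 * k.+1)%:R^-1 = k.+1%:R^-1 / 2 :> R by rewrite natrM invfM mulrC.
    by rewrite -splitr.
  have cQ h : h != 0 -> J (y + h) -> {for h, continuous (Q ^~ y)}.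
    move=> h0 Jh; apply: cvgM; last exact: cvgV.
    apply: cvgB; last exact: cvg_cst.
    apply: (@continuous_comp _ _ _ (fun h => y + h) tau); last exact: ctau.
    by apply: cvgD; [exact: cvg_cst|exact: cvg_id].
  have dQ (k : nat) : exists c, \forall h \near (0 : R)^', `|c - Q h y| <= k.+1%:R^-1.
    (* The reference increment is [1 / (j+2)] because [small j] asks for strictly less than
       [1 / (j+1)]. *)
    have [j _ /SP Sj] := Ay k Logic.I; exists (Q (ratr j.+2%:R^-1) y).
    have [del' /= del'0 hd'] := nJ y Jy.
    have j0 : 0 < j.+1%:R^-1 :> R by rewrite invr_gt0.
    near=> h; have h0 : h != 0 by near: h; exact: nbhs_dnbhs_neq.
    have Jh : J (y + h).
      by apply: hd'; rewrite /= opprD addNKr normrN; near: h; exact: dnbhs0_lt.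
    have hj : `|h| < j.+1%:R^-1 by near: h; exact: dnbhs0_lt.
    rewrite leNgt; apply/negP => hlt.
    (* A violation at the real increment [h] persists nearby by continuity of the quotient, hence
       occurs at a rational one. *)
    have near_h : \forall h' \near h, [/\ h' != 0, `|h'| < j.+1%:R^-1 &
        k.+1%:R^-1 < `|Q (ratr j.+2%:R^-1) y - Q h' y|].
      have n1 : \forall h' \near h, h' != 0 by exact: (@cvgr_neq0 _ _ _ (nbhs h) _ id h).
      have n2 : \forall h' \near h, `|h'| < j.+1%:R^-1.
        have c : (fun x : R => `|x|) @ h --> `|h| by exact: norm_continuous.
        exact: (cvgr_lt _ c _ hj).
      have n3 : \forall h' \near h, k.+1%:R^-1 < `|Q (ratr j.+2%:R^-1) y - Q h' y|.
        have c : (fun x : R => `|Q (ratr j.+2%:R^-1) y - Q x y|) @ h -->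
            `|Q (ratr j.+2%:R^-1) y - Q h y|.
          by apply: cvg_norm; apply: cvgB; [exact: cvg_cst|exact: cQ].
        exact: (cvgr_gt _ c _ hlt).
      by apply: filterS3 n1 n2 n3.
    have [e /= e0 he] := near_h.
    have : h - e < h + e by rewrite ltrD2l (lt_trans _ e0)// oppr_lt0.
    move=> /rat_in_itvoo[r]; rewrite in_itv /= => /andP[r1 r2].
    have [r0 rj] : [/\ ratr r != 0 :> R, `|ratr r : R| < j.+1%:R^-1 &
        k.+1%:R^-1 < `|Q (ratr j.+2%:R^-1) y - Q (ratr r) y|].
      by apply: he; rewrite /= ltr_distl; apply/andP; split; lra.
    have sr : small j r by rewrite /small rj andbT -(fmorph_eq0 (@ratr R)).
    by rewrite ltNge Sj//; exact: small_inv.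
  apply: R_complete; apply: cauchy_exP => e e0.
  pose k := Num.truncn e^-1.
  have ke : k.+1%:R^-1 < e :> R.
    by rewrite -[ltRHS]invrK ltf_pV2 ?posrE ?invr_gt0//; exact: truncnS_gt.
  have [c hc] := dQ k; exists c.
  suff H : \forall h \near (0 : R)^', ball c e (h^-1 * (f (h + y) - f y)).
    move: H; rewrite /nbhs /=; apply: filterS => h /=.
    by rewrite /GRing.scale /= mulr1.
  have [del' /= del'0 hd'] := nJ y Jy.
  near=> h; apply: (le_lt_trans _ ke) => /=.
  have Jh : J (y + h).
    by apply: hd'; rewrite /= opprD addNKr normrN; near: h; exact: dnbhs0_lt.
  rewrite mulrC [h + y]addrC -!tauE// -/(Q h y).
  by near: h.
pose G n := Q n.+1%:R^-1.
rewrite (_ : J = A `|` (J `\` A)); last first.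
  apply/seteqP; split => [y Jy|y [[]//|[]//]].
  by have [?|?] := pselect (A y); [left|right].
apply/measurable_funU => //; first exact: measurableD.
split.
  apply: (@measurable_fun_cvg _ _ _ A G) => [n|y Ay]; first exact: (measurable_funTS (mQ _)).
  have [Jy _] := Ay; have /AP df := Ay; have {}df := df Jy.
  apply/cvgrPdist_le => e e0; have [del del0 hd] := derivable_approx df e0.
  have [del' /= del'0 hd'] := nJ y Jy.
  near=> n; have n0 : 0 < n.+1%:R^-1 :> R by rewrite invr_gt0.
  have hdel : n.+1%:R^-1 < Num.min del del'.
    near: n; have d0 : 0 < Num.min del del' by rewrite lt_min del0.
    exact: (near_infty_natSinv_lt (PosNum d0)).
  move: hdel; rewrite lt_min => /andP[h1 h2].
  have Jyh : J (y + n.+1%:R^-1) by apply: hd'; rewrite /= opprD addNKr normrN gtr0_norm.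
  rewrite /G /Q !tauE// distrC.
  set h := n.+1%:R^-1.
  have -> : (f (y + h) - f y) / h - derive1 f y = (f (y + h) - f y - derive1 f y * h) / h.
    by field; rewrite /h invr_eq0 pnatr_eq0.
  rewrite normrM normfV ler_pdivrMr ?normr_gt0 ?gt_eqF//.
  by apply: hd; rewrite gtr0_norm.
apply: (@eq_measurable_fun _ _ _ _ _ (fun=> point)) => // y /set_mem [Jy nAy].
by apply/esym/derive1_point => /(AP _ Jy).
Unshelve. all: by end_near. Qed.

End derive1_facts.

(** * Absolute continuity and square-integrable derivative from square variation *)

Section bounded_variation.
Context {R : realType} (t : R -> R) (al be : R).
Hypothesis albe : al < be.

(** The condition of F. Riesz for absolute continuity with square-integrable derivative. A
    degenerate interval contributes 0, since its quotient is [0 / 0 = 0]. *)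
Definition square_variation_bounded (C : R) : Prop :=
  forall n (l r : 'I_n -> R),
    (forall k, al <= l k /\ l k <= r k /\ r k <= be) -> nonoverlapping l r ->
    \sum_(k < n) (t (r k) - t (l k)) ^+ 2 / (r k - l k) <= C.

Variable C : R.
Hypothesis hC : square_variation_bounded C.

Let C_ge0 : 0 <= C.
Proof.
have := @hC 0 (fun=> al) (fun=> al); rewrite big_ord0; apply; first by case.
by case.
Qed.

Lemma square_variation_abs (eps : R) : 0 < eps -> exists2 delta : R, 0 < delta &
  forall (n : nat) (l r : 'I_n -> R),
    (forall k, al <= l k /\ l k <= r k /\ r k <= be) -> nonoverlapping l r ->
    \sum_(k < n) (r k - l k) < delta ->
    \sum_(k < n) `|t (r k) - t (l k)| < eps.
Proof.
move=> e0; have C1 : 0 < C + 1 by rewrite ltr_wpDl.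
(* With this [eta], the first sum is at most [eta C <= eps / 2], and for total length below
   [eta (eps / 2)] the second is below [eps / 2]. The [+ 1] covers [C = 0]. *)
pose eta := eps / (2 * (C + 1)); have eta0 : 0 < eta by rewrite divr_gt0// mulr_gt0.
exists (eta * (eps / 2)) => [|n l r lr no sd]; first by rewrite mulr_gt0// divr_gt0.
(* AM-GM: [|d| <= eta d^2 / x + x / eta] *)
apply: (@le_lt_trans _ _ (\sum_(k < n) (eta * ((t (r k) - t (l k)) ^+ 2 / (r k - l k)) +
    eta^-1 * (r k - l k)))).
  apply: ler_sum => k _; have [_ [lrk _]] := lr k; set d := t (r k) - t (l k).
  move: lrk; rewrite le_eqVlt => /predU1P[E|lrk].
    by rewrite /d E !subrr normr0 expr0n /= mul0r !mulr0 addr0.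
  have x0 : 0 < r k - l k by rewrite subr_gt0.
  rewrite -(real_normK (num_real d)); set D := `|d|; set x := r k - l k in x0 *.
  have D0 : 0 <= D by exact: normr_ge0.
  rewrite -subr_ge0.
  have -> : eta * (D ^+ 2 / x) + eta^-1 * x - D =
      ((eta * D - x) ^+ 2 + eta * D * x) / (eta * x) by field; rewrite !gt_eqF.
  have ex0 : 0 <= eta * x by rewrite mulr_ge0// ltW.
  by rewrite divr_ge0// addr_ge0 ?sqr_ge0// mulr_ge0 ?(ltW x0)// mulr_ge0// ltW.
rewrite big_split /= -!mulr_sumr [eps]splitr; apply: ler_ltD.
  apply: (@le_trans _ _ (eta * C)); first by rewrite ler_pM2l// hC.
  rewrite /eta mulrAC ler_pdivrMr ?mulr_gt0//.
  have -> : eps / 2 * (2 * (C + 1)) = eps * (C + 1) by field.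
  by rewrite ler_pM2l// lerDl.
by rewrite -ltr_pdivlMl ?invr_gt0// invrK.
Qed.

Let h n := (be - al) / n.+1%:R.
Let Y n k := al + k%:R * h n.
Let h0 n : 0 < h n. Proof. by rewrite divr_gt0// subr_gt0. Qed.
Let Yn n : Y n n.+1 = be.
Proof. by rewrite /Y /h mulrC divfK ?subrKC// pnatr_eq0. Qed.
Let q n k := (t (Y n k.+1) - t (Y n k)) / (Y n k.+1 - Y n k).
Let YS n k : Y n k.+1 - Y n k = h n.
Proof. by rewrite /Y -natr1; ring. Qed.
(** The step function of squared slopes on the grid of [n+1] equal cells. Cells are closed on the
    left only, so that each point of the interval below [be] lies in exactly one. *)
Let S n (y : R) : \bar R := \sum_(k < n.+1) ((q n k) ^+ 2)%:E *
  (\1_(`[Y n k, Y n k.+1[%classic) y)%:E.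
Let mS n : measurable_fun setT (S n).
Proof.
apply: emeasurable_sum => k; apply: measurable_funeM.
exact/measurable_EFinP/measurable_indic.
Qed.
Let S0 n y : (0 <= S n y)%E.
Proof. by apply: sume_ge0 => k _; rewrite mule_ge0// lee_fin sqr_ge0. Qed.
Let Yle n j k : (j <= k)%N -> Y n j <= Y n k.
Proof. by move=> jk; rewrite lerD2l ler_pM2r ?h0// ler_nat. Qed.

Let S_cell n k y : (k < n.+1)%N -> Y n k <= y < Y n k.+1 -> S n y = ((q n k) ^+ 2)%:E.
Proof.
move=> kn /andP[y1 y2]; rewrite /S (bigD1 (Ordinal kn))//= big1 ?adde0.
  by rewrite indicE mem_set ?mule1//= in_itv /= y1.
move=> j jk; rewrite indicE memNset ?mule0//= in_itv /= => /andP[j1 j2].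
move/negP: jk; apply; apply/eqP/val_inj => /=.
have [jk|kj|//] := ltngtP (nat_of_ord j) k.
- by have := lt_le_trans j2 (Yle n jk) => /(le_lt_trans y1); rewrite ltxx.
- by have := lt_le_trans y2 (Yle n kj) => /(le_lt_trans j1); rewrite ltxx.
Qed.

Let int_S n (D : set R) : measurable D -> (\int[lebesgue_measure]_(y in D) S n y <= C%:E)%E.
Proof.
move=> mD; apply: (@le_trans _ _ (\int[lebesgue_measure]_y S n y)%E).
  apply: ge0_subset_integral.
  - exact: mD.
  - exact: measurableT.
  - exact: mS.
  - by move=> y _; exact: S0.
  - exact: subsetT.
rewrite ge0_integral_sum//; first last.
- by move=> k x _; rewrite mule_ge0// lee_fin sqr_ge0.
- by move=> k; apply: measurable_funeM; exact/measurable_EFinP/measurable_indic.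
apply: (@le_trans _ _ (\sum_(k < n.+1) ((t (Y n k.+1) - t (Y n k)) ^+ 2 / (Y n k.+1 - Y n k))%:E)%E).
  apply: lee_sum => k _; rewrite ge0_integralZl//; last first.
  - by rewrite lee_fin sqr_ge0.
  - exact/measurable_EFinP/measurable_indic.
  rewrite integral_indic// setIT.
  have Yk : @lebesgue_measure R `[Y n k, Y n k.+1[%classic = (h n)%:E.
    by rewrite lebesgue_measure_itv /= lte_fin -subr_gt0 YS h0 -EFinB YS.
  rewrite [X in (_ * X)%E](_ : _ = (h n)%:E)// -EFinM lee_fin /q YS.
  by rewrite le_eqVlt; apply/orP; left; apply/eqP; field; rewrite gt_eqF.
rewrite sumEFin lee_fin; apply: hC.
  move=> k; split; first by rewrite lerDl mulr_ge0// ltW.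
  split; first exact: Yle.
  by rewrite -(Yn n) Yle.
move=> k k' kk'; have [lt_kk'|lt_k'k|/val_inj E] := ltngtP (nat_of_ord k) k'.
- by left; exact: Yle.
- by right; exact: Yle.
- by rewrite E eqxx in kk'.
Qed.

Let S_cvg y : al < y < be -> derivable t y 1 ->
  S ^~ y @ \oo --> ((derive1 t y) ^+ 2)%:E.
Proof.
move=> /andP[aly ybe] dt.
have /choice[k hk] n : exists k, (k < n.+1)%N /\ Y n k <= y < Y n k.+1.
  pose k := Num.truncn ((y - al) / h n).
  have z0 : 0 <= (y - al) / h n by rewrite divr_ge0 ?subr_ge0// ltW.
  have /andP[k1 k2] := truncn_itv z0.
  have Yk : Y n k <= y by rewrite /Y addrC -lerBrDr -ler_pdivlMr.
  exists k; split.
    rewrite -(ltr_nat R) -(ltr_pM2r (h0 n)) -(ltrD2l al).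
    by apply: (le_lt_trans Yk); rewrite -/(Y n n.+1) Yn.
  by rewrite Yk /Y addrC -ltrBlDr -ltr_pdivrMr.
rewrite (_ : S ^~ y = fun n => ((q n (k n)) ^+ 2)%:E); last first.
  by apply/funext => n; have [kn yk] := hk n; exact: S_cell.
apply: cvg_EFin; first exact: nearW.
rewrite /comp /=.
have qc : (fun n => q n (k n)) @ \oo --> derive1 t y.
  apply/cvgrPdist_le => e e0; have [del del0 hd] := derivable_quotient dt e0.
  near=> n; rewrite distrC; apply: hd.
  - by have [_ /andP[-> /ltW ->]] := hk n.
  - by rewrite -subr_gt0 YS.
  - rewrite YS /h ltr_pdivrMr// mulrC -ltr_pdivrMr//.
    apply: (@lt_trans _ _ n%:R); last by rewrite ltr_nat.
    near: n; exact: nbhs_infty_gtr.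
rewrite expr2; under eq_fun do rewrite expr2; exact: cvgM.
Unshelve. all: by end_near. Qed.

(** Wherever [t] is derivable, the squared derivative is the limit of [S n]; elsewhere it is the
    constant [c], the square of the default value. Hence it is everywhere at most [liminf S n + c],
    and Fatou's lemma together with the finite length of the interval gives the bound. *)
Lemma square_variation_derive1 (J : set R) : open J -> {in J, continuous t} ->
  `[al, be]%classic `<=` J ->
  (\int[lebesgue_measure]_(y in `]al, be[) ((derive1 t y) ^+ 2)%:E < +oo)%E.
Proof.
move=> oJ ct sJ; set D := `]al, be[%classic.
have mD : measurable D by exact: measurable_itv.
have DJ : D `<=` J by move=> y Dy; apply: sJ; exact: subset_itv_oo_cc.
pose c : R := (point : R) ^+ 2.
have c0 : 0 <= c by exact: sqr_ge0.
have mL : measurable_fun D (fun y => limn_einf (S ^~ y)).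
  rewrite /limn_einf; apply: measurableT_comp => //.
  apply: (@measurable_fun_limn_esup _ _ _ D (fun n y => - S n y)%E) => n.
  by apply: measurableT_comp => //; exact: measurable_funTS.
have L0 y : (0 <= limn_einf (S ^~ y))%E.
  rewrite limn_einf_lim; apply: lime_ge; first exact: is_cvg_einfs.
  by apply: nearW => n; apply: le_ereal_inf_tmp => _ [k _ <-].

apply: (@le_lt_trans _ _ (\int[lebesgue_measure]_(y in D) (limn_einf (S ^~ y) + c%:E))%E).
  apply: ge0_le_integral => //.
  - by move=> y _; rewrite lee_fin sqr_ge0.
  - apply/measurable_EFinP; apply: measurable_funX; apply: measurable_funS DJ _ => //.
      exact: open_measurable.
    exact: measurable_derive1.
  - exact: emeasurable_funD.
  - move=> y Dy; have [dt|dt] := pselect (derivable t y 1).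
      have [-> _] := cvg_limn_einf_sup (S_cvg Dy dt).
      by rewrite leeDl.
    by rewrite (derive1_point dt) leeDr.
rewrite ge0_integralD//.
have lD : @lebesgue_measure R D = (be - al)%:E.
  by rewrite lebesgue_measure_itv /= lte_fin albe EFinB.
apply: lte_add_pinfty; last first.
  by rewrite integral_cst// [X in (_ * X)%E](_ : _ = (be - al)%:E)// -EFinM ltry.
apply: (@le_lt_trans _ _ C%:E); last exact: ltry.
have mSD n : measurable_fun D (S n) by exact: measurable_funTS.
apply: (le_trans (fatou (@lebesgue_measure R) mD mSD (fun n y _ => S0 n y))).
rewrite limn_einf_lim; apply: lime_le; first exact: is_cvg_einfs.
apply: nearW => n; apply: le_trans (int_S n mD).
by apply: ereal_inf_lbound; exists n => /=.
Qed.

End bounded_variation.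

(** * Increments of absolutely continuous functions *)

Section ac_increments.
Context {R : realType} (nu : {measure set (measurableTypeR R) -> \bar R}) (t : R -> R) (al be : R).
Hypothesis albe : al < be.
Hypothesis nu_itv : forall y z, al <= y -> y <= z -> z <= be ->
  nu `]y, z]%classic = (t z - t y)%:E.
Hypothesis nu_out : nu (~` `]al, be]) = 0%E.
Hypothesis t_ac : forall eps : R, 0 < eps -> exists2 delta : R, 0 < delta &
  forall (n : nat) (l r : 'I_n -> R),
    (forall k, al <= l k /\ l k <= r k /\ r k <= be) -> nonoverlapping l r ->
    \sum_(k < n) (r k - l k) < delta ->
    \sum_(k < n) `|t (r k) - t (l k)| < eps.

Let core (U : set R) (n : nat) := `]al, be] `&` [set x | ball x n.+1%:R^-1 `<=` U].

Let core_measurable U n : measurable (core U n).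
Proof.
apply: measurableI => //; apply: closed_measurable.
rewrite -[mkset _]setCK; apply: open_closedC; rewrite openE => x /=.
move=> /existsNP[y /not_implyP[xy Uy]].
exists (n.+1%:R^-1 - `|x - y|) => /=; first by rewrite subr_gt0.
move=> z /= xz zU; apply: Uy; apply: zU.
rewrite /ball /= in xy *; apply: le_lt_trans (ler_distD x _ _) _.
by rewrite [ `|z - x|]distrC -ltrBrDr.
Qed.

(* the points of [U] at distance at least [1/(n+1)] of its complement are
   covered by the cells of a finer grid that are contained in [U] *)
Let core_le U n (delta eps : R) : open U -> (lebesgue_measure U < delta%:E)%E ->
  (forall (n : nat) (l r : 'I_n -> R),
    (forall k, al <= l k /\ l k <= r k /\ r k <= be) -> nonoverlapping l r ->
    \sum_(k < n) (r k - l k) < delta ->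
    \sum_(k < n) `|t (r k) - t (l k)| < eps) ->
  (nu (core U n) <= eps%:E)%E.
Proof.
move=> oU Ud hd; pose N := (Num.truncn ((be - al) * n.+1%:R)).+1.
pose h := (be - al) / N%:R; have h0 : 0 < h by rewrite divr_gt0 ?subr_gt0.
have hn : h < n.+1%:R^-1.
  rewrite /h ltr_pdivrMr// mulrC ltr_pdivlMr//; exact: truncnS_gt.
pose Y (k : nat) := al + k%:R * h.
have Yle j k : (j <= k)%N -> Y j <= Y k by move=> jk; rewrite lerD2l ler_pM2r// ler_nat.
have YN : Y N = be by rewrite /Y /h mulrC divfK ?subrKC// pnatr_eq0.
have YS k : Y k.+1 = Y k + h by rewrite /Y -natr1; ring.
(* A cell that misses the core is collapsed to its left end, which keeps one index range for all
   cells. *)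
pose r (k : nat) := if `[< `]Y k, Y k.+1] `&` core U n !=set0 >] then Y k.+1 else Y k.
have rY k : Y k <= r k <= Y k.+1.
  by rewrite /r; case: ifP => _; rewrite lexx ?andbT Yle.
pose l' (k : 'I_N) := Y k; pose r' (k : 'I_N) := r k.
have lr k : al <= l' k /\ l' k <= r' k /\ r' k <= be.
  have /andP[rk1 rk2] := rY k; split; first by rewrite lerDl mulr_ge0// ltW.
  by split => //; rewrite -YN; apply: (le_trans rk2); exact: Yle.
have no : nonoverlapping l' r'.
  move=> k k' kk'; have [lt_kk'|lt_k'k|/val_inj E] := ltngtP (nat_of_ord k) k'.
  - by left; have /andP[_ /le_trans] := rY k; apply; exact: Yle.
  - by right; have /andP[_ /le_trans] := rY k'; apply; exact: Yle.
  - by rewrite E eqxx in kk'.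
have rU k : `]l' k, r' k[%classic `<=` U.
  move=> y /=; rewrite in_itv /= /l' /r' /r.
  case: asboolP => [[x [xk [_ xU]]]|_]; last first.
    by move=> /andP[/lt_trans] h1 /h1; rewrite ltxx.
  move: xk => /=; rewrite in_itv /= => /andP[x1 x2] /andP[y1 y2]; apply: xU => /=.
  rewrite /ball /= ltr_distl; move: hn x1 x2 y1 y2; rewrite YS.
  move: (n.+1%:R^-1) => i hi x1 x2 y1 y2.
  by apply/andP; split; lra.
have sd : \sum_(k < N) (r' k - l' k) < delta.
  rewrite -lte_fin; apply: le_lt_trans Ud.
  have -> : (\sum_(k < N) (r' k - l' k))%:E =
      (\sum_(k < N) \int[lebesgue_measure]_(y in `]l' k, r' k[) (cst 1 y))%E :> \bar R.
    rewrite -sumEFin; apply: eq_bigr => k _; rewrite integral_cst// mul1e.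
    have := @lebesgue_measure_itv R `]l' k, r' k[; rewrite /= lte_fin => E.
    apply/esym; apply: (etrans E).
    case: ltP => // rl; have [_ [lrk _]] := lr k.
    by rewrite (@le_anti _ _ (r' k) (l' k)) ?subrr// rl.
  have mU := open_measurable oU.
  apply: (le_trans (@sum_integral_itv_le R N l' r' U (cst 1%E) no mU rU _ _)) => //.
  by rewrite integral_cst// mul1e.
have := hd N l' r' lr no sd => /ltW; rewrite -lee_fin; apply: le_trans.
pose cell (k : nat) : set R := `]Y k, r k]%classic.
have cover : core U n `<=` \big[setU/set0]_(k < N) cell k.
  move=> x [xab xU]; rewrite -bigcup_mkord.
  move: (xab); rewrite /= in_itv /= => /andP[alx xbe].
  (* The cells are open on the left, so the one containing [x] is found by counting from [be]
     downwards; this gives the right cell at the nodes too. *)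
  pose k := (Num.truncn ((be - x) / h)).
  have z0 : 0 <= (be - x) / h by rewrite divr_ge0 ?subr_ge0// ltW.
  have /andP[k1 k2] := truncn_itv z0.
  have kN : (k < N)%N.
    rewrite -(ltr_nat R); apply: (le_lt_trans k1); rewrite ltr_pdivrMr//.
    by rewrite /h mulrC divfK ?pnatr_eq0// ltrD2l ltrN2.
  exists (N - k.+1)%N => /=; first by rewrite ltn_subrL.
  have YE : Y (N - k.+1)%N = be - k.+1%:R * h.
    by rewrite -YN /Y natrB//; ring.
  have x1 : Y (N - k.+1)%N < x.
    by rewrite YE ltrBlDr addrC -ltrBlDr -ltr_pdivrMr.
  have x2 : x <= Y (N - k.+1).+1%N.
    rewrite YS YE -natr1; move: k1; rewrite ler_pdivlMr// -/k => k1.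
    have -> : be - (k%:R + 1) * h + h = be - k%:R * h by ring.
    by rewrite lerBrDr -lerBrDl.
  rewrite /cell /= in_itv /= x1 /r; case: asboolP => // -[]; exists x; split => //=.
  by rewrite in_itv /= x1.
have le_cells : (nu (core U n) <= \sum_(k < N) nu (cell k))%E.
  have mcell k : measurable (cell k) by exact: measurable_itv.
  apply: (@le_trans _ _ (nu (\big[setU/set0]_(k < N) cell k))).
    apply: le_measure; rewrite ?inE; last exact: cover.
      exact: core_measurable.
    by apply: bigsetU_measurable => k _; exact: mcell.
  by apply: Boole_inequality => k _; exact: mcell.
apply: (le_trans le_cells).
rewrite -sumEFin; apply: lee_sum => k _; have [h1 [h2 h3]] := lr k.
by rewrite nu_itv// lee_fin ler_norm.
Qed.

(** Outer regularity places a null set in an open [U] of small Lebesgue measure. The part of [U] in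
    the interval is the increasing union of the sets [core U n], and [core_le] bounds each by the
    absolute continuity of [t], using finitely many intervals only. *)
Lemma ac_null_dominates : nu `<< lebesgue_measure.
Proof.
apply/null_content_dominatesP => A mA A0; apply/eqP.
rewrite -measure_le0; apply/lee_addgt0Pr => e e0; rewrite add0e.
have [delta d0 hd] := t_ac e0.
have Aoo : (lebesgue_measure A < +oo)%E by rewrite A0 ltry.
have [U [oU AU Ud]] := lebesgue_regularity_outer mA Aoo d0.
have mU := open_measurable oU.
have {}Ud : (lebesgue_measure U < delta%:E)%E.
  have UE : (U `\` A) `|` A = U by rewrite setUC setDUK.
  have : (lebesgue_measure ((U `\` A) `|` A) <= lebesgue_measure (U `\` A) + lebesgue_measure A)%E.
    by apply: measureU2 => //; exact: measurableD.
  by rewrite UE A0 adde0 => /le_lt_trans; exact.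
have E : U `&` `]al, be] = \bigcup_n core U n.
  apply/seteqP; split => [x [Ux xab]|x [n _ [xab xU]]]; last first.
    by split => //; apply: xU; exact: ballxx.
  move: oU; rewrite openE => /(_ _ Ux)[e' /= e'0 he'].
  pose n := Num.truncn e'^-1; exists n => //; split => // y xy; apply: he'.
  apply: (lt_le_trans xy); rewrite -[leRHS]invrK lef_pV2 ?posrE ?invr_gt0//.
  exact/ltW/truncnS_gt.
have nuU : (nu U <= nu (U `&` `]al, be]))%E.
  have UE : (U `&` `]al, be]) `|` (U `&` ~` `]al, be]) = U by rewrite -setIUr setUv setIT.
  rewrite -{1}UE.
  have mC : measurable (~` `]al, be] : set R) by exact: measurableC.
  have le2 : (nu ((U `&` `]al, be]) `|` (U `&` ~` `]al, be])) <=
      nu (U `&` `]al, be]) + nu (U `&` ~` `]al, be]))%E.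
    by apply: measureU2; exact: measurableI.
  apply: (le_trans le2).
  rewrite [X in (_ + X)%E](_ : _ = 0%E) ?adde0//.
  by apply/eqP; rewrite -measure_le0 -nu_out le_measure// inE//; exact: measurableI.
apply: (@le_trans _ _ (nu U)); first by rewrite le_measure// inE.
apply: (le_trans nuU); rewrite E.
have := @nondecreasing_cvg_mu _ _ _ nu (core U) (core_measurable U).
have mb : measurable (\bigcup_n core U n) by apply: bigcupT_measurable.
have nd : {homo core U : n k / (n <= k)%N >-> (n <= k)%O}.
  move=> n k nk; apply/subsetPset => x [xab xU]; split => // y xy; apply: xU.
  by apply: (lt_le_trans xy); rewrite lef_pV2 ?posrE// ler_nat ltnS.
move=> /(_ mb nd) cv; rewrite -(cvg_lim _ cv)//.
apply: lime_le; first by apply/cvg_ex; eexists; exact: cv.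
by apply: nearW => n /=; exact: (core_le n oU Ud hd).
Qed.

Variable nuC : {charge set (measurableTypeR R) -> \bar R}.
Hypothesis nuCE : forall A, nuC A = nu A.

Hypothesis t_sqr : (\int[lebesgue_measure]_(y in `]al, be[) ((derive1 t y) ^+ 2)%:E < +oo)%E.
Hypothesis mdt : measurable_fun `]al, be[ (derive1 t).

(** The density is the Radon-Nikodym derivative of [nu], whose integrals are the increments of [t]
    by construction. Differentiation of the indefinite integral identifies it almost everywhere with
    [derive1 t]. *)
Lemma ac_density : exists g : R -> R,
  [/\ lebesgue_measure.-integrable setT (EFin \o g),
   forall y z, al <= y -> y <= z -> z <= be ->
     (\int[lebesgue_measure]_(x in `]y, z]) (g x)%:E = (t z - t y)%:E)%E &
   {ae lebesgue_measure, forall x, al < x < be -> derive1 t x = g x}].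
Proof.
have dom : nuC `<< lebesgue_measure.
  have /null_content_dominatesP h := ac_null_dominates.
  by apply/null_content_dominatesP => A mA A0; rewrite nuCE; exact: h.
pose f := Radon_Nikodym nuC (@lebesgue_measure R).
have fE x : (fine (f x))%:E = f x by rewrite fineK// Radon_Nikodym_fin_num.
have fi : lebesgue_measure.-integrable setT f by exact: Radon_Nikodym_integrable.
pose g := fine \o f.
have gf : EFin \o g = f by apply/funext => x; exact: fE.
have gi : lebesgue_measure.-integrable setT (EFin \o g) by rewrite gf.
have gint A : measurable A -> (\int[lebesgue_measure]_(x in A) (g x)%:E = nu A)%E.
  move=> mA; rewrite -nuCE (Radon_Nikodym_integral dom mA).
  by apply: eq_integral => x _; exact: fE.
exists g; split => //.
  by move=> y z aly yz zbe; rewrite gint// nu_itv.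
have gl : locally_integrable setT g by apply: open_integrable_locally => //; exact: openT.
have gy (y : R) : lebesgue_measure.-integrable [set` Interval -oo%O (BRight y)] (EFin \o g).
  exact: integrableS gi.
have H := FTC1Ny gy gl.
apply: (@filterS _ (almost_everywhere (@lebesgue_measure R)) _ _ _ _ H) => x [_ <-].
move=> /andP[alx xbe]; set F := fun _ : R => _.
have FE y : al <= y -> y <= be -> F y = t y - t al.
  move=> aly ybe; rewrite /F /Rintegral gint//.
  (* The mass of [nu] on the half-line up to [al] is 0, so the indefinite integral from minus
     infinity is [t y - t al]. *)
  have -> : (`]-oo, y] = `]-oo, al] `|` `]al, y])%classic.
    apply/seteqP; split => z /=; rewrite !in_itv /=.
      by move=> zy; case: (leP z al) => zal; [left|right].
    by move=> [/le_trans|/andP[]//]; apply.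
  rewrite measureU//; last first.
    apply/seteqP; split => z //= -[]; rewrite !in_itv /= => zal /andP[/lt_le_trans].
    by move=> /(_ _ zal); rewrite ltxx.
  rewrite [X in fine (X + _)](_ : _ = 0%E); last first.
    apply/eqP; rewrite -measure_le0 -nu_out le_measure ?inE//; first exact: measurableC.
    by move=> z /=; rewrite !in_itv /= => zal; rewrite ltNge zal.
  transitivity (fine (t y - t al)%:E); last by [].
  by congr fine; rewrite add0e; exact: nu_itv.
have dF : derive1 F x = derive1 (fun y => t y - t al) x.
  apply: near_eq_derive1; have : \forall y \near x, `]al, be[%classic y.
    by apply: open_nbhs_nbhs; split; [exact: itv_open|rewrite /= in_itv /= alx].
  by apply: filterS => y /=; rewrite in_itv /= => /andP[aly ybe]; rewrite FE// ltW.
rewrite dF /derive1.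
rewrite (_ : (fun h => h^-1 *: ((t (h + x) - t al) - (t x - t al))) =
  (fun h => h^-1 *: (t (h + x) - t x)))//.
by apply/funext => h; congr (_ *: _); ring.
Qed.

(** [C0] is the integral of the squared derivative. On each cell, integrating [2 c g - c^2 <= g^2]
    with [c] the mean slope is Cauchy-Schwarz; all cells have the same length [h], which is then
    factored out. *)
Lemma ac_sqr_increment : exists C0 : R, forall N, (0 < N)%N ->
  let h := (be - al) / N%:R in
  \sum_(k < N) (t (al + k.+1%:R * h) - t (al + k%:R * h)) ^+ 2 <= C0 * h.
Proof.
have [g [gi gint gae]] := ac_density.
have mg : measurable_fun setT g.
  by have /integrableP[/measurable_EFinP] := gi.
have mg2 : measurable_fun setT (fun x => ((g x) ^+ 2)%:E).
  by apply/measurable_EFinP; exact: measurable_funX.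
have g2E : (\int[lebesgue_measure]_(y in `]al, be[) ((g y) ^+ 2)%:E =
    \int[lebesgue_measure]_(y in `]al, be[) ((derive1 t y) ^+ 2)%:E)%E.
  apply: ae_eq_integral => //.
  - exact: measurable_funTS.
  - by apply/measurable_EFinP; exact: measurable_funX.
  - apply: (@filterS _ (almost_everywhere (@lebesgue_measure R)) _ _ _ _ gae) => x h.
    by rewrite /= in_itv /= => /h ->.
have g2oo : (\int[lebesgue_measure]_(y in `]al, be[) ((g y) ^+ 2)%:E < +oo)%E by rewrite g2E.
have inc y z : al <= y -> y < z -> z <= be -> (((t z - t y) ^+ 2 / (z - y))%:E <=
    \int[lebesgue_measure]_(x in `]y, z[) ((g x) ^+ 2)%:E)%E.
  move=> aly yz zbe; have zy0 : 0 < z - y by rewrite subr_gt0.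
  have sub : `]y, z[%classic `<=` `]al, be[%classic.
    move=> x /=; rewrite !in_itv /= => /andP[yx xz].
    by rewrite (le_lt_trans aly yx) (lt_le_trans xz zbe).
  pose c := (t z - t y) / (z - y).
  have giz : lebesgue_measure.-integrable `]y, z[ (EFin \o g).
    exact: integrableS gi.
  have lyz : @lebesgue_measure R `]y, z[%classic = (z - y)%:E.
    by rewrite lebesgue_measure_itv /= lte_fin yz EFinB.
  have ci : lebesgue_measure.-integrable `]y, z[ (EFin \o (fun=> c ^+ 2)).
    apply/integrableP; split; first exact: measurable_cst.
    by rewrite /= integral_cst// [X in (_ * X)%E](_ : _ = (z - y)%:E)// -EFinM ltry.
  have cgi : lebesgue_measure.-integrable `]y, z[ (EFin \o (fun x => 2 * c * g x)).
      rewrite (_ : _ \o _ = (fun x => (2 * c)%:E * (EFin \o g) x)%E).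
      by apply: integrableZl.
    by apply/funext => x; rewrite /= EFinM.
  have E : (\int[lebesgue_measure]_(x in `]y, z[) (2 * c * g x - c ^+ 2)%:E =
      ((t z - t y) ^+ 2 / (z - y))%:E)%E.
    have gE : (\int[lebesgue_measure]_(x in `]y, z[) (g x)%:E = (t z - t y)%:E)%E.
      rewrite integral_itv_bndo_bndc; last exact/measurable_funTS/measurable_EFinP.
      by rewrite gint// ltW.
    under eq_integral do rewrite EFinB.
    rewrite integralB_EFin//.
    rewrite integral_cst// [X in (_ - _ * X)%E](_ : _ = (z - y)%:E)//.
    under eq_integral do rewrite EFinM.
    rewrite integralZl// gE -!EFinM -EFinB; congr EFin.
    by rewrite /c; field; rewrite gt_eqF.
  rewrite -E; apply: le_integral => //.
  - rewrite (_ : (fun x => _) = (fun x => (EFin \o (fun x => (2 * c * g x)%R)) x -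
        (EFin \o (fun=> (c ^+ 2)%R)) x)%E); last by apply/funext => x; rewrite /= EFinB.
    by apply: integrableB.
  - apply/integrableP; split; first exact: measurable_funTS.
    under eq_integral do rewrite abse_EFin ger0_norm ?sqr_ge0//.
    apply: le_lt_trans g2oo; apply: ge0_subset_integral => //; first exact: measurable_funTS.
    by move=> x _; rewrite lee_fin sqr_ge0.
  - move=> x _; rewrite lee_fin -subr_ge0.
    by rewrite (_ : _ - _ = (g x - c) ^+ 2) ?sqr_ge0//; ring.
exists (fine (\int[lebesgue_measure]_(y in `]al, be[) ((g y) ^+ 2)%:E)%E) => N N0 /=; set h := (be - al) / N%:R.
have h0 : 0 < h by rewrite divr_gt0 ?subr_gt0 ?ltr0n.
pose Y (k : nat) := al + k%:R * h.
have YS k : Y k.+1 - Y k = h by rewrite /Y -natr1; ring.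
have Yle j k : (j <= k)%N -> Y j <= Y k by move=> jk; rewrite lerD2l ler_pM2r// ler_nat.
have YN : Y N = be by rewrite /Y /h mulrC divfK ?subrKC// pnatr_eq0 -lt0n.
have alY k : al <= Y k by rewrite lerDl mulr_ge0// ltW.
have Ybe (k : 'I_N) : Y k.+1 <= be by rewrite -YN Yle.
rewrite -ler_pdivrMr// -lee_fin fineK; last first.
  by rewrite ge0_fin_numE// integral_ge0// => y _; rewrite lee_fin sqr_ge0.
have -> : (\sum_(k < N) (t (al + k.+1%:R * h) - t (al + k%:R * h)) ^+ 2) / h =
    \sum_(k < N) (t (Y k.+1) - t (Y k)) ^+ 2 / (Y k.+1 - Y k).
  by rewrite mulr_suml; apply: eq_bigr => k _; rewrite YS.
rewrite -sumEFin; apply: (@le_trans _ _ (\sum_(k < N)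
    \int[lebesgue_measure]_(x in `]Y k, Y k.+1[) ((g x) ^+ 2)%:E)%E).
  by apply: lee_sum => k _; apply: inc => //; rewrite -subr_gt0 YS.
apply: (@sum_integral_itv_le R N (fun k => Y k) (fun k => Y k.+1)) => //.
- move=> k k' kk'; have [lt_kk'|lt_k'k|/val_inj E] := ltngtP (nat_of_ord k) k'.
  + by left; exact: Yle.
  + by right; exact: Yle.
  + by rewrite E eqxx in kk'.
- move=> k x /=; rewrite !in_itv /= => /andP[yx xz].
  by rewrite (le_lt_trans (alY k) yx) (lt_le_trans xz (Ybe k)).
- by move=> x; rewrite lee_fin sqr_ge0.
Qed.

End ac_increments.

(** * The Stieltjes measure of the inverse scale *)

Section scale_ac.
Context {R : realType} (I : set R) (s : R -> R).
Hypotheses (oI : open_interval I) (hs : scaling_function I s).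
Let t := scale_inv I s.
Variables (a b : R).
Hypotheses (Ia : I a) (Ib : I b) (ab : a < b).
Hypothesis t_ac : abs_continuous_on (s @` I) t.
Hypothesis t_sqr :
  (\int[lebesgue_measure]_(y in `[s a, s b]) ((derive1 t y) ^+ 2)%:E < +oo)%E.

(** The scaling function is continuous on [I] only; clamping its argument to [[a, b]] makes it
    continuous on the line, hence a measurable map to push a measure forward with. *)
Let clamp (x : R) := s (Num.max a (Num.min b x)).

Let clampE x : a <= x <= b -> clamp x = s x.
Proof. by move=> /andP[ax xb]; rewrite /clamp min_r// max_r. Qed.

Let measurable_clamp : measurable_fun setT (clamp : R -> measurableTypeR R).
Proof.
apply: continuous_measurable_fun => x; apply: continuous_comp; last first.
  have [_ cs _] := hs; apply: cs; have [_ iI _] := oI; apply: (iI a b) => //.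
  by rewrite le_max lexx /= ge_max (ltW ab) ge_min lexx.
apply: (@continuous_max _ _ (fun=> a)); first exact: cst_continuous.
apply: (@continuous_min _ _ (fun=> b)); first exact: cst_continuous.
exact: cvg_id.
Qed.

Let itv_fin : (@lebesgue_measure R `]a, b]%classic < +oo)%E.
Proof. by rewrite lebesgue_measure_itv /= lte_fin ab -EFinB ltry. Qed.

Let lam : {finite_measure set (measurableTypeR R) -> \bar R} :=
  @mfrestr _ (measurableTypeR R) R `]a, b]%classic (@lebesgue_measure R)
    (measurable_itv `]a, b]) itv_fin.
(** The preimage of []y, z]] under [s] is []t y, t z]], so the image of Lebesgue measure on []a, b]]
    is the Stieltjes measure of [t]. [nuC] is the same set function as a charge, the form that
    Radon-Nikodym takes. *)
Let nu : {measure set (measurableTypeR R) -> \bar R} :=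
  measure_function_pushforward__canonical__measure_function_Measure lam measurable_clamp.
Let nuC : {charge set (measurableTypeR R) -> \bar R} :=
  measure_function_pushforward__canonical__charge_Charge (charge_of_finite_measure lam) measurable_clamp.

Lemma scale_ac_increments : exists C0 : R, forall N, (0 < N)%N ->
  let h := (s b - s a) / N%:R in
  \sum_(k < N) (t (s a + k.+1%:R * h) - t (s a + k%:R * h)) ^+ 2 <= C0 * h.
Proof.
have sab : s a < s b by rewrite (scale_lt hs).
have nuE A : nu A = @lebesgue_measure R ((clamp @^-1` A) `&` `]a, b]) by [].
have Jab : `[s a, s b]%classic `<=` s @` I.
  by move=> y /=; rewrite in_itv /= => yab; have [] := scale_between oI hs Ia Ib yab.
have mJ := open_measurable (scale_image_open oI hs).
have aI x : a <= x <= b -> I x by have [_ iI _] := oI; exact: (iI a b).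
apply: (@ac_sqr_increment R nu t (s a) (s b) sab _ _ _ nuC) => //.
- move=> y z ay yz zb; rewrite nuE.
  have [Jy /andP[aty tyb]] := @scale_between _ I s oI hs a b y Ia Ib
    (introT andP (conj ay (le_trans yz zb))).
  have [Jz /andP[atz tzb]] := @scale_between _ I s oI hs a b z Ia Ib
    (introT andP (conj (le_trans ay yz) zb)).
  have [Iy sy] := scale_invP hs Jy; have [Iz sz] := scale_invP hs Jz.
  have tyz : t y <= t z by rewrite (scale_inv_le hs).
  have -> : (clamp @^-1` `]y, z]) `&` `]a, b] = `]t y, t z]%classic.
    apply/seteqP; split => x /=; rewrite !in_itv /=.
      move=> [+ /andP[ax xb]]; have Ix := aI x (introT andP (conj (ltW ax) xb)).
      by rewrite clampE ?(ltW ax)// -{1}sy -{1}sz (scale_lt hs)// (scale_le hs).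
    move=> /andP[tyx xtz].
    have ax := le_lt_trans aty tyx; have xb := le_trans xtz tzb.
    have Ix := aI x (introT andP (conj (ltW ax) xb)).
    rewrite clampE ?(ltW ax)// ax xb; split => //.
    by rewrite -{1}sy -{1}sz (scale_lt hs)// (scale_le hs)// tyx.
  have -> : @lebesgue_measure R `]t y, t z]%classic = (t z - t y)%:E => //.
  rewrite lebesgue_measure_itv /= lte_fin; case: ltP => [_|zy]; first by rewrite EFinB.
  by rewrite (@le_anti _ _ (t z) (t y)) ?subrr// zy.
- rewrite nuE (_ : _ `&` _ = set0); first exact: measure0.
  apply/seteqP; split => x //=; rewrite !in_itv /= => -[nx /andP[ax xb]]; apply: nx.
  have Ix := aI x (introT andP (conj (ltW ax) xb)).
  by rewrite clampE ?(ltW ax)// (scale_lt hs)// (scale_le hs)// ax.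
- exact: (t_ac Jab).
- apply: le_lt_trans t_sqr; apply: ge0_subset_integral => //.
  + apply/measurable_EFinP; apply: measurable_funX; apply: measurable_funS Jab _ => //.
    apply: measurable_derive1; first exact: scale_image_open.
    by move=> y /set_mem; exact: scale_inv_continuous.
  + by move=> y _; rewrite lee_fin sqr_ge0.
  + exact: subset_itv_oo_cc.
- apply: (@measurable_funS _ _ _ _ (s @` I)) => //.
    by move=> y yab; apply: Jab; exact: subset_itv_oo_cc yab.
  apply: measurable_derive1; first exact: scale_image_open.
  by move=> y /set_mem; exact: scale_inv_continuous.
Qed.

End scale_ac.

(** * Tensor products and smooth functions on boxes *)

Section tensor.
Context {R : realType}.

Definition tensorf d (g : 'I_d -> R -> R) : 'rV[R]_d -> R :=
  fun x => \prod_(j < d) g j (x ord0 j).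

Lemma measurable_tensorf d (g : 'I_d -> R -> R) :
  (forall j, measurable_fun setT (g j)) ->
  measurable_fun (setT : set (borelV R d)) (tensorf g).
Proof.
move=> mg; rewrite /tensorf; elim: (index_enum _) => [|j r IH].
  by under eq_fun do rewrite big_nil; exact: measurable_cst.
under eq_fun do rewrite big_cons; apply: measurable_funM => //.
exact: (measurableT_comp (mg j) (coord_measurable j)).
Qed.

Lemma tensorf_vcons d (g : 'I_d.+1 -> R -> R) s z :
  tensorf g (vcons (s, z)) = g ord0 s * tensorf (fun j => g (lift ord0 j)) z.
Proof.
rewrite /tensorf big_ord_recl vcons0; congr (_ * _).
by apply: eq_bigr => j _; rewrite vconsS.
Qed.

Lemma tensorf_ge0 d (g : 'I_d -> R -> R) : (forall j x, 0 <= g j x) ->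
  forall x, 0 <= tensorf g x.
Proof. by move=> g0 x; apply: prodr_ge0. Qed.

Lemma sfm_integralZl dT (T : measurableType dT) (m : set T -> \bar R) (f : T -> \bar R)
    (c : R) : sfm m -> 0 <= c -> measurable_fun setT f -> (forall x, 0 <= f x)%E ->
  (\int[m]_x (c%:E * f x) = c%:E * \int[m]_x f x)%E.
Proof. by move=> [m' ->] c0 mf f0; rewrite ge0_integralZl. Qed.

Lemma integral_tensorf d (mu : 'I_d -> set R -> \bar R) (g : 'I_d -> R -> R) :
  (forall j, sfm (mu j)) -> (forall j, measurable_fun setT (g j)) ->
  (forall j x, 0 <= g j x) ->
  (\int[(prod_measure mu : set (borelV R d) -> \bar R)]_x (tensorf g x)%:E =
   \prod_(j < d) \int[mu j]_x (g j x)%:E)%E.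
Proof.
elim: d mu g => [mu g _ _ _|d IH mu g smu mg g0].
  rewrite prod_measure0 integral_dirac//; last first.
    by apply/measurable_EFinP; apply: measurable_tensorf => -[].
  by rewrite diracE in_setT mul1e /tensorf !big_ord0.
have G0 x := tensorf_ge0 g0 x.
have T0 (z : 'rV[R]_d) : 0 <= tensorf (fun j => g (lift ord0 j)) z.
  by apply: tensorf_ge0 => j x.
have mG : measurable_fun setT (fun x : borelV R d.+1 => (tensorf g x)%:E).
  by apply/measurable_EFinP; exact: measurable_tensorf.
rewrite integral_prod_measureS//.
rewrite big_ord_recl -IH//.
have sP := sfm_prod_measure (fun j => smu (lift ord0 j)).
pose P := (\int[(prod_measure (fun j => mu (lift ord0 j)) : set (borelV R d) -> \bar R)]_z
  (tensorf (fun j => g (lift ord0 j)) z)%:E)%E; rewrite -/P.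
have P0 : (0 <= P)%E.
  by apply: (sfm_integral_ge0 sP) => z; rewrite lee_fin; exact: T0.
transitivity (\int[mu ord0]_s (P * (g ord0 s)%:E))%E.
  apply: eq_integralT => s; under eq_integralT do rewrite tensorf_vcons EFinM.
  rewrite muleC; apply: sfm_integralZl => //.
  by apply/measurable_EFinP; exact: measurable_tensorf.
have [m0 ->] := smu ord0.
rewrite ge0_integralZl//; first by rewrite muleC.
- exact/measurable_EFinP.
- by move=> z _; rewrite lee_fin.
Qed.

Lemma fint_tensorf d (mu : 'I_d -> set R -> \bar R) (g : 'I_d -> R -> R) (r : 'I_d -> R) :
  (forall j, sfm (mu j)) -> (forall j, measurable_fun setT (g j)) ->
  (forall j x, 0 <= g j x) -> (forall j, \int[mu j]_x (g j x)%:E = (r j)%:E)%E ->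
  (\int[(prod_measure mu : set (borelV R d) -> \bar R)]_x (tensorf g x)%:E =
   (\prod_(j < d) r j)%:E)%E.
Proof.
move=> smu mg g0 gr; rewrite integral_tensorf// (eq_bigr _ (fun j _ => gr j)).
by rewrite (big_morph EFin (@EFinM R) (erefl _)).
Qed.

Section phi_tensor.
Context d (m : 'I_d -> set R -> \bar R) (K : 'I_d -> R -> R -> set R -> \bar R)
  (g : 'I_d -> R -> R).
Hypotheses (H : forall j, ssg (m j) (K j)) (Bg : forall j, bL1 (m j) (g j))
  (g0 : forall j x, 0 <= g j x).
Let mP : set (borelV R d) -> \bar R := prod_measure m.
Let KP t (x : borelV R d) : set (borelV R d) -> \bar R :=
  prod_measure (fun j => K j t (x ord0 j)).
Let sm j := ssg_sfm (H j).
Let HP : ssg mP KP. Proof. exact: cartesian_product_ssg. Qed.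
Let mg j : measurable_fun setT (g j). Proof. by have [] := Bg j. Qed.

Lemma tensorf_bL1 : bL1 mP (tensorf g).
Proof.
split; first exact: measurable_tensorf.
  have /choice[M hM] : forall j, exists M, forall x, `|g j x| <= M.
    by move=> j; have [_ [M hM] _] := Bg j; exists M.
  exists (\prod_(j < d) M j) => x; rewrite /tensorf normr_prod.
  by apply: ler_prod => j _; rewrite normr_ge0 hM.
have := @fint_tensorf d m g (fun j => fint (m j) (g j)) sm mg g0.
move=> /(_ (fun j => esym (fintE (sm j) (bL1_int (Bg j))))).
rewrite -/mP; case: (ssg_sfm HP) => m' -> e; apply/integrableP; split.
  by apply/measurable_EFinP; exact: measurable_tensorf.
rewrite [X in (X < _)%E](_ : _ = \int[m']_x (tensorf g x)%:E)%E; first by rewrite e ltry.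
by apply: eq_integral => x _ /=; rewrite ger0_norm//; exact: (tensorf_ge0 g0).
Qed.

(** For nonnegative factors Tonelli's theorem lets the product semigroup, and then both inner
    products, split over the coordinates. *)
Lemma phi_tensorf t : 0 < t -> phi mP KP t (tensorf g) =
  \prod_(j < d) ip (m j) (g j) (g j) -
  \prod_(j < d) ip (m j) (sgop (K j) t (g j)) (g j).
Proof.
move=> t0; have BT := tensorf_bL1; have BA := sgop_bL1 HP t0 BT.
have BAj j := sgop_bL1 (H j) t0 (Bg j).
have A0 j x : 0 <= sgop (K j) t (g j) x by exact: sgop_ge0.
have AE : sgop KP t (tensorf g) = tensorf (fun j => sgop (K j) t (g j)).
  apply/funext => x; apply: EFin_inj; rewrite (sgopE HP x t0 BT).
  apply: fint_tensorf => //.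
  - by move=> j; exact: ssg_ksfm (H j) t0.
  - by move=> j; rewrite (sgopE (H j)).
have tM (h k : 'I_d -> R -> R) x : tensorf h x * tensorf k x =
    tensorf (fun j x => h j x * k j x) x by rewrite /tensorf -big_split.
rewrite /phi; congr (_ - _); apply: EFin_inj.
  rewrite (ipE (ssg_sfm HP))//; under eq_integralT do rewrite tM.
  apply: fint_tensorf => //.
  - by move=> j; exact: measurable_funM.
  - by move=> j x; rewrite mulr_ge0.
  - by move=> j; rewrite (ipE (sm j)).
rewrite (ipE (ssg_sfm HP))// AE; under eq_integralT do rewrite tM.
apply: fint_tensorf => //.
- by move=> j; apply: measurable_funM => //; have [] := BAj j.
- by move=> j x; rewrite mulr_ge0.
- by move=> j; rewrite (ipE (sm j)).
Qed.

(** In the subtracted product, each factor with index other than [i] is raised to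
    [ip (m j) (g j) (g j)]; the common product then factors out. *)
Lemma phi_le_tensorf t i : 0 < t ->
  phi (m i) (K i) t (g i) * \prod_(j < d | j != i) ip (m j) (g j) (g j) <=
  phi mP KP t (tensorf g).
Proof.
move=> t0; rewrite phi_tensorf//.
rewrite [X in _ <= X - _](bigD1 i)//= [X in _ <= _ - X](bigD1 i)//= /phi mulrBl lerD2l lerN2.
have b0 j : 0 <= ip (m j) (sgop (K j) t (g j)) (g j).
  by apply: (fint_ge0 (sm j)) => x; rewrite mulr_ge0// (sgop_ge0 (H j)).
apply: ler_wpM2l => //; apply: ler_prod => j _; rewrite b0 /=.
by have := phi_ge0 (H j) t0 (Bg j); rewrite subr_ge0.
Qed.

End phi_tensor.

End tensor.

(** * Compactly supported smooth functions on a box *)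

Section compact_boxes.
Context {R : realType}.

Lemma compact_subset_itv (I K : set R) : open_interval I -> compact K -> K `<=` I ->
  exists a b, [/\ I a, I b, a < b & forall x, K x -> a < x < b].
Proof.
move=> oI cK KI; have [_ _ [x0 Ix0]] := oI.
have [K0|/set0P K0] := eqVneq K set0.
  have [a [b [Ia Ib _ _ /andP[ax xb]]]] := interval_around oI Ix0 ltr01.
  by exists a, b; split => //; [exact: lt_trans xb|move=> x; rewrite K0].
have [c /set_mem Kc cmax] := compact_EVT_max K0 cK
  (continuous_subspaceT (fun x => @cvg_id _ (nbhs x))).
have cN : continuous (fun x : R => - x) by move=> x; exact: cvgN.
have [e /set_mem Ke emin] := compact_EVT_max K0 cK (continuous_subspaceT cN).
have [_ [b [_ Ib _ _ /andP[_ cb]]]] := interval_around oI (KI _ Kc) ltr01.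
have [a [_ [Ia _ _ _ /andP[ae _]]]] := interval_around oI (KI _ Ke) ltr01.
have h x : K x -> a < x < b.
  move=> Kx; apply/andP; split.
    by apply: (lt_le_trans ae); rewrite -lerN2; apply: emin; exact: mem_set.
  by apply: le_lt_trans cb; apply: cmax; exact: mem_set.
exists a, b; split => //.
by have /andP[ax xb] := h _ Kc; exact: lt_trans xb.
Qed.

Lemma compact_subset_box d (I : 'I_d -> set R) (K : set 'rV[R]_d) :
  (forall i, open_interval (I i)) -> compact K -> K `<=` box I ->
  exists a b : 'I_d -> R, (forall i, [/\ I i (a i), I i (b i) & a i < b i]) /\
    forall x, K x -> forall i, a i < x ord0 i < b i.
Proof.
move=> oI cK KI.
have /choice[ab hab] : forall i, exists ab : R * R, [/\ I i ab.1, I i ab.2, ab.1 < ab.2 &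
    forall x, K x -> ab.1 < x ord0 i < ab.2].
  move=> i; pose Ki := [set (x : 'rV[R]_d) ord0 i | x in K].
  have cKi : compact Ki.
    apply: (continuous_compact (f := fun x : 'rV[R]_d => x ord0 i)) cK.
    by apply: continuous_subspaceT => x; exact: coord_continuous.
  have [|a [b [Ia Ib ab h]]] := compact_subset_itv (oI i) cKi.
    by move=> _ [x Kx <-]; exact: KI.
  by exists (a, b); split => // x Kx; apply: h; exists x.
exists (fun i => (ab i).1), (fun i => (ab i).2); split => [i|x Kx i].
  by have [] := hab i.
by have [_ _ _] := hab i; exact.
Qed.

Lemma cbox_compact d (a b : 'I_d -> R) : compact (cbox a b).
Proof.
have := @rV_compact R d (fun i => `[a i, b i]%classic) (fun i => @segment_compact R (a i) (b i)).
by congr compact; apply/seteqP; split => x /= h i; move: (h i); rewrite in_itv.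
Qed.

Lemma bounded_compact_support (T : topologicalType) (S : set T) (g : T -> R) :
  compact S -> continuous g -> (forall x, ~ S x -> g x = 0) ->
  exists2 M, 0 <= M & forall x, `|g x| <= M.
Proof.
move=> cS cg g0; have [S0|/set0P S0] := eqVneq S set0.
  by exists 0 => // x; rewrite g0 ?normr0// S0.
have [c _ hc] := compact_EVT_max S0 cS (f := fun x => `|g x|)
  (continuous_subspaceT (fun x => continuous_comp (cg x) (@norm_continuous _ _ _))).
exists `|g c| => // x; have [Sx|Sx] := pselect (S x); last by rewrite g0 ?normr0.
exact/hc/mem_set.
Qed.

Lemma lipschitz_derive (ph dph : R -> R) (L a b : R) :
  (forall x : R, is_derive x 1 ph (dph x)) -> (forall x, `|dph x| <= L) ->
  `|ph a - ph b| <= L * `|a - b|.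
Proof.
move=> hd hL.
have cph : continuous ph.
  by move=> x; apply: differentiable_continuous; apply/derivable1_diffP; have [] := hd x.
have key x y : x <= y -> `|ph y - ph x| <= L * `|y - x|.
  move=> xy; have [c _ ->] := MVT_segment xy (fun x _ => hd x) (continuous_subspaceT cph).
  by rewrite normrM ler_wpM2r.
by have [/key|/ltW/key//] := leP a b; rewrite distrC [ `|b - a|]distrC.
Qed.

End compact_boxes.

Section smooth_box.
Context {R : realType} {d : nat}.
Implicit Types (f : 'rV[R]_d -> R) (i : 'I_d).

(** The first partial derivatives are continuous and vanish off the compact support of [f], so they
    are bounded. The mean value theorem on lines parallel to the axes gives the Lipschitz bounds,
    with the sum of the bounds as common constant. *)
Lemma Ccinfty_boxfun (I : 'I_d -> set R) f : (forall i, open_interval (I i)) ->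
  Ccinfty (box I) f -> exists a b M L, (forall i, [/\ I i (a i), I i (b i) & a i < b i]) /\
    boxfun a b M L f.
Proof.
move=> oI [fs [cS SI]]; set S := closure _ in cS SI.
have [a [b [Iab Sab]]] := compact_subset_box oI cS SI.
have f0 x : ~ S x -> f x = 0.
  move=> Sx; apply/eqP/negPn/negP => fx; apply: Sx; exact: subset_closure.
have [cf df] := fs [::].
have [M M0 fM] := bounded_compact_support cS cf f0.
have /choice[L hL] : forall i, exists L, 0 <= L /\
    forall x, `|'D_(delta_mx ord0 i) f x| <= L.
  move=> i; have [cdf _] := fs [:: i].
  have [|L L0 hL] := bounded_compact_support cS cdf; last by exists L.
  move=> x Sx /=; rewrite -[RHS](@derive_cst _ _ _ 0 x (delta_mx ord0 i)).
  apply: near_eq_derive.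
  have : \forall y \near x, (~` S) y.
    apply: open_nbhs_nbhs; split => //; apply: closed_openC; exact: closed_closure.
  by apply: filterS => y; exact: f0.
have L0 : 0 <= \sum_i L i by apply: sumr_ge0 => i _; have [] := hL i.
exists a, b, M, (\sum_i L i); split => //; split => //.
- exact: continuous_borelV_measurable.
- move=> x nx; apply: f0 => /Sab h; apply: nx => i.
  by have /andP[h1 h2] := h i; rewrite !ltW.
- move=> i x y xy.
  (* The line through [y] parallel to axis [i], parametrised by its [i]-th coordinate. *)
  pose z (s : R) := (s - y ord0 i) *: delta_mx ord0 i + y : 'rV[R]_d.
  have zx : z (x ord0 i) = x.
    apply/rowP => j; rewrite !mxE eqxx /=; have [->|ji] := eqVneq j i.
      by rewrite mulr1 subrK.
    by rewrite mulr0 add0r xy.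
  have zy : z (y ord0 i) = y by rewrite /z subrr scale0r add0r.
  pose ph s := f (z s).
  have dph (s : R) : is_derive s 1 ph ('D_(delta_mx ord0 i) f (z s)).
    have qE : (fun h : R => h^-1 *: ((ph \o shift s) (h *: (1 : R)) - ph s)) =
        (fun h => h^-1 *: ((f \o shift (z s)) (h *: delta_mx ord0 i) - f (z s))).
      apply/funext => h; congr (_ *: (f _ - _)).
      have hA : h *: (1 : R) = h by rewrite /GRing.scale /= mulr1.
      by rewrite /z /shift /= hA -[h + s - _]addrA scalerDl addrA.
    apply: DeriveDef; first by rewrite /derivable qE; exact: df.
    by rewrite /derive qE.
  have := @lipschitz_derive R ph _ (\sum_j L j) (x ord0 i) (y ord0 i) dph.
  rewrite /ph zx zy; apply => s; have [Li hLi] := hL i.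
  apply: (le_trans (hLi _)); rewrite (bigD1 i)//= lerDl; apply: sumr_ge0 => j _.
  by have [] := hL j.
Qed.

Lemma continuous_tensorf (g : 'I_d -> R -> R) : (forall j, continuous (g j)) ->
  continuous (tensorf g).
Proof.
move=> cg; rewrite /tensorf; elim: (index_enum _) => [|j r IH] x.
  rewrite (_ : (fun x : 'rV[R]_d => _) = fun=> 1); first exact: cst_continuous.
  by apply/funext => y; rewrite big_nil.
have c1 : continuous (fun x : 'rV[R]_d => g j (x ord0 j)).
  by move=> y; exact: (continuous_comp (@coord_continuous R 1 d ord0 j y) (cg j _)).
rewrite (_ : (fun x : 'rV[R]_d => _) =
    (fun x => g j (x ord0 j) * \prod_(k <- r) g k (x ord0 k))); last first.
  by apply/funext => y; rewrite big_cons.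
exact: (cvgM (c1 x) (IH x)).
Qed.

Lemma tensorf_partial (g : 'I_d -> R -> R) i (x : 'rV[R]_d) :
  (forall y : R, derivable (g i) y 1) ->
  is_derive x (delta_mx ord0 i) (tensorf g)
    (tensorf (fun j => if j == i then derive1 (g j) else g j) x).
Proof.
move=> dg; set P := \prod_(j < d | j != i) g j (x ord0 j).
have qE : (fun h : R => h^-1 *: ((tensorf g \o shift x) (h *: delta_mx ord0 i) - tensorf g x)) =
    (fun h => P * (h^-1 *: (g i (h + x ord0 i) - g i (x ord0 i)))).
  apply/funext => h; rewrite /tensorf /= (bigD1 i)//= [X in _ - X](bigD1 i)//= -/P.
  rewrite (eq_bigr (fun j => g j (x ord0 j))); last first.
    by move=> j ji; rewrite !mxE (negbTE ji) andbF mulr0 add0r.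
  by rewrite -/P !mxE !eqxx mulr1 /GRing.scale /=; ring.
have c : (fun h => P * (h^-1 *: (g i (h + x ord0 i) - g i (x ord0 i)))) @ (0 : R)^' -->
    P * derive1 (g i) (x ord0 i).
  apply: cvgM; first exact: cvg_cst.
  have := dg (x ord0 i); rewrite /derivable /derive1.
  by under eq_fun do rewrite /GRing.scale /= mulr1; exact.
apply: DeriveDef; first by rewrite /derivable qE; apply/cvg_ex; eexists; exact: c.
rewrite /derive qE (cvg_lim _ c)// /tensorf [RHS](bigD1 i)//= eqxx mulrC; congr (_ * _).
by apply: eq_bigr => j /negbTE ->.
Qed.

Lemma partials_tensorf (g : 'I_d -> R -> R) (l : seq 'I_d) :
  (forall j n (y : R), derivable (derive1n n (g j)) y 1) ->
  partials l (tensorf g) = tensorf (fun j => derive1n (count_mem j l) (g j)).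
Proof.
move=> dg; elim: l => [//|i l IH] /=; rewrite IH; apply/funext => x.
have [_ ->] := tensorf_partial (g := fun j => derive1n (count_mem j l) (g j)) x (dg i _).
congr tensorf; apply/funext => j; rewrite [i == j]eq_sym.
by have [->|//] := eqVneq j i; rewrite add1n.
Qed.

Lemma tensorf_Ccinfty (I : 'I_d -> set R) (a b : 'I_d -> R) (g : 'I_d -> R -> R) :
  (forall i, is_interval (I i)) -> (forall i, I i (a i)) -> (forall i, I i (b i)) ->
  (forall j n, Ck n (g j)) -> (forall j x, ~ (a j <= x <= b j) -> g j x = 0) ->
  Ccinfty (box I) (tensorf g).
Proof.
move=> iI Ia Ib Cg g0.
have dg j n (y : R) : derivable (derive1n n (g j)) y 1.
  exact: (@Ck_derivable _ n.+1 _ (Cg j n.+1) n y).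
split.
  move=> l; rewrite partials_tensorf//; split.
    apply: continuous_tensorf => j x; apply: differentiable_continuous.
    exact/derivable1_diffP/dg.
  by move=> i x; have [] := tensorf_partial (g := fun j => derive1n (count_mem j l) (g j)) x (dg i _).
have sub : closure [set x | tensorf g x != 0] `<=` cbox a b.
  have cC : closed (cbox a b) by apply: compact_closed; [exact: norm_hausdorff|exact: cbox_compact].
  rewrite [X in _ `<=` X](closure_id _).1//; apply: closure_subset => x /= tx i.
  apply: contrapT => nx; move/negP: tx; apply; rewrite /tensorf (bigD1 i)//= g0 ?mul0r//.
split; last by move=> x /sub xab i; exact: (iI i (a i) (b i)).
by apply: (subclosed_compact _ _ sub); [exact: closed_closure|exact: cbox_compact].
Qed.

End smooth_box.

Lemma smooth_cutoff (R : realType) (a' a b b' : R) : a' < a -> a <= b -> b < b' ->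
  exists chi : R -> R, [/\ forall n, Ck n chi, forall x, 0 <= chi x <= 1,
    forall x, a <= x <= b -> chi x = 1 & forall x, ~ (a' <= x <= b') -> chi x = 0].
Proof.
move=> a'a ab bb'; have [sg [sgC sg0 sg1 sg01 _]] := @smooth_transition R.
have da : 0 < a - a' by rewrite subr_gt0.
have db : 0 < b' - b by rewrite subr_gt0.
exists (fun x => sg ((x - a') / (a - a')) * sg ((b' - x) / (b' - b))); split.
- move=> n; apply: CkM; apply: Ck_comp => //.
    by apply: CkM; [apply: CkD; [exact: Ck_id|exact: Ck_cst]|exact: Ck_cst].
  apply: CkM; last exact: Ck_cst.
  apply: CkD; first exact: Ck_cst.
  have -> : -%R = (fun x : R => (-1) * x) by apply/funext => x; rewrite mulN1r.
  by apply: CkM; [exact: Ck_cst|exact: Ck_id].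
- move=> x; have /andP[h1 h2] := sg01 ((x - a') / (a - a')).
  by have /andP[h3 h4] := sg01 ((b' - x) / (b' - b)); rewrite mulr_ge0//= mulr_ile1.
- move=> x /andP[ax xb]; rewrite !sg1 ?mulr1//.
    by rewrite ler_pdivlMr// mul1r lerD2l lerN2.
  by rewrite ler_pdivlMr// mul1r lerD2r.
- move=> x nx; have [xa|ax] := ltP x a'.
    by rewrite sg0 ?mul0r// pmulr_lle0 ?invr_gt0// subr_le0 ltW.
  have [xb|bx] := leP x b'; first by exfalso; apply: nx; rewrite ax.
  by rewrite [X in _ * X]sg0 ?mulr0// pmulr_lle0 ?invr_gt0// subr_le0 ltW.
Qed.

(** * Local square integrability on a box *)

Section lebesgue_copy.
Context {R : realType}.

(* [lebesgue_measure] is a measure on [measurableTypeR R]; the measurable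
   structure of [R] itself has another display *)
Local Notation lebR := (@lebesgue_measure R : set R -> \bar R).

Let measurable_id_copy : measurable_fun setT (id : measurableTypeR R -> R).
Proof. by move=> _ A mA; rewrite setTI. Qed.

Let copy : {measure set R -> \bar R} :=
  measure_function_pushforward__canonical__measure_function_Measure
    (@lebesgue_measure R) measurable_id_copy.

Let copyE : lebR = copy. Proof. by []. Qed.

Lemma sfm_lebesgue : sfm lebR.
Proof.
rewrite copyE; apply: sigma_finite_sfm.
by have [F FT mF] := sigma_finiteT (@lebesgue_measure R); exists F.
Qed.

Lemma integral_lebesgue_copy (f : R -> \bar R) : mnn f ->
  (\int[lebR]_x f x = \int[lebesgue_measure]_x f x)%E.
Proof. by move=> [mf f0]; rewrite copyE ge0_integral_pushforward. Qed.

End lebesgue_copy.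

Section prode.
Context {R : realType}.
Local Open Scope ereal_scope.

Lemma prode_lty d (f : 'I_d -> \bar R) : (forall j, 0 <= f j) ->
  (forall j, f j < +oo) -> \prod_(j < d) f j < +oo.
Proof.
move=> f0 foo; suff: 0 <= \prod_(j < d) f j < +oo by case/andP.
elim/big_ind: _ => [|x y /andP[x0 xoo] /andP[y0 yoo]|j _].
- by rewrite lee01 ltry.
- rewrite mule_ge0//=; apply: lte_mul_pinfty => //.
  by rewrite ge0_fin_numE.
- by rewrite f0 foo.
Qed.

(** Strict positivity matters, since [0 * +oo = 0] would hide an infinite factor. *)
Lemma lty_prode d (f : 'I_d -> \bar R) i : (forall j, 0 < f j) ->
  \prod_(j < d) f j < +oo -> f i < +oo.
Proof.
move=> f0; rewrite (bigD1 i)//=; set P := (X in _ * X).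
have P0 : 0 < P by rewrite /P; elim/big_ind: _ => // *; exact: mule_gt0.
case: (f i) (f0 i) => [r _ _|_|//]; first exact: ltry.
by rewrite gt0_mulye// ltxx.
Qed.

End prode.

Section box_integral.
Context {R : realType} {d : nat}.
Local Notation lebV := (prod_measure (fun _ : 'I_d => (@lebesgue_measure R : set R -> \bar R))
  : set (borelV R d) -> \bar R).

Lemma lebesgue_itv_lty (a b : R) : (@lebesgue_measure R `[a, b]%classic < +oo)%E.
Proof. by rewrite lebesgue_measure_itv /=; case: ifP => _; rewrite -?EFinB ltry. Qed.

Lemma sfm_lebV : sfm lebV.
Proof. by apply: sfm_prod_measure => _; exact: sfm_lebesgue. Qed.

Lemma integral_cbox_coord (al be : 'I_d -> R) i (g : R -> R) :
  measurable_fun setT g -> (forall x, 0 <= g x) ->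
  (\int[lebV]_(y in cbox al be) (g (y ord0 i))%:E =
   \prod_(j < d) \int[lebesgue_measure]_(x in `[al j, be j])
      (if j == i then g x else 1)%:E)%E.
Proof.
move=> mg g0.
pose G j x := (if j == i then g x else 1) * \1_(`[al j, be j]%classic) x.
have G0 j x : 0 <= G j x by rewrite mulr_ge0//; case: ifP.
have mG j : measurable_fun setT (G j).
  by apply: measurable_funM; [case: (j == i)|exact: measurable_indic].
have GE j x : (G j x)%:E =
    ((fun x => (if j == i then g x else 1)%:E) \_ `[al j, be j]%classic) x.
  by rewrite patchE /G indicE; case: (x \in `[al j, be j]%classic); rewrite ?mulr1 ?mulr0.
rewrite (sfm_integral_mkcond _ _ sfm_lebV).
transitivity (\int[lebV]_y (tensorf G y)%:E)%E.
  apply: eq_integralT => y; rewrite patchE; case: ifPn => [/set_mem yc|yc].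
    congr EFin; rewrite /tensorf (bigD1 i)//= big1 ?mulr1.
      by rewrite /G eqxx indicE mem_set ?mulr1//= in_itv; exact: yc.
    move=> j /negbTE ji; rewrite /G ji indicE mem_set ?mulr1//= in_itv; exact: yc.
  have /existsNP[j hj] : ~ cbox al be y by move=> h; rewrite mem_set in yc.
  have nj : ~ `[al j, be j]%classic (y ord0 j) by rewrite /= in_itv.
  by congr EFin; rewrite /tensorf (bigD1 j)//= /G indicE memNset// mulr0 mul0r.
rewrite integral_tensorf//; last by move=> j; exact: sfm_lebesgue.
apply: eq_bigr => j _; rewrite integral_lebesgue_copy; last first.
  by split; [exact/measurable_EFinP|move=> x; rewrite lee_fin].
by rewrite [RHS]integral_mkcond; apply: eq_integralT => x; exact: GE.
Qed.

Lemma lebV_cbox_lty (al be : 'I_d -> R) : (lebV (cbox al be) < +oo)%E.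
Proof.
apply: prod_measure_cbox_fin => i; first exact: sfm_lebesgue.
exact: lebesgue_itv_lty.
Qed.

End box_integral.

Section scale_L2loc.
Context {R : realType} {d : nat} (I : 'I_d -> set R) (s : 'I_d -> R -> R).
Hypotheses (oI : forall i, open_interval (I i))
  (hs : forall i, scaling_function (I i) (s i)).
Let t i := scale_inv (I i) (s i).
Let J i := s i @` I i.
Let U : set 'rV[R]_d := box J.
Local Notation lebV := (prod_measure (fun _ : 'I_d => (@lebesgue_measure R : set R -> \bar R))
  : set (borelV R d) -> \bar R).
Let dt (y : 'rV[R]_d) : 'rV[R]_d := \row_i derive1 (t i) (y ord0 i).

Let oJ i : open (J i). Proof. exact: scale_image_open (oI i) (hs i). Qed.
Let mJ i : measurable (J i). Proof. exact: open_measurable. Qed.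
Let mdt i : measurable_fun (J i) (derive1 (t i)).
Proof.
apply: measurable_derive1 => // y /set_mem; exact: (scale_inv_continuous (oI i) (hs i)).
Qed.

(** The derivative is extended by 0 off [J i], to be measurable on the whole line as the product
    formula requires. *)
Let sq i (x : R) : R := ((derive1 (t i)) \_ (J i)) x ^+ 2.
Let msq i : measurable_fun setT (sq i).
Proof. by apply: measurable_funX; apply/(measurable_restrictT _ (mJ i)). Qed.
Let sq0 i x : 0 <= sq i x. Proof. exact: sqr_ge0. Qed.
Let sqE i x : J i x -> sq i x = derive1 (t i) x ^+ 2.
Proof. by move=> Jx; rewrite /sq patchE mem_set. Qed.

Let J_between i a b x : I i a -> I i b -> s i a <= x <= s i b -> J i x.
Proof. by move=> Ia Ib xab; have [] := scale_between (oI i) (hs i) Ia Ib xab. Qed.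

Lemma measurable_box : measurable (U : set (borelV R d)).
Proof.
have -> : U = \bigcap_(i in [set` [set: 'I_d]%SET]) [set x : 'rV[R]_d | J i (x ord0 i)].
  by apply/seteqP; split => [x h i _|x h i]; [exact: h|apply: h; rewrite /= inE].
apply: fin_bigcap_measurable => // i _.
by rewrite -[X in measurable X]setTI; exact: (coord_measurable i).
Qed.

(** The compact set is a box with [[s i a, s i b]] as its [i]-th side and arbitrary nondegenerate
    sides in the other directions. Its integral is a product of one-dimensional ones, from which the
    [i]-th is extracted. *)
Lemma L2loc_scale_inv i a b : L2loc U dt -> I i a -> I i b -> a < b ->
  (\int[lebesgue_measure]_(y in `[s i a, s i b]) ((derive1 (t i) y) ^+ 2)%:E < +oo)%E.
Proof.
move=> [mdtU dtK] Ia Ib ab.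
have /choice[ab' hab'] : forall j, exists ab' : R * R,
    [/\ I j ab'.1, I j ab'.2, ab'.1 < ab'.2 & j = i -> ab' = (a, b)].
  move=> j; have [->|ji] := eqVneq j i; first by exists (a, b).
  have [_ _ [x Ix]] := oI j.
  have [a' [b' [Ia' Ib' _ _ /andP[ax xb]]]] := interval_around (oI j) Ix ltr01.
  by exists (a', b'); split => //=; [exact: lt_trans xb|move=> /eqP; rewrite (negbTE ji)].
pose al j := s j (ab' j).1; pose be j := s j (ab' j).2.
have albe j : al j < be j by have [I1 I2 lt12 _] := hab' j; rewrite (scale_lt (hs j)).
have KU : cbox al be `<=` U.
  by move=> x xab j; have [I1 I2 _ _] := hab' j; exact: (J_between I1 I2 (xab j)).
have := dtK _ (@cbox_compact R d al be) KU.
have mK := @measurable_cbox R d al be.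
have [_ _ _ /(_ erefl) abE] := hab' i.
have mab : measurable_fun `[s i a, s i b]%classic (derive1 (t i)).
  apply: (@measurable_funS _ _ _ _ (J i)) => //.
  by move=> x /=; rewrite in_itv => xab; exact: (J_between Ia Ib xab).
have [lV lVE] := @sfm_lebV R d.
have msq1 : measurable_fun setT (fun x => sq i x + 1) by exact: measurable_funD.
have K1 := @lebV_cbox_lty R d al be.
have sq1E := @integral_cbox_coord R d al be i (fun x => sq i x + 1).
rewrite lVE in K1 sq1E *; move=> Koo.
have sqK : (\int[lV]_(y in cbox al be) (sq i (y ord0 i))%:E < +oo)%E.
  apply: le_lt_trans Koo; apply: ge0_le_integral => //.
  - by move=> y _; rewrite lee_fin.
  - apply: measurable_funTS; apply/measurable_EFinP.
    exact: (measurableT_comp (msq i) (coord_measurable i)).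
  - apply/measurable_EFinP; apply: measurable_sum => j; apply: measurable_funX.
    exact: measurable_funS measurable_box KU (mdtU j).
  - move=> y yK; rewrite lee_fin (bigD1 i)//= mxE sqE; last exact: KU.
    by rewrite lerDl; apply: sumr_ge0 => j _; exact: sqr_ge0.
(* Adding 1 keeps the integral finite and makes the [i]-th factor positive even if the derivative
   vanishes, as [lty_prode] requires. *)
have sq1K : (\int[lV]_(y in cbox al be) (sq i (y ord0 i) + 1)%:E < +oo)%E.
  under eq_integral do rewrite EFinD.
  rewrite ge0_integralD//.
  - apply: lte_add_pinfty => //; by rewrite integral_cst// mul1e.
  - by move=> y _; rewrite lee_fin.
  - apply: measurable_funTS; apply/measurable_EFinP.
    exact: (measurableT_comp (msq i) (coord_measurable i)).
move: sq1K; rewrite sq1E; last 2 first.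
- exact: measurable_funD.
- by move=> x; rewrite addr_ge0.
have gt0 j : (0 < \int[lebesgue_measure]_(x in `[al j, be j]) (if j == i then sq i x + 1 else 1)%:E)%E.
  apply: (@lt_le_trans _ _ (\int[lebesgue_measure]_(x in `[al j, be j]) (cst 1 x))%E).
    rewrite integral_cst// mul1e; have := @lebesgue_measure_itv R `[al j, be j].
    rewrite /= lte_fin albe => E; rewrite [ltRHS](_ : _ = (be j - al j)%:E)//.
    by rewrite lte_fin subr_gt0.
  apply: ge0_le_integral => //.
  - apply/measurable_EFinP; case: (j == i) => //.
    exact: (measurable_funTS msq1).
  - by move=> x _; rewrite lee_fin; case: ifP => // _; rewrite lerDr.
move=> /(lty_prode i gt0); rewrite eqxx; apply: le_lt_trans.
rewrite /al /be abE /=; apply: ge0_le_integral => //.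
- by move=> x _; rewrite lee_fin sqr_ge0.
- by apply/measurable_EFinP; exact: (measurable_funX 2 mab).
- by apply/measurable_EFinP; exact: (measurable_funTS msq1).
- move=> x /=; rewrite in_itv => xab; rewrite lee_fin sqE ?lerDl//.
  exact: (J_between Ia Ib xab).
Qed.

Lemma scale_inv_L2loc : (forall i a b, I i a -> I i b -> a < b ->
  (\int[lebesgue_measure]_(y in `[s i a, s i b]) ((derive1 (t i) y) ^+ 2)%:E < +oo)%E) ->
  L2loc U dt.
Proof.
move=> hsq.
have mdtU i : measurable_fun (U : set (borelV R d)) (fun y => dt y ord0 i).
  under eq_fun do rewrite mxE.
  apply: (@measurable_comp _ _ _ _ _ _ (J i) (derive1 (t i))) => //.
    by move=> _ [y Uy <-]; exact: Uy.
  exact: measurable_funTS (coord_measurable i).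
split => // K cK KU.
have opJ i : open_interval (J i).
  split => //; first exact: scale_image_interval (oI i) (hs i).
  by have [_ _ [x Ix]] := oI i; exists (s i x), x.
have [al [be [hab Kab]]] := compact_subset_box opJ cK KU.
have KC : K `<=` cbox al be.
  by move=> x Kx i; have /andP[h1 h2] := Kab x Kx i; rewrite !ltW.
have CU : cbox al be `<=` U.
  move=> x xab i; have [Jal Jbe _] := hab i.
  exact: (scale_image_interval (oI i) (hs i) Jal Jbe (xab i)).
have mC := @measurable_cbox R d al be.
have mK : measurable (K : set (borelV R d)).
  by apply: borelV_closed; apply: compact_closed => //; exact: norm_hausdorff.
have sqC i : (\int[lebV]_(y in cbox al be) (sq i (y ord0 i))%:E < +oo)%E.
  rewrite integral_cbox_coord//.
  apply: prode_lty => j.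
    by apply: integral_ge0 => x _; rewrite lee_fin; case: ifP.
  case: eqVneq => [->|ji]; last first.
    by rewrite integral_cst// mul1e; exact: lebesgue_itv_lty.
  have [[a Ia aE] [b Ib bE] lab] := hab i.
  have {}lab : a < b by rewrite -(scale_lt (hs i) Ia Ib) aE bE.
  have := hsq i a b Ia Ib lab; rewrite aE bE; apply: le_lt_trans.
  rewrite le_eqVlt; apply/orP; left; apply/eqP; apply: eq_integral => x /set_mem /=.
  by rewrite in_itv -aE -bE => xab; rewrite sqE//; exact: (J_between Ia Ib xab).
have [lV lVE] := @sfm_lebV R d.
rewrite lVE in sqC *.
have mI : measurable_fun (cbox al be : set (borelV R d))
    (fun y => (\sum_(i < d) (dt y ord0 i) ^+ 2)%:E).
  apply/measurable_EFinP; apply: measurable_sum => j; apply: measurable_funX.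
  exact: measurable_funS measurable_box CU (mdtU j).
apply: (@le_lt_trans _ _ (\int[lV]_(y in cbox al be) (\sum_(i < d) (dt y ord0 i) ^+ 2)%:E)%E).
  apply: ge0_subset_integral => //.
  by move=> y _; rewrite lee_fin; apply: sumr_ge0 => i _; exact: sqr_ge0.
rewrite (eq_integral (fun y : borelV R d => \sum_(i < d) (sq i (y ord0 i))%:E)%E); last first.
  move=> y /set_mem yC; rewrite -sumEFin; apply: eq_bigr => i _.
  by rewrite mxE sqE//; exact: CU.
have msqC i : measurable_fun (cbox al be : set (borelV R d)) (fun y => (sq i (y ord0 i))%:E).
  apply: measurable_funTS; apply/measurable_EFinP.
  exact: (measurableT_comp (msq i) (coord_measurable i)).
rewrite ge0_integral_sum//; last by move=> i y _; rewrite lee_fin.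
by apply: lte_sum_pinfty => i _; exact: sqC.
Qed.

End scale_L2loc.

(** * The product form *)

Section product_form.
Context {R : realType} {d : nat} (I : 'I_d -> set R) (s : 'I_d -> R -> R)
  (m : 'I_d -> {measure set R -> \bar R}) (p : 'I_d -> R -> R.-spker R ~> R).
Hypotheses (oI : forall i, open_interval (I i))
  (hs : forall i, scaling_function (I i) (s i))
  (hm : forall i, speed_measure (I i) (m i))
  (hX : forall i, minimal_diffusion (I i) (s i) (m i) (p i)).
Let E : set (borelV R d) := box I.
Let mE : set (borelV R d) -> \bar R := prod_measure (fun i => (m i : set R -> \bar R)).
Let t i := scale_inv (I i) (s i).
Let J i := s i @` I i.
Let K i := ktrans (I i) (p i).
Let KP (r : R) (x : borelV R d) : set (borelV R d) -> \bar R :=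
  prod_measure (fun i => K i r (x ord0 i)).

Let H i : ssg (m i) (K i). Proof. exact: minimal_ssg (oI i) (hm i) (hX i). Qed.
Let HP : ssg mE KP. Proof. exact: cartesian_product_ssg. Qed.

Let between i a b x : I i a -> I i b -> a <= x <= b -> I i x.
Proof. by move=> Ia Ib; have [_ iI _] := oI i; exact: (iI a b). Qed.

Lemma product_dirichletP u (e : R) : bL1 mE u -> (forall x, ~ E x -> u x = 0) ->
  dirichlet_form E mE (cartesian_product p) u e <->
  (fun r => phi mE KP r u / r) @ (0 : R)^'+ --> e.
Proof.
move=> Bu u0; apply: (dirichlet_formP HP) => // r x _ Ex.
by congr prod_measure; apply/funext => i; exact: (ktransE (p i) r (Ex i)).
Qed.

(** The bound [phi r f <= C r] is enough for membership: by [phi_cvg] it makes the quotients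
    converge to a finite energy. *)
Lemma domain_of_square_integrable :
  (forall i, abs_continuous_on (J i) (t i)) ->
  (forall i a b, I i a -> I i b -> a < b ->
    (\int[lebesgue_measure]_(y in `[s i a, s i b]) ((derive1 (t i) y) ^+ 2)%:E < +oo)%E) ->
  forall f, Ccinfty (E : set 'rV[R]_d) f -> dirichlet_domain E mE (cartesian_product p) f.
Proof.
move=> ac sq f Cf; have [a [b [M [L [Iab bf]]]]] := Ccinfty_boxfun oI Cf.
have moo i : (m i `[a i, b i]%classic < +oo)%E.
  by have [Ia Ib _] := Iab i; exact: (speed_itv_fin (oI i) (hm i)).
have [C hC] : exists C, forall f, boxfun a b M L f -> forall r, 0 < r ->
    phi mE KP r f <= C * r.
  apply: phi_boxfun => // i; have [Ia Ib ab] := Iab i.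
  have [C0 hC0] := scale_ac_increments (oI i) (hs i) Ia Ib ab (ac i) (sq i _ _ Ia Ib ab).
  exact: (itvfun_phi_le (oI i) (hs i) (hm i) (hX i) Ia Ib ab hC0).
have Bf : bL1 mE f by apply: (boxfun_bL1 _ moo bf) => i; exact: ssg_sfm (H i).
have f0 x : ~ E x -> f x = 0.
  move=> nEx; have [_ _ + _] := bf; apply => xab; apply: nEx => i.
  by have [Ia Ib _] := Iab i; exact: (between Ia Ib (xab i)).
have [e he] := phi_cvg HP Bf ltr01 (fun r hr => hC f bf r (andP hr).1).
by exists e; apply/product_dirichletP.
Qed.

Lemma ip_gt0 i a b g : I i a -> I i b -> a < b -> bL1 (m i) g ->
  (forall x, a <= x <= b -> g x = 1) -> 0 < ip (m i) g g.
Proof.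
move=> Ia Ib ab Bg g1; have [_ _ mpos] := hm i; have sm := ssg_sfm (H i).
rewrite -lte_fin (ipE sm Bg Bg).
have sub : `]a, b[%classic `<=` I i.
  by move=> x /=; rewrite in_itv /= => /andP[ax xb]; apply: (between Ia Ib); rewrite !ltW.
apply: (@lt_le_trans _ _ (m i `]a, b[%classic)).
  apply: mpos => //.
  by exists ((a + b) / 2); rewrite /= in_itv /=; apply/andP; split; lra.
have [mg _ _] := Bg.
have mgg : measurable_fun setT (fun x => (g x * g x)%:E).
  by apply/measurable_EFinP; exact: measurable_funM.
rewrite -[leLHS]mul1e -integral_cst//.
apply: (@le_trans _ _ (\int[m i]_(x in `]a, b[) (g x * g x)%:E)%E).
  apply: ge0_le_integral => //; first exact: measurable_funTS.
  move=> x /=; rewrite in_itv /= => /andP[ax xb].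
  by rewrite g1 ?mulr1// !ltW.
by apply: ge0_subset_integral => // x _; rewrite lee_fin -expr2 sqr_ge0.
Qed.

(** Finite energy of one tensor product bounds [phi] of its [i]-th factor linearly in time, so that
    factor is in the one-dimensional form; being [x - c] on [[a, b]], it is a test function for
    [square_variation_le]. *)
Lemma bounded_of_domain :
  (forall f, Ccinfty (E : set 'rV[R]_d) f -> dirichlet_domain E mE (cartesian_product p) f) ->
  forall i a b, I i a -> I i b -> a < b ->
    exists C, square_variation_bounded (t i) (s i a) (s i b) C.
Proof.
move=> dom i a b Ia Ib ab.
(* Four increasing points of [I j]: the cut-off is 1 between the middle two and 0 outside the outer
   two. For [j = i] the middle two are [a] and [b]. *)
have /choice[q hq] : forall j, exists q : (R * R) * (R * R),
    [/\ [/\ I j q.1.1, I j q.1.2, I j q.2.1 & I j q.2.2],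
        [/\ q.1.1 < q.1.2, q.1.2 < q.2.1 & q.2.1 < q.2.2] &
        j = i -> q.1.2 = a /\ q.2.1 = b].
  move=> j; have [x [y [Ix Iy xy jxy]]] : exists x y, [/\ I j x, I j y, x < y &
      j = i -> x = a /\ y = b].
    have [->|ji] := eqVneq j i; first by exists a, b.
    have [_ _ [x Ix]] := oI j.
    have [a' [b' [Ia' Ib' _ _ /andP[ax xb]]]] := interval_around (oI j) Ix ltr01.
    by exists a', b'; split => //; [exact: lt_trans xb|move=> /eqP; rewrite (negbTE ji)].
  have [x' [_ [Ix' _ _ _ /andP[xx' _]]]] := interval_around (oI j) Ix ltr01.
  have [_ [y' [_ Iy' _ _ /andP[_ yy']]]] := interval_around (oI j) Iy ltr01.
  by exists ((x', x), (y, y')).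
have /choice[chi hchi] : forall j, exists chi : R -> R, [/\ forall n, Ck n chi,
    forall x, 0 <= chi x <= 1, forall x, (q j).1.2 <= x <= (q j).2.1 -> chi x = 1 &
    forall x, ~ ((q j).1.1 <= x <= (q j).2.2) -> chi x = 0].
  move=> j; have [_ [q1 q2 q3] _] := hq j.
  exact: smooth_cutoff q1 (ltW q2) q3.
pose w j := (q j).2.2 - (q j).1.1.
(* Subtracting the left end of the support keeps the [i]-th factor nonnegative, as the product
   formula for [phi] demands. *)
pose g j x := if j == i then (x - (q j).1.1) * chi j x else chi j x.
have gC j n : Ck n (g j).
  have [chiC _ _ _] := hchi j; rewrite /g; case: (j == i); last exact: chiC.
  by apply: CkM; [apply: CkD; [exact: Ck_id|exact: Ck_cst]|exact: chiC].
have g_out j x : ~ ((q j).1.1 <= x <= (q j).2.2) -> g j x = 0.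
  by have [_ _ _ h] := hchi j; move=> /h hx; rewrite /g hx mulr0 if_same.
have g0 j x : 0 <= g j x.
  have [xq|xq] := pselect ((q j).1.1 <= x <= (q j).2.2); last by rewrite g_out.
  have [_ /(_ x)/andP[c0 _] _ _] := hchi j; move/andP: xq => [qx _].
  by rewrite /g; case: ifP => // _; rewrite mulr_ge0// subr_ge0.
have g_le j x : `|g j x| <= Num.max 1 (w j).
  rewrite ger0_norm// /g; have [_ /(_ x)/andP[c0 c1] _ co] := hchi j.
  case: ifP => _; last by rewrite le_max c1.
  rewrite le_max; apply/orP; right.
  have [xq|xq] := pselect ((q j).1.1 <= x <= (q j).2.2); last first.
    rewrite co// mulr0 subr_ge0; have [_ [q1 q2 q3] _] := hq j.
    by rewrite ltW// (lt_trans q1)// (lt_trans q2).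
  move/andP: xq => [x1 x2]; apply: (@le_trans _ _ (x - (q j).1.1)).
    by rewrite ler_piMr// subr_ge0.
  by rewrite lerD2r.
have sm j := ssg_sfm (H j).
have Bg j : bL1 (m j) (g j).
  have [[I1 _ _ I2] _ _] := hq j.
  apply: (@bL1_bounded_support R _ R (m j) `[(q j).1.1, (q j).2.2]%classic _ (Num.max 1 (w j))) => //.
  - exact: (speed_itv_fin (oI j) (hm j)).
  - apply: continuous_measurable_fun => x; apply: differentiable_continuous.
    exact/derivable1_diffP/(@Ck_derivable _ 1 _ (gC j 1) 0 x).
  - by move=> x; rewrite /= in_itv; exact: g_out.
have BT := tensorf_bL1 H Bg g0.
have CT : Ccinfty (E : set 'rV[R]_d) (tensorf g).
  apply: (@tensorf_Ccinfty R d I (fun j => (q j).1.1) (fun j => (q j).2.2)) => //.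
  - by move=> j; case: (oI j).
  - by move=> j; have [[]] := hq j.
  - by move=> j; have [[]] := hq j.
have [e /product_dirichletP he] := dom _ CT.
have {}he := he BT.
have T0 x : ~ E x -> tensorf g x = 0.
  move=> /existsNP[j nj]; rewrite /tensorf (bigD1 j)//= g_out ?mul0r// => xq.
  by have [[I1 _ _ I2] _ _] := hq j; apply: nj; exact: (between I1 I2 xq).
have le_e := phi_le_limit HP BT (he T0).
pose P := \prod_(j < d | j != i) ip (m j) (g j) (g j).
(* Each cut-off is 1 on a nondegenerate interval, which the speed measure charges; one may therefore
   divide by [P]. *)
have P0 : 0 < P.
  apply: prodr_gt0 => j ji; have [[_ I1 I2 _] [_ q2 _] _] := hq j.
  apply: (ip_gt0 I1 I2 q2 (Bg j)) => x xq.
  by rewrite /g (negbTE ji); have [_ _ -> ] := hchi j.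
have [ei hei] : exists ei : R, (fun r => phi (m i) (K i) r (g i) / r) @ (0 : R)^'+ --> ei.
  apply: (@phi_cvg _ _ _ _ _ (H i) _ (e / P) 1 (Bg i) ltr01) => r /andP[r0 _].
  rewrite mulrAC ler_pdivlMr//.
  exact: le_trans (phi_le_tensorf H Bg g0 i r0) (le_e r r0).
have [[I1 _ _ I2] _ /(_ erefl)[qa qb]] := hq i.
have gi0 x : ~ I i x -> g i x = 0.
  by move=> nx; apply: g_out => xq; apply: nx; exact: (between I1 I2 xq).
have /(minimal_dirichletP (oI i) (hm i) (hX i) _ (Bg i) gi0) mf := hei.
exists (8 * ei) => n l r lr no.
apply: (@square_variation_le _ _ _ _ (oI i) (hs i) (hm i) _ _ a b (q i).1.1 mf) => // x xab.
by rewrite /g eqxx; have [_ _ -> ] := hchi i; rewrite ?mulr1// qa qb.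
Qed.

End product_form.

Theorem lemma2p4 (R : realType) (d : nat) (hd : (2 <= d)%N)
    (I : 'I_d -> set R) (s : 'I_d -> R -> R)
    (m : 'I_d -> {measure set R -> \bar R})
    (p : 'I_d -> R -> R.-spker R ~> R)
    (hI : forall i, open_interval (I i))
    (hs : forall i, scaling_function (I i) (s i))
    (hm : forall i, speed_measure (I i) (m i))
    (hX : forall i, minimal_diffusion (I i) (s i) (m i) (p i)) :
  let E : set (borelV R d) := box I in
  let mE : set (borelV R d) -> \bar R :=
    prod_measure (fun i => (m i : set R -> \bar R)) in
  let t i := scale_inv (I i) (s i) in
  let J i := s i @` I i in
  let U := box J in
  (forall f : 'rV[R]_d -> R, Ccinfty E f ->
     dirichlet_domain E mE (cartesian_product p) f)
  <->
  ((forall i, abs_continuous_on (J i) (t i)) /\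
   L2loc U (fun y => \row_i derive1 (t i) (y ord0 i))).
Proof.
move=> E mE t J U; split=> [dom|[ac l2] f].
  have sv := bounded_of_domain hI hs hm hX dom.
  split=> [i al be sub eps eps0|].
    have [albe|beal] := ltP al be; last first.
      exists 1 => // n l r lr _ _; rewrite big1// => k _.
      have [h1 [h2 h3]] := lr k.
      have -> : r k = l k by apply/le_anti; rewrite h2 (le_trans h3)// (le_trans beal).
      by rewrite subrr normr0.
    have [a Ia sa] : J i al by apply: sub; rewrite /= in_itv /= lexx ltW.
    have [b Ib sb] : J i be by apply: sub; rewrite /= in_itv /= lexx ltW.
    have ab : a < b by rewrite -(scale_lt (hs i) Ia Ib) sa sb.
    have [C hC] := sv i a b Ia Ib ab; rewrite sa sb in hC.
    exact: (square_variation_abs hC eps0).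
  apply: scale_inv_L2loc => // i a b Ia Ib ab.
  have [C hC] := sv i a b Ia Ib ab.
  have sab : s i a < s i b by rewrite (scale_lt (hs i)).
  have sub : `[s i a, s i b]%classic `<=` J i.
    by move=> y /=; rewrite in_itv /= => yab; have [] := scale_between (hI i) (hs i) Ia Ib yab.
  have oJ := scale_image_open (hI i) (hs i).
  have ct : {in J i, continuous (t i)}.
    by move=> y /set_mem; exact: (scale_inv_continuous (hI i) (hs i)).
  rewrite integral_itv_bndoo.
    exact: (square_variation_derive1 sab hC oJ ct sub).
  apply/measurable_EFinP; apply: measurable_funX.
  apply: (@measurable_funS _ _ _ _ (J i)); first exact: open_measurable.
    by move=> y yab; apply: sub; exact: subset_itv_oo_cc yab.
  exact: measurable_derive1.
apply: domain_of_square_integrable => // i a b Ia Ib ab.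
exact: (L2loc_scale_inv hI hs l2 Ia Ib ab).
Qed.
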